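(* Let $(\mathbb E;Q,B;M)$ be a metric VB-algebroid $(\mathbb E\to Q,B\to M)$ and $(D;U,B';M)\subseteq\mathbb E$ a maximal isotropic double vector subbundle with sides $U\subseteq Q$ and $B'\subseteq B$. Choose a Lagrangian splitting of $\mathbb E$ that is adapted to $D$ and consider the corresponding self-dual $2$-representation $(\partial_Q:Q^*\to Q,\nabla^Q,\nabla^{Q^*},R)$ of $B$. Then $D\to U$ is a subalgebroid of $\mathbb E\to Q$ if and only if 1. $\partial_Q(U^\circ)\subseteq U$, 2. $\nabla^Q_bu\in\Gamma(U)$ for all $u\in\Gamma(U)$ and $b\in\Gamma(B')$, 3. $[b_1,b_2]\in\Gamma(B')$ for all $b_1,b_2\in\Gamma(B')$, 4. $R(b_1,b_2)$ restricts to a section of $\mathrm{Hom}(U,U^\circ)$ for all $b_1,b_2\in\Gamma(B')$.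
   Context: $U^\circ\subseteq Q^*$ is the annihilator of $U$. **Double vector bundles.** $(\mathbb E;Q,B;M)$: commutative square of vector bundles $\pi_Q:\mathbb E\to Q$, $\pi_B:\mathbb E\to B$, $q_Q:Q\to M$, $B\to M$ such that the structure maps of $\mathbb E\to B$ are vector bundle morphisms over those of $Q\to M$; core $C=\ker\pi_Q\cap\ker\pi_B$. Core sections of $\mathbb E\to Q$: $c^\dagger(q_m)=0_{q_m}+_B\overline{c(m)}$, $c\in\Gamma(C)$; linear sections of $\mathbb E\to Q$: sections that are vector bundle morphisms $(Q\to M)\to(\mathbb E\to B)$ over some $b\in\Gamma(B)$; for $\phi\in\Gamma(\mathrm{Hom}(Q,C))$, $\widetilde\phi(q_m)=0_{q_m}+_B\overline{\phi(q_m)}$. Linear splitting $\Sigma:Q\times_MB\to\mathbb E$: injective double vector bundle morphism over the identities on the sides; $\sigma_B(b)(q_m)=\Sigma(q_m,b(m))$. Duals: $\mathbb E^*_Q$ (over $Q$; sides $Q,C^*$, core $B^*$) and $\mathbb E^*_B$ (over $B$; sides $B,C^*$, core $Q^*$), in duality over $C^*$ by $(\Phi,\Psi)\mapsto\langle\Phi,d\rangle_Q-\langle\Psi,d\rangle_B$ for any $d\in\mathbb E$ with $\pi_Q(d)=\pi_Q(\Phi)$, $\pi_B(d)=\pi_B(\Psi)$. **Metric double vector bundle**: symmetric nondegenerate pairing on $\mathbb E\to B$ such that the induced $\boldsymbol\beta:\mathbb E\to\mathbb E^*_B$ is an isomorphism of double vector bundles; core identified with $Q^*$. Lagrangian splitting: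 image maximal isotropic in $\mathbb E\to B$. A double vector subbundle $D$ over the sides $B'\subseteq B$, $U\subseteq Q$ is maximal isotropic if its fibres over points of $B'$ are maximal isotropic in those of $\mathbb E\to B$; its core is then $U^\circ$. A splitting is adapted to $D$ if $\Sigma(U\times_MB')\subseteq D$. **VB-algebroid** $(\mathbb E\to Q;B\to M)$: Lie algebroid $\mathbb E\to Q$ with anchor $\mathbb E\to TQ$ a double vector bundle morphism over some $\rho_B:B\to TM$ and linear bracket (linear/linear gives linear, linear/core gives core, core/core gives $0$); $B$ is then a Lie algebroid. A splitting defines a $2$-representation of $B$ on $\partial_Q:Q^*\to Q$ by: the anchor of $\tau^\dagger$ is the vertical lift $(\partial_Q\tau)^\uparrow$; the anchor of $\sigma_B(b)$ is $\widehat{\nabla^Q_b}$, where for a derivation $D$ of $\Gamma(Q)$ over $X$, $\widehat D(q_Q^*f)=q_Q^*(Xf)$, $\widehat D(\ell_\tau)=\ell_{D^*\tau}$ ($\ell_\tau$ the linear function of $\tau\in\Gamma(Q^* )$); $[\sigma_B(b),\tau^\dagger]=(\nabla^{Q^*}_b\tau)^\dagger$; $[\sigma_B(b_1),\sigma_B(b_2)]=\sigma_B[b_1,b_2]-\widetilde{R(b_1,b_2)}$, $R\in\Omega^2(B,\mathrm{Hom}(Q,Q^* ))$. It is self-dual if $\partial_Q=\partial_Q^*$, $\nabla^Q$ and $\nabla^{Q^*}$ are dual and $R^*=-R$. **Metric VB-algebroid**: a VB-algebroid $(\mathbb E\to Q;B\to M)$ on a metric double vector bundle such that $\boldsymbol\beta$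 is an isomorphism of VB-algebroids onto $(\mathbb E^*_B\to Q^{**}=Q;B\to M)$; this dual VB-algebroid is obtained from the linear Poisson structure on $\mathbb E^*_Q$ dual to $\mathbb E\to Q$, which is also linear over $Q^{**}$, by dualising over $Q^{**}$ and identifying this dual with $\mathbb E^*_B$ by the pairing above. Lagrangian splittings of metric VB-algebroids define self-dual $2$-representations. *)

(* Defs.v *)
From HB Require Import structures.
From mathcomp Require Import all_boot all_order all_algebra.
From mathcomp Require Import all_classical all_reals all_analysis.
Set Implicit Arguments.
Unset Strict Implicit.
Unset Printing Implicit Defensive.
Import Order.TTheory GRing.Theory Num.Theory.
Import numFieldNormedType.Exports.
Local Open Scope classical_set_scope.
Local Open Scope ring_scope.

(* Conventions.
   A smooth manifold is a set of points together with its algebra of smooth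
   functions (a differential space in the sense of Sikorski) which is Hausdorff,
   second countable and locally diffeomorphic to R^n.  Fibre products, dual
   bundles and submanifolds carry the induced differential structures.
   Fibrewise operations are total functions; their values matter only on
   arguments in a common fibre. *)

Section Smooth.
Variable R : realType.

Fixpoint Ck (n k : nat) (O : set 'rV[R]_n) (f : 'rV[R]_n -> R) : Prop :=
  match k with
  | 0%N => forall x, O x -> {for x, continuous f}
  | k'.+1 => (forall x, O x -> differentiable f x) /\
             forall i : 'I_n, Ck k' O (fun x => 'D_(delta_mx 0 i) f x)
  end.

Definition smooth_fun_on (n : nat) (O : set 'rV[R]_n) (f : 'rV[R]_n -> R) :=
  forall k, Ck k O f.

Record diffspace := DiffSpace { pts :> Type; Cinf : set (pts -> R) }.

(* The differential structure generated by G: the functions that near every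
   point p are smooth functions of finitely many members of G; "near p" refers
   to the initial topology of G. *)
Definition generated (T : Type) (G : set (T -> R)) : set (T -> R) :=
  [set f | forall p, exists n (g : 'I_n -> T -> R) (phi : 'rV[R]_n -> R) (eps : R),
     [/\ 0 < eps, forall i, G (g i), smooth_fun_on setT phi &
         forall x, (forall i, `|g i x - g i p| < eps) ->
           f x = phi (\row_i g i x)]].

Definition RnD (n : nat) : diffspace :=
  @DiffSpace 'rV[R]_n (smooth_fun_on setT).

Definition RD : diffspace :=
  @DiffSpace R [set f | forall k (x : R), derivable (derive1n k f) x 1].

Definition prodD (X Y : diffspace) : diffspace :=
  @DiffSpace (X * Y)%type
    (generated ([set h | exists2 f, @Cinf X f & h = fun z => f z.1] `|`
                [set h | exists2 f, @Cinf Y f & h = fun z => f z.2])).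

Definition subD (X : diffspace) (S : set X) : diffspace :=
  @DiffSpace {x : X | S x}
    (generated [set h | exists2 f, @Cinf X f & h = fun z => f (sval z)]).

Definition smooth (X Y : diffspace) (f : X -> Y) :=
  forall g, @Cinf Y g -> @Cinf X (fun x => g (f x)).

Definition diffeo (X Y : diffspace) (f : X -> Y) :=
  smooth f /\ exists g : Y -> X, [/\ smooth g, cancel f g & cancel g f].

Definition openD (X : diffspace) (W : set X) :=
  forall p, W p -> exists n (g : 'I_n -> X -> R) (eps : R),
    [/\ 0 < eps, forall i, Cinf (g i) &
        forall x, (forall i, `|g i x - g i p| < eps) -> W x].

Definition Cinf_on (X : diffspace) (W : set X) (f : X -> R) :=
  forall p, W p -> exists (h : X -> R) (V : set X),
    [/\ Cinf h, openD V, V p & forall x, V x -> f x = h x].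

Definition smooth_on (X Y : diffspace) (W : set X) (f : X -> Y) :=
  forall g, @Cinf Y g -> Cinf_on W (fun x => g (f x)).

Definition chart (X : diffspace) (n : nat) (W : set X) (O : set 'rV[R]_n)
    (x : X -> 'rV[R]_n) (y : 'rV[R]_n -> X) :=
  [/\ openD W, open O,
      (forall p, W p -> O (x p) /\ y (x p) = p),
      (forall a, O a -> W (y a) /\ x (y a) = a) &
      smooth_on (Y := RnD n) W x /\
      forall f, Cinf f -> smooth_fun_on O (fun a => f (y a))].

Definition manifold (X : diffspace) :=
  [/\ @generated X (@Cinf X) `<=` @Cinf X,
      (forall p q : X, p <> q -> exists V W : set X,
         [/\ openD V, openD W, V p, W q & V `&` W = set0]),
      (exists W : nat -> set X, (forall i, openD (W i)) /\
         forall V p, openD V -> V p -> exists i, W i p /\ W i `<=` V) &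
      exists n, forall p : X, exists W (O : set 'rV[R]_n) x y, chart W O x y /\ W p].

(* Tangent vectors are velocities of smooth curves, viewed as functionals on
   smooth functions. *)
Definition velocity (X : diffspace) (gamma : R -> X) (f : X -> R) : R :=
  derive1 (fun t => f (gamma t)) 0.

Definition curve_at (X : diffspace) (p : X) (gamma : R -> X) :=
  smooth (X := RD) gamma /\ gamma 0 = p.

Definition represents (X : diffspace) (gamma : R -> X) (v : (X -> R) -> R) :=
  forall f, Cinf f -> v f = velocity gamma f.

Definition tangent_at (X : diffspace) (p : X) (v : (X -> R) -> R) :=
  exists2 gamma, curve_at p gamma & represents gamma v.

End Smooth.

Section VectorBundles.
Variable R : realType.
Implicit Types E M : diffspace R.

Record vbundle E M := VBundle {
  vproj : E -> M;
  vzero : M -> E;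
  vadd : E -> E -> E;
  vscale : R -> E -> E }.

Definition Gamma E M (p : E -> M) (s : M -> E) :=
  smooth s /\ forall m, p (s m) = m.

Definition fibre_space E M (V : vbundle E M) :=
  [/\ [/\ (forall m, vproj V (vzero V m) = m),
      (forall e e', vproj V e = vproj V e' -> vproj V (vadd V e e') = vproj V e) &
      (forall a e, vproj V (vscale V a e) = vproj V e)],
      [/\ (forall e e', vproj V e = vproj V e' -> vadd V e e' = vadd V e' e),
      (forall e1 e2 e3, vproj V e1 = vproj V e2 -> vproj V e2 = vproj V e3 ->
         vadd V e1 (vadd V e2 e3) = vadd V (vadd V e1 e2) e3),
      (forall e, vadd V (vzero V (vproj V e)) e = e) &
      (forall e, vadd V e (vscale V (-1) e) = vzero V (vproj V e))] &
      [/\ (forall e, vscale V 1 e = e),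
      (forall a b e, vscale V a (vscale V b e) = vscale V (a * b) e),
      (forall a b e, vscale V (a + b) e = vadd V (vscale V a e) (vscale V b e)) &
      (forall a e e', vproj V e = vproj V e' ->
         vscale V a (vadd V e e') = vadd V (vscale V a e) (vscale V a e'))]].

(* A local trivialization t : W x R^k -> E over W, with inverse (vproj, c). *)
Definition trivialization E M (V : vbundle E M) (k : nat) (W : set M)
    (t : M -> 'rV[R]_k -> E) (c : E -> 'rV[R]_k) :=
  [/\ openD W,
      (forall m a, W m -> vproj V (t m a) = m /\ c (t m a) = a),
      (forall e, W (vproj V e) -> t (vproj V e) (c e) = e),
      (forall m a b r, W m -> t m (a + b) = vadd V (t m a) (t m b) /\
                              t m (r *: a) = vscale V r (t m a)) &
      smooth_on (X := prodD M (RnD R k)) [set z | W z.1] (fun z => t z.1 z.2) /\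
      smooth_on (Y := RnD R k) (vproj V @^-1` W) c].

Definition vector_bundle E M (V : vbundle E M) :=
  [/\ manifold E, manifold M, smooth (vproj V), fibre_space V &
      exists k, forall m : M, exists W (t : M -> 'rV[R]_k -> E) c,
        trivialization V W t c /\ W m].

(* D is a vector subbundle of V over the submanifold U of the base. *)
Definition subbundle E M (V : vbundle E M) (D : set E) (U : set M) :=
  (forall e, D e -> U (vproj V e)) /\
  exists k r, forall m, U m -> exists W (t : M -> 'rV[R]_k -> E) c,
    [/\ trivialization V W t c, W m &
        forall e, W (vproj V e) -> U (vproj V e) ->
          (D e <-> forall j : 'I_k, (r <= j)%N -> c e 0 j = 0)].

Definition vb_morphism E M E' M' (V : vbundle E M) (V' : vbundle E' M')
    (F : E -> E') (f : M -> M') :=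
  [/\ smooth F, smooth f, (forall e, vproj V' (F e) = f (vproj V e)),
      (forall e e', vproj V e = vproj V e' -> F (vadd V e e') = vadd V' (F e) (F e')) &
      (forall a e, F (vscale V a e) = vscale V' a (F e))].

Definition addS E M (V : vbundle E M) (s s' : M -> E) := fun m => vadd V (s m) (s' m).
Definition scaleS E M (V : vbundle E M) (f : M -> R) (s : M -> E) :=
  fun m => vscale V (f m) (s m).

(* The dual of the bundle of vector spaces S_m = S /\ vproj^-1(m): a point over m
   is a linear functional on S_m, extended by 0 to E. *)
Definition linear_at E M (V : vbundle E M) (S : set E) (m : M) (psi : E -> R) :=
  (forall e e', S e -> S e' -> vproj V e = m -> vproj V e' = m ->
     psi (vadd V e e') = psi e + psi e') /\
  (forall a e, S e -> vproj V e = m -> psi (vscale V a e) = a * psi e).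

Record dual_pt E M (V : vbundle E M) (S : set E) := DualPt {
  dbase : M;
  dval :> E -> R;
  dlin : linear_at V S dbase dval;
  doff : forall e, ~ (S e /\ vproj V e = dbase) -> dval e = 0 }.

Definition cut E M (V : vbundle E M) (S : set E) (m : M) (psi : E -> R) : E -> R :=
  fun e => if `[< S e /\ vproj V e = m >] then psi e else 0.

Lemma cut_off E M (V : vbundle E M) S m psi e :
  ~ (S e /\ vproj V e = m) -> cut V S m psi e = 0.
Proof. by rewrite /cut; case: asboolP. Qed.

Lemma linear_at0 E M (V : vbundle E M) S m : linear_at V S m (fun=> 0).
Proof. by split=> *; rewrite ?addr0 ?mulr0. Qed.

(* mkdual m psi is the restriction of psi to S_m whenever that is linear. *)
Definition mkdual E M (V : vbundle E M) (S : set E) (m : M) (psi : E -> R) :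
    dual_pt V S :=
  match pselect (linear_at V S m (cut V S m psi)) with
  | left lin => DualPt lin (@cut_off E M V S m psi)
  | right _ => DualPt (linear_at0 V S m) (fun _ _ => erefl)
  end.

Definition ev E M (V : vbundle E M) (S : set E) (s : M -> E) (Phi : dual_pt V S) : R :=
  Phi (s (dbase Phi)).

Definition dual E M (V : vbundle E M) (S : set E) : diffspace R :=
  @DiffSpace R (dual_pt V S)
    (generated ([set h | exists2 f, @Cinf R M f & h = fun Phi => f (dbase Phi)] `|`
                [set h | exists2 s, Gamma (vproj V) s /\ (forall m, S (s m)) &
                                    h = ev s])).

Definition dual_vb E M (V : vbundle E M) (S : set E) : vbundle (dual V S) M :=
  @VBundle (dual V S) M (@dbase E M V S)
    (fun m => mkdual V S m (fun=> 0))
    (fun P1 P2 => mkdual V S (dbase P1) (fun e => P1 e + P2 e))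
    (fun a P1 => mkdual V S (dbase P1) (fun e => a * P1 e)).

(* The addition and scalar multiplication of the tangent prolongation
   TE -> TM of E -> M, obtained by applying the tangent functor to those of
   E -> M: u, v at e, e' have the same image in TM and w is their sum. *)
Definition tangent_add E M (V : vbundle E M) (e e' : E) (u v w : (E -> R) -> R) :=
  exists gamma gamma' : R -> E,
    [/\ curve_at e gamma, curve_at e' gamma',
        (forall t, vproj V (gamma t) = vproj V (gamma' t)),
        represents gamma u /\ represents gamma' v &
        represents (fun t => vadd V (gamma t) (gamma' t)) w].

Definition tangent_scale E M (V : vbundle E M) (a : R) (e : E) (u w : (E -> R) -> R) :=
  exists gamma : R -> E,
    [/\ curve_at e gamma, represents gamma u &
        represents (fun t => vscale V a (gamma t)) w].

Record lie_ops E M := LieOps {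
  anchor : E -> (M -> R) -> R;
  bracket : (M -> E) -> (M -> E) -> (M -> E) }.

Definition anchorS E M (L : lie_ops E M) (s : M -> E) (f : M -> R) : M -> R :=
  fun m => anchor L (s m) f.

Definition lie_algebroid E M (V : vbundle E M) (L : lie_ops E M) :=
  let G := Gamma (vproj V) in
  vector_bundle V /\
  [/\ (forall e, tangent_at (vproj V e) (anchor L e)),
      (forall e e' f, vproj V e = vproj V e' -> Cinf f ->
         anchor L (vadd V e e') f = anchor L e f + anchor L e' f),
      (forall a e f, Cinf f -> anchor L (vscale V a e) f = a * anchor L e f) &
      (forall s f, G s -> Cinf f -> Cinf (anchorS L s f))] /\
  [/\ (forall s s', G s -> G s' -> G (bracket L s s')),
      (forall s s1 s2, G s -> G s1 -> G s2 ->
         bracket L s (addS V s1 s2) = addS V (bracket L s s1) (bracket L s s2)),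
      (forall s s', G s -> G s' ->
         bracket L s s' = scaleS V (fun=> -1) (bracket L s' s)),
      (forall s1 s2 s3, G s1 -> G s2 -> G s3 ->
         bracket L s1 (bracket L s2 s3) =
         addS V (bracket L (bracket L s1 s2) s3) (bracket L s2 (bracket L s1 s3))) &
      (forall s s' f, G s -> G s' -> Cinf f ->
         bracket L s (scaleS V f s') =
         addS V (scaleS V f (bracket L s s')) (scaleS V (anchorS L s f) s'))] /\
  (forall s s' f, G s -> G s' -> Cinf f ->
     anchorS L (bracket L s s') f =
     anchorS L s (anchorS L s' f) \- anchorS L s' (anchorS L s f)).

Definition lie_subalgebroid E M (V : vbundle E M) (L : lie_ops E M)
    (D : set E) (U : set M) :=
  [/\ subbundle V D U,
      (forall e, D e -> exists gamma,
         [/\ curve_at (vproj V e) gamma, forall t, U (gamma t) &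
             represents gamma (anchor L e)]) &
      (forall s s', Gamma (vproj V) s -> Gamma (vproj V) s' ->
         (forall q, U q -> D (s q)) -> (forall q, U q -> D (s' q)) ->
         forall q, U q -> D (bracket L s s' q))].

Definition poisson_bracket (X : diffspace R)
    (P : (X -> R) -> (X -> R) -> (X -> R)) :=
  [/\ [/\ (forall f g, Cinf f -> Cinf g -> Cinf (P f g)),
          (forall f g, Cinf f -> Cinf g -> P f g = \- P g f) &
          (forall f g h, Cinf f -> Cinf g -> Cinf h -> P f (g \+ h) = P f g \+ P f h)],
      (forall f g (a : R), Cinf f -> Cinf g ->
         P f (fun x => a * g x) = fun x => a * P f g x),
      (forall f g h, Cinf f -> Cinf g -> Cinf h ->
         P f (fun x => g x * h x) = fun x => P f g x * h x + g x * P f h x) &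
      (forall f g h, Cinf f -> Cinf g -> Cinf h ->
         P f (P g h) = P (P f g) h \+ P g (P f h))].

(* The linear Poisson structure on the dual bundle of a Lie algebroid. *)
Definition dual_poisson E M (V : vbundle E M) (L : lie_ops E M)
    (P : (dual V setT -> R) -> (dual V setT -> R) -> (dual V setT -> R)) :=
  let G := Gamma (vproj V) in
  [/\ poisson_bracket P,
      (forall s s', G s -> G s' -> P (@ev _ _ V _ s) (@ev _ _ V _ s') =
                                   @ev _ _ V setT (bracket L s s')),
      (forall s f, G s -> Cinf f ->
         P (@ev _ _ V _ s) (fun Phi => f (dbase Phi)) =
         fun Phi => anchor L (s (dbase Phi)) f) &
      (forall f g, Cinf f -> Cinf g ->
         P (fun Phi => f (dbase Phi)) (fun Phi => g (dbase Phi)) = fun=> 0)].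

(* Linear connections of an anchored bundle A -> M on a vector bundle. *)
Definition connection A E M (VA : vbundle A M) (LA : lie_ops A M) (V : vbundle E M)
    (nabla : (M -> A) -> (M -> E) -> (M -> E)) :=
  let GA := Gamma (vproj VA) in let G := Gamma (vproj V) in
  [/\ (forall b s, GA b -> G s -> G (nabla b s)),
      (forall b b' s, GA b -> GA b' -> G s ->
         nabla (addS VA b b') s = addS V (nabla b s) (nabla b' s)),
      (forall b s s', GA b -> G s -> G s' ->
         nabla b (addS V s s') = addS V (nabla b s) (nabla b s')),
      (forall f b s, Cinf f -> GA b -> G s ->
         nabla (scaleS VA f b) s = scaleS V f (nabla b s)) &
      (forall f b s, Cinf f -> GA b -> G s ->
         nabla b (scaleS V f s) =
         addS V (scaleS V f (nabla b s)) (scaleS V (anchorS LA b f) s))].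

End VectorBundles.

Record dvb (R : realType) := Dvb {
  tE : diffspace R; tQ : diffspace R; tB : diffspace R; tM : diffspace R;
  vQ : vbundle tE tQ; vB : vbundle tE tB;
  qQ : vbundle tQ tM; qB : vbundle tB tM }.

Section DoubleVectorBundles.
Variables (R : realType) (X : dvb R).
Let E := tE X.
Let Q := tQ X.
Let B := tB X.
Let M := tM X.

Definition double_vector_bundle :=
  [/\ [/\ vector_bundle (vQ X), vector_bundle (vB X),
          vector_bundle (qQ X) & vector_bundle (qB X)],
      vb_morphism (vQ X) (qB X) (vproj (vB X)) (vproj (qQ X)),
      vb_morphism (qB X) (vQ X) (vzero (vB X)) (vzero (qQ X)),
      (forall a : R, vb_morphism (vQ X) (vQ X) (vscale (vB X) a) (vscale (qQ X) a)) &
      (* addition, from E x_B E -> Q x_M Q to E -> Q over the addition of Q *)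
      [/\ (forall e e' : E, vproj (vB X) e = vproj (vB X) e' ->
             vproj (vQ X) (vadd (vB X) e e') =
             vadd (qQ X) (vproj (vQ X) e) (vproj (vQ X) e')),
          (forall e1 e2 e3 e4 : E,
             vproj (vB X) e1 = vproj (vB X) e2 -> vproj (vB X) e3 = vproj (vB X) e4 ->
             vproj (vQ X) e1 = vproj (vQ X) e3 -> vproj (vQ X) e2 = vproj (vQ X) e4 ->
             vadd (vB X) (vadd (vQ X) e1 e3) (vadd (vQ X) e2 e4) =
             vadd (vQ X) (vadd (vB X) e1 e2) (vadd (vB X) e3 e4)) &
          (forall (a : R) (e e' : E), vproj (vB X) e = vproj (vB X) e' ->
             vadd (vB X) (vscale (vQ X) a e) (vscale (vQ X) a e') =
             vscale (vQ X) a (vadd (vB X) e e'))]].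

Definition core : set E :=
  [set e | exists m : M, vproj (vQ X) e = vzero (qQ X) m /\ vproj (vB X) e = vzero (qB X) m].

(* The vector bundle structure of the core over M, on the points of core. *)
Definition core_vb : vbundle E M :=
  @VBundle R E M (fun e => vproj (qQ X) (vproj (vQ X) e))
    (fun m => vzero (vQ X) (vzero (qQ X) m)) (vadd (vQ X)) (vscale (vQ X)).

Definition Gamma_core (c : M -> E) :=
  Gamma (vproj core_vb) c /\ forall m, core (c m).

(* c^dagger and the core-linear section of phi : Q -> C *)
Definition core_section (c : M -> E) : Q -> E :=
  fun q => vadd (vB X) (vzero (vQ X) q) (c (vproj (qQ X) q)).

Definition hom_section (phi : Q -> E) : Q -> E :=
  fun q => vadd (vB X) (vzero (vQ X) q) (phi q).

Definition linear_section (b : M -> B) (s : Q -> E) :=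
  [/\ Gamma (vproj (qB X)) b, Gamma (vproj (vQ X)) s & vb_morphism (qQ X) (vB X) s b].

Definition dvb_subbundle (D : set E) (U : set Q) (B' : set B) :=
  [/\ subbundle (vQ X) D U, subbundle (vB X) D B',
      subbundle (qQ X) U setT & subbundle (qB X) B' setT].

(* Linear splittings Q x_M B -> E; injectivity is forced by the first clause. *)
Definition linear_splitting (Sg : Q -> B -> E) :=
  let over q b := vproj (qQ X) q = vproj (qB X) b in
  [/\ (forall q b, over q b -> vproj (vQ X) (Sg q b) = q /\ vproj (vB X) (Sg q b) = b),
      (forall q q' b, over q b -> over q' b ->
         Sg (vadd (qQ X) q q') b = vadd (vB X) (Sg q b) (Sg q' b)),
      (forall q b b', over q b -> over q b' ->
         Sg q (vadd (qB X) b b') = vadd (vQ X) (Sg q b) (Sg q b')),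
      (forall a q b, over q b ->
         Sg (vscale (qQ X) a q) b = vscale (vB X) a (Sg q b) /\
         Sg q (vscale (qB X) a b) = vscale (vQ X) a (Sg q b)) &
      smooth (X := @subD R (prodD Q B) [set z | over z.1 z.2]) (Y := E)
        (fun z => Sg (sval z).1 (sval z).2)].

Definition sigmaB (Sg : Q -> B -> E) (b : M -> B) : Q -> E :=
  fun q => Sg q (b (vproj (qQ X) q)).

Definition adapted (Sg : Q -> B -> E) (D : set E) (U : set Q) (B' : set B) :=
  forall q b, U q -> B' b -> vproj (qQ X) q = vproj (qB X) b -> D (Sg q b).

Definition EdualQ := dual (vQ X) setT.
Definition EdualB := dual (vB X) setT.
Definition Cdual := dual core_vb core.
Definition Qdual := dual (qQ X) setT.

(* The projections of the two duals onto C^*. *)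
Definition EdualQ_C (Phi : EdualQ) : Cdual :=
  mkdual core_vb core (vproj (qQ X) (dbase Phi))
    (fun c => Phi (vadd (vB X) (vzero (vQ X) (dbase Phi)) c)).

Definition EdualB_C (Psi : EdualB) : Cdual :=
  mkdual core_vb core (vproj (qB X) (dbase Psi))
    (fun c => Psi (vadd (vQ X) (vzero (vB X) (dbase Psi)) c)).

(* Addition and scalar multiplication of E^*_B -> C^*, as relations. *)
Definition EdualB_C_add (Psi1 Psi2 Psi3 : EdualB) :=
  dbase Psi3 = vadd (qB X) (dbase Psi1) (dbase Psi2) /\
  forall d1 d2 : E, vproj (vB X) d1 = dbase Psi1 -> vproj (vB X) d2 = dbase Psi2 ->
    vproj (vQ X) d1 = vproj (vQ X) d2 -> Psi3 (vadd (vQ X) d1 d2) = Psi1 d1 + Psi2 d2.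

Definition EdualB_C_scale (a : R) (Psi1 Psi2 : EdualB) :=
  [/\ dbase Psi2 = vscale (qB X) a (dbase Psi1), EdualB_C Psi2 = EdualB_C Psi1 &
      forall d : E, vproj (vB X) d = dbase Psi1 ->
        Psi2 (vscale (vQ X) a d) = a * Psi1 d].

(* F is the function on E^*_Q, linear over C^*, given by the section Psi of
   E^*_B -> C^* through the pairing <Phi, d>_Q - <Psi, d>_B. *)
Definition ell_EdualB (Psi : Cdual -> EdualB) (F : EdualQ -> R) :=
  forall (Phi : EdualQ) (d : E),
    vproj (vQ X) d = dbase Phi -> vproj (vB X) d = dbase (Psi (EdualQ_C Phi)) ->
    F Phi = Phi d - Psi (EdualQ_C Phi) d.

(* LB is the induced Lie algebroid structure on B -> M. *)
Definition vb_algebroid (L : lie_ops E Q) (LB : lie_ops B M) :=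
  let Z : Q -> E := vzero (vQ X) in
  [/\ double_vector_bundle,
      lie_algebroid (vQ X) L /\ lie_algebroid (qB X) LB,
      (* the anchor E -> TQ is a double vector bundle morphism over that of B *)
      [/\ (forall e f, Cinf f ->
             anchor L e (fun q => f (vproj (qQ X) q)) = anchor LB (vproj (vB X) e) f),
          (forall e e' : E, vproj (vB X) e = vproj (vB X) e' ->
             tangent_add (qQ X) (vproj (vQ X) e) (vproj (vQ X) e')
               (anchor L e) (anchor L e') (anchor L (vadd (vB X) e e'))) &
          (forall (a : R) (e : E),
             tangent_scale (qQ X) a (vproj (vQ X) e)
               (anchor L e) (anchor L (vscale (vB X) a e)))] &
      [/\ (forall b b' s s', linear_section b s -> linear_section b' s' ->
             linear_section (bracket LB b b') (bracket L s s')),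
          (forall b s c, linear_section b s -> Gamma_core c ->
             exists2 c', Gamma_core c' & bracket L s (core_section c) = core_section c') &
          (forall c c', Gamma_core c -> Gamma_core c' ->
             bracket L (core_section c) (core_section c') = Z)]].

(* The Lie algebroid structure on E^*_B -> C^* dual, over C^*, to the Poisson
   structure P on E^*_Q.  The Lie algebroid axioms for L' follow from those of P,
   and so does the linearity of P over C^* (it is what these equations say). *)
Definition dual_lie_over_C
    (P : (EdualQ -> R) -> (EdualQ -> R) -> (EdualQ -> R))
    (L' : lie_ops EdualB Cdual) :=
  (forall Psi Psi', Gamma EdualB_C Psi -> Gamma EdualB_C Psi' ->
     Gamma EdualB_C (bracket L' Psi Psi') /\
     forall F F', ell_EdualB Psi F -> ell_EdualB Psi' F' ->
       ell_EdualB (bracket L' Psi Psi') (P F F')) /\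
  (forall Psi F f Phi, Gamma EdualB_C Psi -> ell_EdualB Psi F -> Cinf f ->
     P F (fun Phi => f (EdualQ_C Phi)) Phi = anchor L' (Psi (EdualQ_C Phi)) f).

Definition dual_vb_algebroid (L : lie_ops E Q) (L' : lie_ops EdualB Cdual) :=
  exists2 P, dual_poisson L P & dual_lie_over_C P L'.

Section Metric.
Variable g : E -> E -> R.

(* The map beta : E -> E^*_B, its side map Q -> C^*, and its core map C -> Q^*
   which identifies the core with Q^*. *)
Definition beta (e : E) : EdualB := mkdual (vB X) setT (vproj (vB X) e) (g e).

Definition beta_Q (q : Q) : Cdual :=
  mkdual core_vb core (vproj (qQ X) q) (fun c => g (vzero (vQ X) q) c).

Definition beta_core (c : E) : Qdual :=
  mkdual (qQ X) setT (vproj core_vb c) (fun q => g c (vzero (vQ X) q)).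

Definition metric_dvb :=
  [/\ double_vector_bundle,
      [/\ (forall e e' : E, vproj (vB X) e = vproj (vB X) e' -> g e e' = g e' e),
          (forall e1 e2 e' : E, vproj (vB X) e1 = vproj (vB X) e2 ->
             vproj (vB X) e2 = vproj (vB X) e' -> g (vadd (vB X) e1 e2) e' = g e1 e' + g e2 e'),
          (forall (a : R) (e e' : E), vproj (vB X) e = vproj (vB X) e' ->
             g (vscale (vB X) a e) e' = a * g e e'),
          (forall e : E, (forall e', vproj (vB X) e = vproj (vB X) e' -> g e e' = 0) ->
             e = vzero (vB X) (vproj (vB X) e)) &
          Cinf (d := @subD R (prodD E E) [set z | vproj (vB X) z.1 = vproj (vB X) z.2])
            (fun z => g (sval z).1 (sval z).2)] &
      (* beta is an isomorphism of double vector bundles over id_B and beta_Q *)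
      [/\ diffeo beta, vb_morphism (vB X) (dual_vb (vB X) setT) beta id,
          diffeo beta_Q /\ vb_morphism (qQ X) (dual_vb core_vb core) beta_Q id,
          (forall e, EdualB_C (beta e) = beta_Q (vproj (vQ X) e)) &
          (forall e e', vproj (vQ X) e = vproj (vQ X) e' ->
             EdualB_C_add (beta e) (beta e') (beta (vadd (vQ X) e e'))) /\
          (forall a e, EdualB_C_scale a (beta e) (beta (vscale (vQ X) a e)))]].

Definition fibre_subspace (b : B) (S : set E) :=
  [/\ (forall e, S e -> vproj (vB X) e = b), S (vzero (vB X) b),
      (forall e e', S e -> S e' -> S (vadd (vB X) e e')) &
      (forall a e, S e -> S (vscale (vB X) a e))].

Definition isotropic (S : set E) := forall e e', S e -> S e' -> g e e' = 0.

Definition maximal_isotropic_fibre (b : B) (S : set E) :=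
  [/\ fibre_subspace b S, isotropic S &
      forall S', fibre_subspace b S' -> isotropic S' -> S `<=` S' -> S' `<=` S].

Definition maximal_isotropic_dvb (D : set E) (U : set Q) (B' : set B) :=
  dvb_subbundle D U B' /\
  forall b, B' b -> maximal_isotropic_fibre b [set e | D e /\ vproj (vB X) e = b].

Definition lagrangian_splitting (Sg : Q -> B -> E) :=
  linear_splitting Sg /\
  forall b, maximal_isotropic_fibre b
    [set e | exists2 q, vproj (qQ X) q = vproj (qB X) b & e = Sg q b].

Definition metric_vb_algebroid (L : lie_ops E Q) (LB : lie_ops B M) :=
  [/\ metric_dvb, vb_algebroid L LB &
      (* beta is an isomorphism onto the dual VB-algebroid L' *)
      exists L', [/\ dual_vb_algebroid L L',
        (forall e f, Cinf f ->
           anchor L e (fun q => f (beta_Q q)) = anchor L' (beta e) f) &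
        (forall s s' Psi Psi', Gamma (vproj (vQ X)) s -> Gamma (vproj (vQ X)) s' ->
           Gamma EdualB_C Psi -> Gamma EdualB_C Psi' ->
           (forall q, Psi (beta_Q q) = beta (s q)) ->
           (forall q, Psi' (beta_Q q) = beta (s' q)) ->
           forall q, bracket L' Psi Psi' (beta_Q q) = beta (bracket L s s' q))]].

Definition vQdual : vbundle Qdual M := dual_vb (qQ X) setT.

Definition GammaQdual (tau : M -> Qdual) := Gamma (vproj vQdual) tau.

(* tau' = D^* tau for a derivation D of Gamma(Q) with symbol Xf *)
Definition dual_derivation (Xf : (M -> R) -> M -> R) (D : (M -> Q) -> (M -> Q))
    (tau tau' : M -> Qdual) :=
  forall u, Gamma (vproj (qQ X)) u -> forall m,
    tau' m (u m) = Xf (fun x => tau x (u x)) m - tau m (D u m).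

(* Q^* is identified with the core C by beta_core: a section c of C and a section
   tau of Q^* correspond when beta_core \o c = tau, and then c^dagger is
   tau^dagger. *)
Definition two_representation (L : lie_ops E Q) (LB : lie_ops B M) (Sg : Q -> B -> E)
    (dQ : Qdual -> Q) (nablaQ : (M -> B) -> (M -> Q) -> (M -> Q))
    (nablaQd : (M -> B) -> (M -> Qdual) -> (M -> Qdual))
    (Rc : B -> B -> Q -> Qdual) :=
  let GB := Gamma (vproj (qB X)) in
  let over3 b b' q := vproj (qB X) b = vproj (qQ X) q /\ vproj (qB X) b' = vproj (qQ X) q in
  [/\ (* the types of the four components *)
      [/\ vb_morphism vQdual (qQ X) dQ id,
          connection (qB X) LB (qQ X) nablaQ,
          connection (qB X) LB vQdual nablaQd &
          [/\ (forall b b' q, over3 b b' q ->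
                 vproj vQdual (Rc b b' q) = vproj (qQ X) q /\
                 Rc b b' q = vscale vQdual (-1) (Rc b' b q)),
              (forall b1 b2 b' q, over3 b1 b' q -> over3 b2 b' q ->
                 Rc (vadd (qB X) b1 b2) b' q = vadd vQdual (Rc b1 b' q) (Rc b2 b' q)),
              (forall b b' q q', over3 b b' q -> over3 b b' q' ->
                 Rc b b' (vadd (qQ X) q q') = vadd vQdual (Rc b b' q) (Rc b b' q')),
              (forall a b b' q, over3 b b' q ->
                 Rc (vscale (qB X) a b) b' q = vscale vQdual a (Rc b b' q) /\
                 Rc b b' (vscale (qQ X) a q) = vscale vQdual a (Rc b b' q)) &
              smooth (X := @subD R (prodD (prodD B B) Q)
                             [set z | over3 z.1.1 z.1.2 z.2]) (Y := Qdual)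
                (fun z => Rc (sval z).1.1 (sval z).1.2 (sval z).2)]],
      (* the anchor of tau^dagger is the vertical lift of dQ tau *)
      (forall tau c, GammaQdual tau -> Gamma_core c ->
         (forall m, beta_core (c m) = tau m) ->
         forall q, represents
           (fun t : R => vadd (qQ X) q (vscale (qQ X) t (dQ (tau (vproj (qQ X) q)))))
           (anchor L (core_section c q))),
      (* the anchor of sigma_B(b) is the linear vector field of nabla^Q_b *)
      (forall b, GB b ->
         (forall f q, Cinf f -> anchor L (sigmaB Sg b q) (fun x => f (vproj (qQ X) x)) =
                                anchorS LB b f (vproj (qQ X) q)) /\
         (forall tau, GammaQdual tau -> exists tau',
            [/\ GammaQdual tau', dual_derivation (anchorS LB b) (nablaQ b) tau tau' &
                forall q, anchor L (sigmaB Sg b q) (fun x => tau (vproj (qQ X) x) x) =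
                          tau' (vproj (qQ X) q) q])),
      (forall b tau c, GB b -> GammaQdual tau -> Gamma_core c ->
         (forall m, beta_core (c m) = tau m) ->
         exists c', [/\ Gamma_core c', (forall m, beta_core (c' m) = nablaQd b tau m) &
                        bracket L (sigmaB Sg b) (core_section c) = core_section c']) &
      (forall b b', GB b -> GB b' -> exists phi : Q -> E,
         [/\ forall q, core (phi q),
             forall q, beta_core (phi q) = Rc (b (vproj (qQ X) q)) (b' (vproj (qQ X) q)) q &
             bracket L (sigmaB Sg b) (sigmaB Sg b') =
             addS (vQ X) (sigmaB Sg (bracket LB b b'))
               (scaleS (vQ X) (fun=> -1) (hom_section phi))])].

End Metric.

Definition annihilator (U : set Q) : set Qdual :=
  [set tau | forall q, U q -> vproj (qQ X) q = dbase tau -> tau q = 0].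

End DoubleVectorBundles.

(* Main.v *)
Require Import Defs.
From mathcomp Require Import all_boot all_order all_algebra.
From mathcomp Require Import all_classical all_reals all_analysis.
From mathcomp Require Import ring.
Set Implicit Arguments.
Unset Strict Implicit.
Unset Printing Implicit Defensive.
Import Order.TTheory GRing.Theory Num.Theory.
Import numFieldNormedType.Exports.
Local Open Scope classical_set_scope.
Local Open Scope ring_scope.

(* A Lagrangian splitting identifies a point e of E with its two projections
   q in Q, b in B and a covector on the fibre of Q, namely u |-> g(e, Sg u b).
   In these terms the metric is g(e, d) = e(q_d) + d(q_e), and for an adapted
   splitting the points of D over U are exactly those with b in B' whose
   covector annihilates U.

   If D is a subalgebroid, the anchors of core sections and of the lifts of
   sections of B', tested on linear functions vanishing on U, give (1) and (2),
   and the two components of the bracket of two lifts give (3) and (4).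
   Conversely (1) and (2) say that the anchor of a point of D kills the linear
   functions vanishing on U, hence is the velocity of a curve u(m(t)) + t w(m(t))
   in U.  After multiplication by the square of a bump function, a section that is
   D-valued on U becomes a combination of lifts of sections of B', of core sections of
   the annihilator of U, and of sections whose coefficients vanish on U; Leibniz
   reduces closure under the bracket to the first two kinds.  The mixed bracket
   needs nabla^{Q*} to be dual to nabla^Q, which is read off from the Poisson
   structure: under the metric, the lift of b becomes the linear function that the
   lift itself defines on E^*_Q, because the splitting is Lagrangian. *)

(** * Smooth functions of real variables *)

(** A manifold enters only through its algebra of global smooth functions, and brackets act on
    global sections, so every local frame has to be made global by a bump function; this is why the
    development starts from exp(-1/x). A second obstacle is that the anchor of a point of D must be
    the velocity of a curve inside U: killing linear functions is only a first-order condition, and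
    the curve has to be produced from it. Finally, D is a subbundle over U only, whereas the lifts
    live over all of Q; covectors turn membership in D into the vanishing of functions on U, so that
    a section with values in D along U can be expanded in a frame over all of Q, with the unwanted
    coefficients vanishing on U. *)

Section OneVariable.
Variable R : realType.
Implicit Types f g : R -> R.

(** Peeling off the first derivative rather than the last one lets the inductions on the order pass
    through sums, products and composites. *)
Fixpoint diffn (k : nat) f : Prop :=
  if k is k'.+1 then (forall x, derivable f x 1) /\ diffn k' (derive1 f) else True.

Lemma Cinf_RD f : @Cinf R (RD R) f <-> forall k, diffn k f.
Proof.
split=> [cf k | df k].
  elim: k f cf => //= k IH f cf; split=> [x | ]; first exact: (cf 0%N).
  by apply: IH => j x; have := cf j.+1 x; rewrite derive1Sn.
elim: k f df => [f df x | k IH f df x]; first exact: (df 1%N).1.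
by rewrite derive1Sn; apply: IH => j; have [] := df j.+1.
Qed.

Lemma diffnW k f : diffn k.+1 f -> diffn k f.
Proof.
elim: k f => // k IH f [df dk]; split=> //.
exact: IH.
Qed.

Lemma derive1_is (f df : R -> R) : (forall x : R, is_derive x 1 f (df x)) -> derive1 f = df.
Proof. by move=> H; apply/funext => x; rewrite derive1E derive_val. Qed.

Lemma diffn_cst k (a : R) : diffn k (fun=> a).
Proof.
elim: k a => //= k IH a; split=> [x|]; first exact: derivable_cst.
suff -> : derive1 (fun=> a) = fun=> 0 by [].
by apply: derive1_is => x; exact: is_derive_cst.
Qed.

Lemma diffnD k f g : diffn k f -> diffn k g -> diffn k (fun x => f x + g x).
Proof.
elim: k f g => //= k IH f g [df df'] [dg dg']; split=> [x|]; first exact: derivableD.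
suff -> : derive1 (fun x => f x + g x) = fun x => derive1 f x + derive1 g x by exact: IH.
apply: derive1_is => x; rewrite !derive1E.
by apply: is_deriveD; exact/derivableP.
Qed.

Lemma diffnM k f g : diffn k f -> diffn k g -> diffn k (fun x => f x * g x).
Proof.
elim: k f g => //= k IH f g df dg; split=> [x|].
  by apply: derivableM; [exact: df.1|exact: dg.1].
have -> : derive1 (fun x => f x * g x) = fun x => f x * derive1 g x + g x * derive1 f x.
  apply: derive1_is => x; rewrite !derive1E.
  by apply: is_deriveM; apply/derivableP; [exact: df.1|exact: dg.1].
by apply: diffnD; apply: IH; [exact: diffnW|exact: dg.2|exact: diffnW|exact: df.2].
Qed.

Lemma diffn_sum k (I : Type) (r : seq I) (F : I -> R -> R) :
  (forall i, diffn k (F i)) -> diffn k (fun x => \sum_(i <- r) F i x).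
Proof.
move=> dF; elim: r => [|i r IH].
  by under eq_fun do rewrite big_nil; exact: diffn_cst.
by under eq_fun do rewrite big_cons; exact: diffnD.
Qed.

Lemma near_derive1n (f g : R -> R) k (p : R) :
  (\forall x \near p, f x = g x) ->
  \forall x \near p, derive1n k f x = derive1n k g x.
Proof.
(* Agreement near p means agreement near every point close to p, so the first derivatives agree on a
   neighbourhood and not just at p. *)
elim: k f g => // k IH f g /near_join fg.
rewrite !derive1Sn; apply: IH; apply: filterS fg => x fgx.
by rewrite !derive1E; exact: near_eq_derive.
Qed.

End OneVariable.

(** * Functions of class C^k and the chain rule along curves *)

Section SeveralVariables.
Variables (R : realType) (n : nat).
Implicit Types phi psi : 'rV[R]_n -> R.
Local Notation Ckn k phi := (@Ck R n k setT phi).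
Local Notation pd i phi x := (derive phi x (delta_mx 0 i : 'rV[R]_n)).
Local Notation sm phi := (@smooth_fun_on R n setT phi).

Lemma CkW k phi : Ckn k.+1 phi -> Ckn k phi.
Proof.
elim: k phi => [phi [d _] x _|k IH phi [d dk]].
  exact/differentiable_continuous/d.
by split=> // i; apply: IH; exact: dk.
Qed.

Lemma Ck_cst k (a : R) : Ckn k (fun=> a).
Proof.
elim: k a => [a x _|k IH a]; first exact: cst_continuous.
split=> [x _|i]; first exact: differentiable_cst.
suff -> : (fun x => pd i (fun=> a) x) = fun=> 0 by exact: IH.
by apply/funext => x; exact: derive_cst.
Qed.

Lemma CkD k phi psi : Ckn k phi -> Ckn k psi -> Ckn k (fun x => phi x + psi x).
Proof.
elim: k phi psi => [phi psi d e x _|k IH phi psi [d dk] [e ek]].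
  exact: (cvgD (d x I) (e x I)).
split=> [x _|i]; first by apply: differentiableD; [exact: d|exact: e].
suff -> : (fun x => pd i (fun x => phi x + psi x) x) =
   fun x => pd i phi x + pd i psi x.
  exact: (IH _ _ (dk i) (ek i)).
apply/funext => x; apply: deriveD; apply: diff_derivable; [exact: d|exact: e].
Qed.

Lemma CkM k phi psi : Ckn k phi -> Ckn k psi -> Ckn k (fun x => phi x * psi x).
Proof.
elim: k phi psi => [phi psi d e x _|k IH phi psi d e].
  exact: (cvgM (d x I) (e x I)).
split=> [x _|i]; first by apply: differentiableM; [exact: d.1|exact: e.1].
suff -> : (fun x => pd i (fun x => phi x * psi x) x) = fun x =>
   phi x * pd i psi x + psi x * pd i phi x.
  by apply: CkD; apply: IH; [exact: CkW|exact: e.2|exact: CkW|exact: d.2].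
apply/funext => x; apply: deriveM; apply: diff_derivable; [exact: d.1|exact: e.1].
Qed.

(** The i-th partial derivative of f(x_j) is f'(x_j) times a Kronecker delta, again of this form up
    to a constant, so the induction closes when f varies. *)
Lemma Ck_coord1 k (j : 'I_n) (f : R -> R) :
  @Cinf R (RD R) f -> Ckn k (fun x => f (x 0 j)).
Proof.
elim: k f => [f|k IH f] /Cinf_RD df.
  move=> x _; apply: (@continuous_comp _ _ _ (fun x : 'rV[R]_n => x 0 j) f).
    exact/differentiable_continuous/differentiable_coord.
  apply/differentiable_continuous/derivable1_diffP.
  exact: (df 1%N).1.
have dfj x : differentiable (fun x : 'rV[R]_n => f (x 0 j)) x.
  apply: (@differentiable_comp _ _ _ _ (fun x : 'rV[R]_n => x 0 j) f).
    exact: differentiable_coord.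
  by apply/derivable1_diffP; exact: (df 1%N).1.
split=> [x _ //|i].
have -> : (fun x => pd i (fun x : 'rV[R]_n => f (x 0 j)) x) =
    fun x => (derive1 f) (x 0 j) * (i == j)%:R.
  apply/funext => x; rewrite deriveE //.
  have cj := @differentiable_coord R 1 n x 0 j.
  have fd : differentiable f (x 0 j) by apply/derivable1_diffP; exact: (df 1%N).1.
  rewrite (@diff_comp _ _ _ _ (fun x : 'rV[R]_n => x 0 j) f x cj fd) /=.
  have -> : 'd (fun x : 'rV[R]_n => x 0 j) x (delta_mx 0 i) = (i == j)%:R.
    rewrite -deriveE //.
    have dd : derivable (id : 'rV[R]_n -> _) x (delta_mx 0 i) by exact: derivable_id.
    have := derive_mx dd; rewrite derive_id => /matrixP /(_ 0 j).
    by rewrite !mxE eqxx /= eq_sym => <-.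
  rewrite derive1E' //.
  rewrite -[X in 'd  _ _ X = _]mulr1.
  by rewrite [LHS]linearZ mulrC.
apply: CkM; last exact: Ck_cst.
apply: IH; apply/Cinf_RD => m.
by have [] := df m.+1.
Qed.

Lemma smooth_cst (a : R) : sm (fun=> a).
Proof. by move=> k; exact: Ck_cst. Qed.

Lemma smooth_add phi psi : sm phi -> sm psi -> sm (fun x => phi x + psi x).
Proof. by move=> d e k; exact: CkD. Qed.

Lemma smooth_mul phi psi : sm phi -> sm psi -> sm (fun x => phi x * psi x).
Proof. by move=> d e k; exact: CkM. Qed.

Lemma smooth_coord1 (j : 'I_n) f : @Cinf R (RD R) f -> sm (fun x => f (x 0 j)).
Proof. by move=> cf k; exact: Ck_coord1. Qed.

Lemma Cinf_RD_id : @Cinf R (RD R) id.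
Proof.
apply/Cinf_RD => -[|k] //=; split=> [x|]; first exact: derivable_id.
suff -> : derive1 id = fun=> 1 :> R by exact: diffn_cst.
by apply: derive1_is => x; exact: is_derive_id.
Qed.

Lemma smooth_coord (j : 'I_n) : sm (fun x => x 0 j).
Proof. exact: (smooth_coord1 j Cinf_RD_id). Qed.

Lemma row_derive (f : 'I_n -> R -> R) (t : R) :
  (forall i, derivable (f i) t 1) ->
  is_derive t 1 (fun t => \row_i f i t) (\row_i derive1 (f i) t).
Proof.
move=> df.
have e i j : (fun x => (\row_i f i x) i j) = f j by apply/funext => x; rewrite mxE.
have dr : derivable (fun t => \row_i f i t) t 1 by apply/derivable_mxP => i j; rewrite e.
apply: DeriveDef => //; rewrite derive_mx //.
apply/matrixP => i j; rewrite [LHS]mxE [RHS]mxE derive1E.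
by rewrite e.
Qed.

Lemma chain_rule phi (f : 'I_n -> R -> R) (t : R) :
  differentiable phi (\row_i f i t) -> (forall i, derivable (f i) t 1) ->
  is_derive t 1 (fun t => phi (\row_i f i t))
    (\sum_i pd i phi (\row_i f i t) * derive1 (f i) t).
Proof.
move=> dphi df; have [dr dv] := row_derive df.
have dr' : differentiable (fun t => \row_i f i t) t by exact/derivable1_diffP.
have dc : differentiable (fun t => phi (\row_i f i t)) t.
  exact: (differentiable_comp dr' dphi).
apply: DeriveDef; first exact/derivable1_diffP.
rewrite deriveE //.
rewrite (diff_comp dr' dphi) /= -(deriveE _ dr') dv.
set a := \row_i derive1 (f i) t.
rewrite [a in LHS]row_sum_delta linear_sum; apply: eq_bigr => i _.
by rewrite linearZ /= -deriveE // mxE mulrC.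
Qed.

(** By the chain rule the derivative is a sum of products whose first factors are composites of the
    same form, with a partial derivative in place of [phi]; hence the induction generalizes over
    [phi]. *)
Lemma diffn_comp k phi (f : 'I_n -> R -> R) : sm phi -> (forall i, diffn k (f i)) ->
  diffn k (fun t => phi (\row_i f i t)).
Proof.
elim: k phi f => //= k IH phi f dphi df.
have dx x : differentiable phi x by exact: (dphi 1%N).1.
split=> [x|]; first by have [] := @chain_rule phi f x (dx _) (fun i => (df i).1 x).
have -> := derive1_is (fun x => chain_rule (dx _) (fun i => (df i).1 x)).
apply: diffn_sum => i; apply: diffnM; last exact: (df i).2.
apply: (IH (fun x => pd i phi x)) => [m|j].
  exact: (dphi m.+1).2.
exact/diffnW/df.
Qed.

End SeveralVariables.

(** * Functions that are flat at the origin *)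

Section FlatFunctions.
Variable R : realType.

(* The derivatives of exp(-1/x) are combinations of members of this family. *)
Definition flat n (x : R) : R := if 0 < x then x^-1 ^+ n * expR (- x^-1) else 0.

(** With y = 1/x, the term of degree n+2 of the exponential series gives y^(n+2) / (n+2)! <= exp y.
    Two powers more than n are taken in order to leave x^2, which forces the derivative at 0 to
    vanish. *)
Lemma flat_bound n (x : R) : `|flat n x| <= n.+2`!%:R * x ^+ 2.
Proof.
rewrite /flat; case: ifPn => [x0|_]; last first.
  by rewrite normr0 mulr_ge0 ?sqr_ge0.
have xi0 : 0 < x^-1 by rewrite invr_gt0.
rewrite ger0_norm ?mulr_ge0 ?exprn_ge0 ?expR_ge0 ?(ltW xi0) //.
have /= := expR_ge1Dxn n.+1 (ltW xi0); set y := x^-1 in xi0 *; set F := (n.+2)`!%:R.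
have F0 : 0 < F :> R by rewrite ltr0n fact_gt0.
move=> le1; have le2 : y ^+ n.+2 / F <= expR y.
  by apply: le_trans le1; rewrite lerDr.
rewrite expRN ler_pdivrMr ?expR_gt0 //.
have -> : x = y^-1 by rewrite /y invrK.
clearbody y.
rewrite exprVn mulrAC ler_pdivlMr ?exprn_gt0 // -exprD addn2.
by move: le2; rewrite ler_pdivrMr // mulrC.
Qed.

Lemma is_derive_quadratic (f : R -> R) (C : R) :
  (forall x, `|f x| <= C * x ^+ 2) -> is_derive (0 : R) 1 f 0.
Proof.
move=> fC.
have f0 : f 0 = 0.
  by apply/eqP; rewrite -normr_le0 (le_trans (fC 0)) // expr0n mulr0.
have C0 : 0 <= C by have := fC 1; rewrite expr1n mulr1; exact: le_trans.
have lim0 : h^-1 *: (f (h *: 1 + 0) - f 0) @[h --> (0 : R)^'] --> (0 : R).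
  apply/cvgrPdist_le => e e0; near=> h.
  have h0 : h != 0 by near: h; exact: nbhs_dnbhs_neq.
  rewrite sub0r normrN f0 subr0 addr0 [h *: 1]mulr1 normrZ normfV.
  rewrite ler_pdivrMl ?normr_gt0 // (le_trans (fC h)) //.
  rewrite -real_normK ?num_real // expr2 mulrCA ler_wpM2l //.
  (* The constant C may be 0, hence the denominator C + 1. *)
  have : `|h| <= e / (C + 1).
    by near: h; apply: dnbhs0_le; rewrite divr_gt0 // ltr_wpDl.
  rewrite ler_pdivlMr ?ltr_wpDl // mulrDr mulr1 mulrC; apply: le_trans.
  by rewrite lerDl.
by apply: DeriveDef; [apply/cvg_ex; exists 0|exact: cvg_lim].
Unshelve. all: by end_near. Qed.

Lemma is_derive_flat n (x : R) :
  is_derive x 1 (flat n) (- n%:R * flat n.+1 x + flat n.+2 x).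
Proof.
have [x0|x0|->] := ltgtP x 0.
- rewrite /flat ltNge (ltW x0) /= mulr0 addr0.
  apply: (@near_eq_is_derive _ _ _ (fun=> 0)).
  near=> y; rewrite ltNge ltW //; near: y.
  exact: lt_nbhsl.
- apply: (@near_eq_is_derive _ _ _ (fun y : R => y^-1 ^+ n * expR (- y^-1))).
    near=> y; rewrite /flat ifT //; near: y.
    exact: lt_nbhsr.
  have xn0 : x != 0 by rewrite gt_eqF.
  have d1 : is_derive x 1 (fun y : R => y^-1) (- x ^- 2 *: 1).
    by apply: (@is_deriveV _ id).
  have d2 := is_deriveX n d1.
  have d3 : is_derive x 1 (fun y : R => expR (- y^-1)) (expR (- x^-1) * - (- x ^- 2 *: 1)).
    by apply: (@is_derive1_comp _ expR (fun y => - y^-1)); exact: is_deriveN.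
  have d4 := is_deriveM d2 d3.
  have -> : (fun y : R => y^-1 ^+ n * expR (- y^-1)) =
      (fun y : R => y^-1) ^+ n * (fun y : R => expR (- y^-1)).
    by apply/funext => y; rewrite !fctE.
  apply: (is_derive_eq d4).
  rewrite /flat x0 /= [_%:A]mulr1 /GRing.scale /=.
  rewrite !fctE /=; move: {d1 d2 d3 d4} (expR _) => E.
  case: n => [|n] /=; first by field.
  rewrite -!exprVn !exprS; move: (x^-1) (n.+1%:R : R) (_ ^+ n) => y m z; ring.
- rewrite /flat ltxx mulr0 addr0.
  exact: (is_derive_quadratic (@flat_bound n)).
Unshelve. all: by end_near. Qed.

Lemma Cinf_flat n : @Cinf R (RD R) (flat n).
Proof.
apply/Cinf_RD => k; elim: k n => // k IH n; split=> [x|].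
  by have [] := is_derive_flat n x.
have -> := derive1_is (is_derive_flat n).
apply: diffnD; last exact: IH.
by apply: diffnM; [exact: diffn_cst|exact: IH].
Qed.

End FlatFunctions.
Arguments Cinf_flat : clear implicits.

(** * Differential spaces and bump functions *)

Section DifferentialSpaces.
Variable R : realType.
Implicit Types X Y Z : diffspace R.

Definition closedD X := @generated R X (@Cinf R X) `<=` @Cinf R X.

Lemma manifold_closed X : manifold X -> closedD X.
Proof. by case. Qed.

Section Closed.
Variable X : diffspace R.
Hypothesis cX : closedD X.
Implicit Types (f h : X -> R) (V W : set X).

Lemma Cinf_smooth_comp n (g : 'I_n -> X -> R) phi :
  (forall i, Cinf (g i)) -> smooth_fun_on setT phi -> Cinf (fun x => phi (\row_i g i x)).
Proof. by move=> Cg sphi; apply: cX => p; exists n, g, phi, 1; split. Qed.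

(** Near p the function is itself a coordinate: h is put in position 0, before the functions that
    describe the neighbourhood, and [phi] is the projection to that position. *)
Lemma Cinf_local f : Cinf_on setT f -> Cinf f.
Proof.
move=> fl; apply: cX => p; have [h [V [Ch oV Vp fh]]] := fl p I.
have [n [g [e [e0 Cg gV]]]] := oV p Vp.
exists n.+1, (fun i => if unlift ord0 i is Some j then g j else h), (fun x => x 0 0), e.
split=> // [i||x xp]; first by case: unliftP => [j|] _.
  exact: smooth_coord.
rewrite mxE unlift_none; apply/fh/gV => i.
by have := xp (lift ord0 i); rewrite liftK.
Qed.

Lemma Cinf_comp1 (psi : R -> R) f : @Cinf R (RD R) psi -> Cinf f -> Cinf (fun x => psi (f x)).
Proof.
move=> Cpsi Cf; have := @Cinf_smooth_comp 1 (fun=> f) _ (fun=> Cf) (smooth_coord1 0 Cpsi).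
by under eq_fun do rewrite mxE.
Qed.

Lemma Cinf_cst (a : R) : @Cinf R X (fun=> a).
Proof.
by apply: (@Cinf_smooth_comp 0 (fun=> fun=> 0) (fun=> a)) => [[]|]; last exact: smooth_cst.
Qed.

Lemma Cinf_add f h : Cinf f -> Cinf h -> Cinf (fun x => f x + h x).
Proof.
move=> Cf Ch; have := @Cinf_smooth_comp 2 (fun i => if i == 0 then f else h)
  (fun x => x 0 0 + x 0 1) _ (smooth_add (@smooth_coord _ _ 0) (@smooth_coord _ _ 1)).
under [X in Cinf X]eq_fun do rewrite !mxE /=.
by apply=> i; case: ifP.
Qed.

Lemma Cinf_mul f h : Cinf f -> Cinf h -> Cinf (fun x => f x * h x).
Proof.
move=> Cf Ch; have := @Cinf_smooth_comp 2 (fun i => if i == 0 then f else h)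
  (fun x => x 0 0 * x 0 1) _ (smooth_mul (@smooth_coord _ _ 0) (@smooth_coord _ _ 1)).
under [X in Cinf X]eq_fun do rewrite !mxE /=.
by apply=> i; case: ifP.
Qed.

Lemma Cinf_sum (I : Type) (r : seq I) (F : I -> X -> R) :
  (forall i, Cinf (F i)) -> Cinf (fun x => \sum_(i <- r) F i x).
Proof.
move=> CF; elim: r => [|i r IH].
  by under eq_fun do rewrite big_nil; exact: Cinf_cst.
by under eq_fun do rewrite big_cons; exact: Cinf_add.
Qed.

Lemma openDT : openD [set: X].
Proof.
move=> p _; exists 0%N, (fun=> fun=> 0), 1; split=> // i.
exact: Cinf_cst.
Qed.

Lemma openDI V W : openD V -> openD W -> openD (V `&` W).
Proof.
move=> oV oW p [/oV[n [g [e [e0 Cg gV]]]] /oW[m [h [d [d0 Ch hW]]]]].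
exists (n + m)%N, (fun i => match fintype.split i with inl j => g j | inr j => h j end).
exists (Num.min e d); split=> [|i|x xp].
- by rewrite lt_min e0.
- by case: fintype.split.
- split; [apply: gV|apply: hW] => i.
    by have := xp (lshift m i); rewrite -[lshift m i]/(unsplit (inl i)) unsplitK lt_min => /andP[].
  by have := xp (rshift n i); rewrite -[rshift n i]/(unsplit (inr i)) unsplitK lt_min => /andP[].
Qed.

Lemma openD_gt f (a : R) : Cinf f -> openD [set x | a < f x].
Proof.
move=> Cf p /= ap; exists 1%N, (fun=> f), (f p - a); split=> // [|x /(_ 0)].
  by rewrite subr_gt0.
by rewrite ltr_norml => /andP[+ _]; rewrite opprB ltrBrDr subrK.
Qed.

Lemma openD_forall n (V : 'I_n -> set X) :
  (forall i, openD (V i)) -> openD [set x | forall i, V i x].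
Proof.
elim: n V => [|n IH] V oV.
  suff -> : [set x | forall i, V i x] = setT by exact: openDT.
  by apply/seteqP; split=> x // _ [].
suff -> : [set x | forall i, V i x] =
    V ord0 `&` [set x | forall i, V (lift ord0 i) x].
  exact/openDI/IH.
apply/seteqP; split=> x /= => [Vx //|[Vx Vx'] i].
by case: (unliftP ord0 i) => [j|] ->.
Qed.

Lemma Cinf_on_vec n W (a : 'I_n -> X -> R) p : (forall i, Cinf_on W (a i)) -> W p ->
  exists (b : 'I_n -> X -> R) V, [/\ forall i, Cinf (b i), openD V, V p &
    forall x, V x -> forall i, a i x = b i x].
Proof.
move=> aW Wp.
have /choice[b Hb] : forall i, exists h, exists V : set X,
    [/\ Cinf h, openD V, V p & forall x, V x -> a i x = h x] by move=> i; exact: aW.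
have [V HV] := choice Hb.
exists b, [set x | forall i, V i x]; split.
- by move=> i; have [] := HV i.
- by apply: openD_forall => i; have [] := HV i.
- by move=> i; have [] := HV i.
- by move=> x Vx i; have [_ _ _] := HV i; apply.
Qed.

Lemma smooth_generated (T : Type) (G : set (T -> R)) (f : X -> T) :
  (forall g, G g -> Cinf (fun x => g (f x))) ->
  smooth (Y := DiffSpace (generated G)) f.
Proof.
move=> Gf h Gh; apply: cX => p; have [n [g [phi [e [e0 Gg sphi gh]]]]] := Gh (f p).
exists n, (fun i x => g i (f x)), phi, e; split=> // [i|x xp]; first exact/Gf/Gg.
exact: gh.
Qed.

Lemma smooth_pair Y Z (f : X -> Y) (g : X -> Z) :
  smooth f -> smooth g -> smooth (Y := prodD Y Z) (fun x => (f x, g x)).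
Proof.
by move=> sf sg; apply: smooth_generated => _ [] [h Ch ->]; [exact: sf|exact: sg].
Qed.

Lemma smooth_sub Y (S : set Y) (f : X -> Y) (fS : forall x, S (f x)) :
  smooth f -> smooth (Y := subD S) (fun x => exist S (f x) (fS x)).
Proof. by move=> sf; apply: smooth_generated => _ [h Ch ->]; exact: sf. Qed.

Lemma smooth_row n (b : 'I_n -> X -> R) :
  (forall i, Cinf (b i)) -> smooth (Y := RnD R n) (fun x => \row_i b i x).
Proof. by move=> Cb phi sphi; exact: Cinf_smooth_comp. Qed.

(** The support condition is stated at the points outside W, each of which has a neighbourhood where
    chi vanishes. This is the form in which extension by zero uses it; no compactness is
    involved. *)
Definition bump_on W chi :=
  Cinf chi /\ forall x, ~ W x -> exists V, [/\ openD V, V x & forall y, V y -> chi y = 0].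

Lemma bump_on0 W chi x : bump_on W chi -> ~ W x -> chi x = 0.
Proof. by move=> [_ H] /H [V [_ Vx]]; apply. Qed.

Lemma exists_bump W p : openD W -> W p -> exists2 chi, bump_on W chi & chi p = 1.
Proof.
move=> oW Wp; have [n [g [e [e0 Cg gW]]]] := oW p Wp.
pose G x := \sum_i (g i x - g i p) ^+ 2.
have CG : Cinf G.
  apply: Cinf_sum => i; under eq_fun do rewrite expr2.
  by apply: Cinf_mul; apply: Cinf_add => //; exact: Cinf_cst.
have Gp : G p = 0 by rewrite /G big1 // => i _; rewrite subrr expr0n.
(* G is the squared distance to p in the coordinates g. The half makes d smaller than e^2, so that G
   x <= d places x in W; outside W one thus has d < G, an open condition under which the flat
   function is 0. *)
pose d := e ^+ 2 / 2.
have d0 : 0 < d by rewrite divr_gt0 ?exprn_gt0.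
have flat0 : 0 < flat 0 d by rewrite /flat d0 mul1r expR_gt0.
exists (fun x => (flat 0 d)^-1 * flat 0 (d - G x)); last first.
  by rewrite Gp subr0 mulVf ?gt_eqF.
split.
  apply: Cinf_mul; first exact: Cinf_cst.
  apply: (Cinf_comp1 (Cinf_flat R 0)); apply: Cinf_add; first exact: Cinf_cst.
  under eq_fun do rewrite -mulN1r; apply: Cinf_mul => //; exact: Cinf_cst.
move=> x nWx; exists [set y | d < G y]; split; first exact: openD_gt.
  rewrite /=; apply: contrapT => /negP; rewrite -leNgt => Gd; apply/nWx/gW => i.
  rewrite -(@ltr_pXn2r _ 2) ?nnegrE ?(ltW e0) // real_normK ?num_real //.
  apply: le_lt_trans (_ : _ <= G x) _.
    by rewrite /G (bigD1 i) //= lerDl sumr_ge0 // => j _; exact: sqr_ge0.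
  apply: le_lt_trans Gd _.
  by rewrite /d ltr_pdivrMr // ltr_pMr ?exprn_gt0 // ltrDl.
move=> y /= dG; suff -> : flat 0 (d - G y) = 0 by rewrite mulr0.
by rewrite /flat subr_gt0 ltNge (ltW dG).
Qed.

(** F may be arbitrary outside W: there the product is 0 on a whole neighbourhood, and at points of
    W it is locally a product of smooth functions. *)
Lemma Cinf_cut W chi F : bump_on W chi -> Cinf_on W F -> Cinf (fun x => chi x * F x).
Proof.
move=> [Cchi chi0] FW; apply: Cinf_local => p _.
have [Wp|/chi0[V [oV Vp V0]]] := pselect (W p); last first.
  exists (fun=> 0), V; split=> //; first exact: Cinf_cst.
  by move=> x Vx; rewrite V0 ?mul0r.
have [h [V [Ch oV Vp Fh]]] := FW p Wp.
exists (fun x => chi x * h x), V; split=> //; first exact: Cinf_mul.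
by move=> x Vx; rewrite Fh.
Qed.

End Closed.

Lemma openD_preim X Y (f : X -> Y) (W : set Y) : smooth f -> openD W -> openD (f @^-1` W).
Proof.
move=> sf oW p /oW[n [g [e [e0 Cg gW]]]].
exists n, (fun i x => g i (f x)), e; split=> // [i|x xp]; first exact: sf.
exact: gW.
Qed.

Lemma bump_preim X Y (f : X -> Y) (W : set Y) chi : smooth f -> bump_on W chi ->
  bump_on (f @^-1` W) (fun x => chi (f x)).
Proof.
move=> sf [Cchi chi0]; split=> [|x /chi0[V [oV Vx V0]]]; first exact: sf.
exists (f @^-1` V); split=> //; first exact: openD_preim.
by move=> y /V0.
Qed.

Lemma bump_onW X (W W' : set X) chi : W `<=` W' -> bump_on W chi -> bump_on W' chi.
Proof. by move=> WW' [Cchi chi0]; split=> // x nWx; apply: chi0 => /WW'. Qed.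

Lemma Cinf_on_preim X Y (f : X -> Y) (W : set Y) h : smooth f -> Cinf_on W h ->
  Cinf_on (f @^-1` W) (fun x => h (f x)).
Proof.
move=> sf hW p /hW[h' [V [Ch oV Vp hh]]].
exists (fun x => h' (f x)), (f @^-1` V); split=> //; first exact: sf.
  exact: openD_preim.
by move=> x /hh.
Qed.

Lemma smooth_comp X Y Z (f : X -> Y) (g : Y -> Z) : smooth f -> smooth g ->
  smooth (g \o f).
Proof. by move=> sf sg h Ch; apply: (sf (fun y => h (g y))); exact: sg. Qed.

Lemma smooth_id X : smooth (@id X).
Proof. by []. Qed.

Lemma RD_continuous (f : R -> R) (t : R) : @Cinf R (RD R) f -> {for t, continuous f}.
Proof. by move=> Cf; apply/differentiable_continuous/derivable1_diffP; exact: (Cf 0%N). Qed.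

Lemma near_norm n (g : 'I_n -> R -> R) (t e : R) : 0 < e ->
  (forall i, @Cinf R (RD R) (g i)) ->
  \forall s \near t, forall i, `|g i s - g i t| < e.
Proof.
move=> e0 Cg; suff H i : nbhs t [set s | `|g i s - g i t| < e] by exact: filter_forall H.
have Ci := @RD_continuous (g i) t (Cg i).
have /cvgrPdist_lt /(_ _ e0) := Ci.
by apply: filterS => s; rewrite distrC.
Qed.

(** Open sets of X are described by finitely many smooth functions, and each of them is continuous
    along a smooth curve. *)
Lemma near_openD X (gamma : R -> X) (V : set X) (t : R) :
  smooth (X := RD R) gamma -> openD V -> V (gamma t) ->
  \forall s \near t, V (gamma s).
Proof.
move=> sg oV /oV[n [g [e [e0 Cg gV]]]].
have := @near_norm n (fun i s => g i (gamma s)) t e e0 (fun i => sg _ (Cg i)).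
by apply: filterS => s; exact: gV.
Qed.

(** Derivatives of every order depend only on the germ, and near x the function is a composite with
    a smooth [phi]. With this, the general lemmas on smooth maps apply to curves. *)
Lemma closed_RD : closedD (RD R).
Proof.
move=> f gf k x; have [n [g [phi [e [e0 Cg sphi gphi]]]]] := gf x.
have fphi : \forall s \near x, f s = phi (\row_i g i s).
  by have := @near_norm _ g x e e0 Cg; apply: filterS => s; exact: gphi.
have Cphi : @Cinf R (RD R) (fun s => phi (\row_i g i s)).
  by apply/Cinf_RD => j; apply: diffn_comp => // i; move/Cinf_RD: (Cg i).
apply: near_eq_derivable (Cphi k x).
by apply: filterS (near_derive1n k fphi) => s ->.
Qed.

End DifferentialSpaces.

(** * Local sections of vector bundles *)

Section Bundles.
Variable R : realType.
Variables (E M : diffspace R) (V : vbundle E M).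

Section Fibres.
Hypothesis fV : fibre_space V.
Local Notation "a +: b" := (vadd V a b) (at level 50).
Local Notation pr := (vproj V).
Local Notation zr := (vzero V).
Local Notation sc := (vscale V).

Lemma proj_zero m : pr (zr m) = m.
Proof. by case: fV => [[]]. Qed.

Lemma proj_add e e' : pr e = pr e' -> pr (e +: e') = pr e.
Proof. by case: fV => [[? H ?] _ _]; exact: H. Qed.

Lemma proj_scale a e : pr (sc a e) = pr e.
Proof. by case: fV => [[]]. Qed.

Lemma vaddC e e' : pr e = pr e' -> e +: e' = e' +: e.
Proof. by case: fV => [_ [H ? ? ?] _]; exact: H. Qed.

Lemma vaddA e1 e2 e3 : pr e1 = pr e2 -> pr e2 = pr e3 ->
  e1 +: (e2 +: e3) = (e1 +: e2) +: e3.
Proof. by case: fV => [_ [? H ? ?] _]; exact: H. Qed.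

Lemma vadd0 e : zr (pr e) +: e = e.
Proof. by case: fV => [_ []]. Qed.

Lemma vaddr0 e m : pr e = m -> e +: zr m = e.
Proof. by move=> <-; rewrite vaddC ?vadd0 // proj_zero. Qed.

Lemma vadd0r e m : pr e = m -> zr m +: e = e.
Proof. by move=> <-; exact: vadd0. Qed.

Lemma vaddN e : e +: sc (-1) e = zr (pr e).
Proof. by case: fV => [_ []]. Qed.

Lemma vscale1 e : sc 1 e = e.
Proof. by case: fV => [_ _ []]. Qed.

Lemma vscaleA a b e : sc a (sc b e) = sc (a * b) e.
Proof. by case: fV => [_ _ []]. Qed.

Lemma vscaleDl a b e : sc (a + b) e = sc a e +: sc b e.
Proof. by case: fV => [_ _ []]. Qed.

Lemma vscaleDr a e e' : pr e = pr e' -> sc a (e +: e') = sc a e +: sc a e'.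
Proof. by case: fV => [_ _ [? ? ? H]]; exact: H. Qed.

Lemma vscale0 e m : pr e = m -> sc 0 e = zr m.
Proof. by move=> <-; rewrite -(subrr 1) vscaleDl vscale1 vaddN. Qed.

(** The standard way below to recognise a zero vector: show that it equals its own double. *)
Lemma vadd_idem e : e +: e = e -> e = zr (pr e).
Proof.
move=> ee; rewrite -vaddN -{2}ee -vaddA ?proj_scale //.
by rewrite vaddN vaddr0.
Qed.

Lemma vscale_zero a m : sc a (zr m) = zr m.
Proof.
have p0 : pr (sc a (zr m)) = m by rewrite proj_scale proj_zero.
rewrite -{2}p0; apply: vadd_idem.
by rewrite -vscaleDr // vaddr0 // proj_zero.
Qed.

Lemma linear_at_zero m psi : linear_at V setT m psi -> psi (zr m) = 0.
Proof.
move=> [_ lZ]; rewrite -(vscale_zero 0 m) lZ ?proj_zero //.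
by rewrite mul0r.
Qed.

End Fibres.

Lemma linear_at_cut S m psi :
  (forall e e', S e -> S e' -> vproj V e = vproj V e' ->
     S (vadd V e e') /\ vproj V (vadd V e e') = vproj V e) ->
  (forall a e, S e -> S (vscale V a e) /\ vproj V (vscale V a e) = vproj V e) ->
  linear_at V S m psi -> linear_at V S m (Defs.cut V S m psi).
Proof.
move=> SD SZ [lD lZ]; split=> [e e' Se Se' pe pe'|a e Se pe].
  rewrite /Defs.cut !asboolT //; first exact: lD.
  by have [|? ->] := SD _ _ Se Se'; first by rewrite pe pe'.
rewrite /Defs.cut !asboolT //; first exact: lZ.
by have [? ->] := SZ a _ Se.
Qed.

Lemma mkdual_base S m psi : dbase (mkdual V S m psi) = m.
Proof. by rewrite /mkdual; case: pselect. Qed.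

Lemma mkdualE S m psi e : linear_at V S m (Defs.cut V S m psi) -> S e -> vproj V e = m ->
  mkdual V S m psi e = psi e.
Proof.
by move=> lin Se pe; rewrite /mkdual; case: pselect => //= ?; rewrite /Defs.cut asboolT.
Qed.

Lemma mkdualTE m psi e : fibre_space V -> linear_at V setT m psi -> vproj V e = m ->
  mkdual V setT m psi e = psi e.
Proof.
move=> fV lin; apply: mkdualE => //; apply: linear_at_cut => //.
  by move=> ? ? _ _ ?; split=> //; exact: proj_add.
by move=> a ? _; split=> //; exact: proj_scale.
Qed.

(** Values off the fibre are 0 by [doff], and the remaining fields are proofs. *)
Lemma dual_ext S (P1 P2 : dual_pt V S) : dbase P1 = dbase P2 ->
  (forall e, S e -> vproj V e = dbase P1 -> P1 e = P2 e) -> P1 = P2.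
Proof.
case: P1 P2 => [m1 v1 l1 o1] [m2 v2 l2 o2] /= m12; move: m12 l2 o2 => <- l2 o2 ev.
have v12 : v1 = v2.
  apply/funext => e; have [[Se pe]|H] := pselect (S e /\ vproj V e = m1); first exact: ev.
  by rewrite o1 ?o2.
by move: v12 l2 o2 {ev} => <- l2 o2; congr DualPt; exact: Prop_irrelevance.
Qed.

Section Trivial.
Hypothesis fV : fibre_space V.
Variables (k : nat) (W : set M) (t : M -> 'rV[R]_k -> E) (c : E -> 'rV[R]_k).
Hypothesis tr : trivialization V W t c.

Lemma triv_open : openD W.
Proof. by case: tr. Qed.

Lemma triv_proj m a : W m -> vproj V (t m a) = m.
Proof. by case: tr => [_ H _ _ _] Wm; have [] := H m a Wm. Qed.

Lemma triv_coord m a : W m -> c (t m a) = a.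
Proof. by case: tr => [_ H _ _ _] Wm; have [] := H m a Wm. Qed.

Lemma triv_coordK e m : W m -> vproj V e = m -> t m (c e) = e.
Proof. by move=> Wm pe; rewrite -pe in Wm *; case: tr => [_ _ H _ _]; exact: H. Qed.

Lemma trivD m a b : W m -> t m (a + b) = vadd V (t m a) (t m b).
Proof. by case: tr => [_ _ _ H _] Wm; have [] := H m a b 1 Wm. Qed.

Lemma trivZ m a r : W m -> t m (r *: a) = vscale V r (t m a).
Proof. by case: tr => [_ _ _ H _] Wm; have [] := H m a a r Wm. Qed.

Lemma triv0 m : W m -> t m 0 = vzero V m.
Proof.
by move=> Wm; rewrite -(scale0r (0 : 'rV[R]_k)) trivZ // (vscale0 fV (triv_proj _ Wm)).
Qed.

Lemma coordD e e' : W (vproj V e) -> vproj V e = vproj V e' -> c (vadd V e e') = c e + c e'.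
Proof.
move=> We ee'; have We' : W (vproj V e') by rewrite -ee'.
rewrite -[RHS](triv_coord _ We) trivD // (triv_coordK We) //.
by rewrite (triv_coordK (m := vproj V e)).
Qed.

Lemma coordZ a e : W (vproj V e) -> c (vscale V a e) = a *: c e.
Proof. by move=> We; rewrite -[RHS](triv_coord _ We) trivZ // (triv_coordK We). Qed.

Lemma coord0 m : W m -> c (vzero V m) = 0.
Proof. by move=> Wm; rewrite -triv0 // triv_coord. Qed.

Lemma coord_Cinf_on j : Cinf_on (vproj V @^-1` W) (fun e => c e 0 j).
Proof. by case: tr => [_ _ _ _ [_ H]]; exact: (H (fun x => x 0 j) (@smooth_coord _ _ j)). Qed.

Lemma triv_Cinf_on f : Cinf f ->
  Cinf_on (X := prodD M (RnD R k)) [set z | W z.1] (fun z => f (t z.1 z.2)).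
Proof. by case: tr => [_ _ _ _ [H _]]; exact: H. Qed.

Lemma triv_expand m psi a : W m -> linear_at V setT m psi ->
  psi (t m a) = \sum_j a 0 j * psi (t m (delta_mx 0 j)).
Proof.
move=> Wm lin; have [lD lZ] := lin.
rewrite [in LHS](row_sum_delta a).
elim: (index_enum _) => [|j r IH]; first by rewrite !big_nil triv0 // (linear_at_zero fV lin).
rewrite !big_cons trivD // lD ?(triv_proj _ Wm) // IH trivZ // lZ ?(triv_proj _ Wm) //.
Qed.

End Trivial.

Section Smoothness.
Hypothesis vbV : vector_bundle V.
Let fV : fibre_space V. Proof. by case: vbV. Qed.
Let sV : smooth (vproj V). Proof. by case: vbV. Qed.
Variable X : diffspace R.
Hypothesis cX : closedD X.

Lemma exists_triv m : exists k W (t : M -> 'rV[R]_k -> E) c, trivialization V W t c /\ W m.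
Proof. by case: vbV => [_ _ _ _ [k /(_ m)[W [t [c H]]]]]; exists k, W, t, c. Qed.

(** The coordinates b are smooth on all of X and only describe f near p. [Cinf_on_vec] supplies them
    from coordinates that are merely smooth near p. *)
Lemma smooth_via_triv (mu : X -> M) (f : X -> E) : smooth mu ->
  (forall p, exists k (W : set M) (t : M -> 'rV[R]_k -> E) c (b : 'I_k -> X -> R) (N : set X),
     [/\ trivialization V W t c, W (mu p) /\ N p, openD N, forall i, Cinf (b i) &
         forall x, N x -> f x = t (mu x) (\row_i b i x)]) ->
  smooth f.
Proof.
move=> smu Hf h Ch; apply: (Cinf_local cX) => p _.
have [k [W [t [c [b [N [tr [Wp Np] oN Cb fN]]]]]]] := Hf p.
have sz : smooth (Y := prodD M (RnD R k)) (fun x => (mu x, \row_i b i x)).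
  exact: (smooth_pair cX smu (smooth_row cX Cb)).
have [h' [N' [Ch' oN' N'p hh']]] := triv_Cinf_on tr Ch (p := (mu p, \row_i b i p)) Wp.
exists (fun x => h' (mu x, \row_i b i x)).
exists (N `&` (fun x => (mu x, \row_i b i x)) @^-1` N'); split=> //.
- exact: (sz h').
- exact: (openDI oN (openD_preim sz oN')). 
- by move=> x [Nx N'x]; rewrite fN // (hh' (mu x, \row_i b i x)).
Qed.

(** A vector bundle carries no smoothness axiom for its operations; it comes from the
    trivializations, where addition is that of coordinates. *)
Lemma vadd_smooth (f f' : X -> E) : smooth f -> smooth f' ->
  (forall x, vproj V (f x) = vproj V (f' x)) -> smooth (fun x => vadd V (f x) (f' x)).
Proof.
move=> sf sf' ff'; have smu := smooth_comp sf sV.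
apply: (smooth_via_triv smu) => p.
have [k [W [t [c [tr Wp]]]]] := exists_triv (vproj V (f p)).
have Wp' : W (vproj V (f' p)) by rewrite -ff'.
have [b [N [Cb oN Np bN]]] := Cinf_on_vec cX
  (fun j => Cinf_on_preim sf (coord_Cinf_on tr j)) Wp.
have [b' [N' [Cb' oN' Np' bN']]] := Cinf_on_vec cX
  (fun j => Cinf_on_preim sf' (coord_Cinf_on tr j)) Wp'.
exists k, W, t, c, (fun i x => b i x + b' i x).
exists ((N `&` N') `&` (vproj V \o f) @^-1` W); split=> //.
- exact: (openDI (openDI oN oN') (openD_preim smu (triv_open tr))).
- by move=> i; exact: Cinf_add.
move=> x [[Nx N'x] Wx].
have -> : \row_i (b i x + b' i x) = c (f x) + c (f' x).
  by apply/rowP => j; rewrite !mxE bN // bN'.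
by rewrite /= (trivD tr) // !(triv_coordK tr) //= ff'.
Qed.

Lemma vscale_smooth (g : X -> R) (f : X -> E) : Cinf g -> smooth f ->
  smooth (fun x => vscale V (g x) (f x)).
Proof.
move=> Cg sf; have smu := smooth_comp sf sV.
apply: (smooth_via_triv smu) => p.
have [k [W [t [c [tr Wp]]]]] := exists_triv (vproj V (f p)).
have [b [N [Cb oN Np bN]]] := Cinf_on_vec cX
  (fun j => Cinf_on_preim sf (coord_Cinf_on tr j)) Wp.
exists k, W, t, c, (fun i x => g x * b i x).
exists (N `&` (vproj V \o f) @^-1` W); split=> //.
- exact: (openDI oN (openD_preim smu (triv_open tr))).
- by move=> i; exact: Cinf_mul.
move=> x [Nx Wx].
have -> : \row_i (g x * b i x) = g x *: c (f x) by apply/rowP => j; rewrite !mxE bN.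
by rewrite /= (trivZ tr) // (triv_coordK tr).
Qed.

Lemma vzero_smooth (mu : X -> M) : smooth mu -> smooth (fun x => vzero V (mu x)).
Proof.
move=> smu; apply: (smooth_via_triv smu) => p.
have [k [W [t [c [tr Wp]]]]] := exists_triv (mu p).
exists k, W, t, c, (fun=> fun=> 0), (mu @^-1` W); split=> //.
- exact: (openD_preim smu (triv_open tr)).
- by move=> i; exact: Cinf_cst.
move=> x Wx; rewrite -(triv0 fV tr) //; congr (t _ _).
by apply/rowP => j; rewrite !mxE.
Qed.

End Smoothness.

(** * Global sections and cosections from local frames *)

Section Sections.
Hypothesis vbV : vector_bundle V.
Let fV : fibre_space V. Proof. by case: vbV. Qed.
Let sV : smooth (vproj V). Proof. by case: vbV. Qed.
Let cE : closedD E. Proof. by case: vbV => /manifold_closed. Qed.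
Let cM : closedD M. Proof. by case: vbV => _ /manifold_closed. Qed.
Local Notation Gam := (Gamma (vproj V)).

Lemma Gamma_add s s' : Gam s -> Gam s' -> Gam (addS V s s').
Proof.
move=> [ss ps] [ss' ps']; split=> [|m].
  by apply: (vadd_smooth vbV cM) => // m; rewrite ps ps'.
by rewrite proj_add // ps // ps'.
Qed.

Lemma Gamma_scale f s : Cinf f -> Gam s -> Gam (scaleS V f s).
Proof.
move=> Cf [ss ps]; split=> [|m]; first exact: (vscale_smooth vbV cM).
by rewrite proj_scale // ps.
Qed.

Lemma Gamma_zero : Gam (vzero V).
Proof.
split=> [|m]; last exact: proj_zero.
exact: (vzero_smooth vbV cM (@smooth_id _ M)).
Qed.

Section Cut.
Variables (k : nat) (W : set M) (t : M -> 'rV[R]_k -> E) (c : E -> 'rV[R]_k).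
Hypothesis tr : trivialization V W t c.
Variable chi : M -> R.
Hypothesis bchi : bump_on W chi.

Definition cut_section (a : 'rV[R]_k) (m : M) : E :=
  if `[< W m >] then t m (chi m *: a) else vzero V m.

Lemma cut_sectionT a m : W m -> cut_section a m = t m (chi m *: a).
Proof. by move=> Wm; rewrite /cut_section asboolT. Qed.

Lemma cut_sectionF a m : ~ W m -> cut_section a m = vzero V m.
Proof. by move=> Wm; rewrite /cut_section asboolF. Qed.

Lemma cut_section0 a m : chi m = 0 -> cut_section a m = vzero V m.
Proof.
move=> c0; have [Wm|Wm] := pselect (W m); last exact: cut_sectionF.
by rewrite cut_sectionT // c0 scale0r (triv0 fV tr).
Qed.

Lemma Gamma_cut a : Gam (cut_section a).
Proof.
split=> [|m]; last first.
  have [Wm|Wm] := pselect (W m); first by rewrite cut_sectionT // (triv_proj tr).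
  by rewrite cut_sectionF // proj_zero.
apply: (smooth_via_triv cM (@smooth_id _ M)) => p.
have [Wp|Wp] := pselect (W p).
  exists k, W, t, c, (fun i m => chi m * a 0 i), W; split=> //.
  - exact: (triv_open tr).
  - by move=> i; apply: Cinf_mul => //; [exact: bchi.1|exact: Cinf_cst].
  move=> m Wm; rewrite cut_sectionT //; congr (t _ _).
  by apply/rowP => j; rewrite !mxE.
(* Outside W the section is zero near p, and a trivialization around p, unrelated to t, exhibits
   this. *)
have [N [oN Np N0]] := bchi.2 p Wp.
have [k' [W' [t' [c' [tr' Wp']]]]] := exists_triv vbV p.
exists k', W', t', c', (fun=> fun=> 0), (N `&` W'); split=> //.
- exact: (openDI oN (triv_open tr')).
- by move=> i; exact: Cinf_cst.
move=> m [Nm W'm]; rewrite cut_section0 ?N0 // -(triv0 fV tr') //; congr (t' _ _).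
by apply/rowP => j; rewrite !mxE.
Qed.

Definition cut_form (al : 'I_k -> R) (e : E) : R :=
  chi (vproj V e) * \sum_j al j * c e 0 j.

Lemma Cinf_cut_form al : Cinf (cut_form al).
Proof.
apply: (Cinf_cut cE (bump_preim sV bchi)) => p Wp.
have [b [N [Cb oN Np bN]]] := Cinf_on_vec cE (fun j => coord_Cinf_on tr j) Wp.
exists (fun e => \sum_j al j * b j e), N; split=> //.
  apply: Cinf_sum => // j; apply: Cinf_mul => //; exact: Cinf_cst.
by move=> e Ne; apply: eq_bigr => j _; rewrite bN.
Qed.

Lemma cut_form_linear al m : linear_at V setT m (cut_form al).
Proof.
have [Wm|Wm] := pselect (W m); last first.
  have c0 := bump_on0 bchi Wm.
  split=> [e e' _ _ pe pe'|a e _ pe].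
    by rewrite /cut_form proj_add ?pe ?pe' // c0 !mul0r addr0.
  by rewrite /cut_form proj_scale ?pe // c0 !mul0r mulr0.
split=> [e e' _ _ pe pe'|a e _ pe].
  rewrite /cut_form proj_add ?pe ?pe' // (coordD tr) ?pe ?pe' //.
  rewrite -mulrDr -big_split /=; congr (_ * _).
  by apply: eq_bigr => j _; rewrite mxE mulrDr.
rewrite /cut_form proj_scale // (coordZ tr) ?pe // mulrCA; congr (_ * _).
rewrite mulr_sumr; apply: eq_bigr => j _.
by rewrite mxE mulrCA.
Qed.

Definition cut_cosection (al : 'I_k -> R) (m : M) : dual V setT :=
  mkdual V setT m (cut_form al).

Lemma cut_cosectionE al m e : vproj V e = m -> cut_cosection al m e = cut_form al e.
Proof. by move=> pe; apply: mkdualTE => //; exact: cut_form_linear. Qed.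

Lemma Gamma_cut_cosection al : Gamma (vproj (dual_vb V setT)) (cut_cosection al).
Proof.
split=> [|m]; last exact: mkdual_base.
apply: (@smooth_generated _ _ cM _ _ (cut_cosection al)) => _ [[f Cf ->]|[s [[ss ps] _] ->]].
  by under eq_fun do rewrite mkdual_base.
rewrite (_ : (fun m => _) = fun m => cut_form al (s m)); first exact/ss/Cinf_cut_form.
apply/funext => m; rewrite /ev mkdual_base; exact: cut_cosectionE.
Qed.

Lemma cut_cosection_fun al :
  (fun x => cut_cosection al (vproj V x) x) = cut_form al.
Proof. by apply/funext => x; rewrite cut_cosectionE. Qed.

Lemma cut_form_coord j x : cut_form (fun i => (i == j)%:R) x = chi (vproj V x) * c x 0 j.
Proof.
rewrite /cut_form (bigD1 j) //= big1 ?addr0 ?eqxx ?mul1r //.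
by move=> i /negbTE ->; rewrite mul0r.
Qed.

Lemma cut_cosection_coord j x :
  cut_cosection (fun i => (i == j)%:R) (vproj V x) x = chi (vproj V x) * c x 0 j.
Proof. by rewrite cut_cosectionE // cut_form_coord. Qed.

End Cut.

Definition kills_sub (U : set E) (xi : M -> dual V setT) :=
  forall q, U q -> xi (vproj V q) q = 0.

Lemma kills_cut_cosection U k r W (t : M -> 'rV[R]_k -> E) c chi (j : 'I_k) :
  trivialization V W t c -> bump_on W chi ->
  (forall e, W (vproj V e) -> U e -> forall i : 'I_k, (r <= i)%N -> c e 0 i = 0) ->
  (r <= j)%N -> kills_sub U (cut_cosection c chi (fun i => (i == j)%:R)).
Proof.
move=> tr bchi HU rj x Ux; rewrite (cut_cosection_coord tr bchi).
have [Wx|Wx] := pselect (W (vproj V x)); last by rewrite (bump_on0 bchi Wx) mul0r.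
by rewrite (HU x) // mulr0.
Qed.

Lemma cut_section_sub (U : set E) k r W (t : M -> 'rV[R]_k -> E) c chi (i : 'I_k) m :
  trivialization V W t c -> U (vzero V m) ->
  (forall e, W (vproj V e) -> (forall j : 'I_k, (r <= j)%N -> c e 0 j = 0) -> U e) ->
  (i < r)%N -> U (cut_section W t chi (delta_mx 0 i) m).
Proof.
move=> tr U0 HU ir; have [Wm|Wm] := pselect (W m); last by rewrite cut_sectionF.
rewrite cut_sectionT //; apply: HU; rewrite ?(triv_proj tr) // => j rj.
rewrite (triv_coord tr) // !mxE eqxx /=.
by case: eqP => [ji|_]; rewrite ?mulr0 //; rewrite -ji ltnNge rj in ir.
Qed.

(** The coordinates of psi in the dual frame at m are kept constant and cut off by a bump function
    with value 1 at m. *)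
Lemma cosection_through m psi : linear_at V setT m psi ->
  exists2 xi : M -> dual V setT, Gamma (vproj (dual_vb V setT)) xi &
    forall e, vproj V e = m -> xi m e = psi e.
Proof.
move=> lin; have [k [W [t [c [tr Wm]]]]] := exists_triv vbV m.
have [chi bchi chi1] := exists_bump cM (triv_open tr) Wm.
exists (cut_cosection c chi (fun j => psi (t m (delta_mx 0 j)))).
  exact: (Gamma_cut_cosection tr bchi).
move=> e pe; rewrite (cut_cosectionE tr bchi) // /cut_form pe chi1 mul1r.
rewrite -[in RHS](triv_coordK tr Wm pe) (triv_expand fV tr _ Wm lin).
by apply: eq_bigr => j _; rewrite mulrC.
Qed.

Lemma subbundle_section (D : set E) : subbundle V D setT ->
  forall e, D e -> exists s, [/\ Gam s, forall m, D (s m) & s (vproj V e) = e].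
Proof.
move=> [_ [k [r Ht]]] e De.
have [W [t [c [tr Wm HD]]]] := Ht (vproj V e) I.
have [chi bchi chi1] := exists_bump cM (triv_open tr) Wm.
exists (cut_section W t chi (c e)); split.
- exact: (Gamma_cut tr bchi).
- move=> m; have [Wm'|Wm'] := pselect (W m).
    rewrite cut_sectionT //; apply/HD; rewrite ?(triv_proj tr) // => j rj.
    by rewrite (triv_coord tr) // mxE (HD e Wm I).1 // mulr0.
  rewrite cut_sectionF //.
  (* Off W the section is zero, and a zero vector lies in D because D is cut out by linear equations
     near every point of the base. *)
  have [W' [t' [c' [tr' Wm2 HD']]]] := Ht m I.
  apply/HD'; rewrite ?proj_zero // => j _.
  by rewrite (coord0 fV tr') // mxE.
- by rewrite cut_sectionT // chi1 scale1r (triv_coordK tr).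
Qed.

Lemma subbundle_zero D m : subbundle V D setT -> D (vzero V m).
Proof.
move=> [_ [k [r Ht]]]; have [W [t [c [tr Wm HD]]]] := Ht m I.
by apply/HD; rewrite ?proj_zero // => j _; rewrite (coord0 fV tr) // mxE.
Qed.

Lemma subbundle_add D e e' : subbundle V D setT -> D e -> D e' -> vproj V e = vproj V e' ->
  D (vadd V e e').
Proof.
move=> [_ [k [r Ht]]] De De' ee'; have [W [t [c [tr Wm HD]]]] := Ht (vproj V e) I.
have Wm' : W (vproj V e') by rewrite -ee'.
apply/HD; rewrite ?proj_add // => j rj; rewrite (coordD tr) // mxE.
by rewrite (HD e Wm I).1 // (HD e' Wm' I).1 // addr0.
Qed.

Lemma subbundle_scale D a e : subbundle V D setT -> D e -> D (vscale V a e).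
Proof.
move=> [_ [k [r Ht]]] De; have [W [t [c [tr Wm HD]]]] := Ht (vproj V e) I.
apply/HD; rewrite ?proj_scale // => j rj; rewrite (coordZ tr) // mxE.
by rewrite (HD e Wm I).1 // mulr0.
Qed.

(** The coordinates of index at least r cut out U locally; multiplied by a bump function they become
    global cosections that kill U, and these are the tests needed. *)
Lemma subbundle_separated (U : set E) q : subbundle V U setT ->
  (forall xi, Gamma (vproj (dual_vb V setT)) xi -> Cinf (fun x => xi (vproj V x) x) ->
     kills_sub U xi -> xi (vproj V q) q = 0) ->
  U q.
Proof.
move=> [_ [k [r Ht]]] Hxi.
have [W [t [c [tr Wm HU]]]] := Ht (vproj V q) I.
have [chi bchi chi1] := exists_bump cM (triv_open tr) Wm.
apply/HU => // j rj.
have kx := kills_cut_cosection tr bchi (fun e We Ue => (HU e We I).1 Ue) rj.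
have Cf := Cinf_cut_form tr bchi (fun i => (i == j)%:R).
rewrite -(cut_cosection_fun tr bchi) in Cf.
have := Hxi _ (Gamma_cut_cosection tr bchi _) Cf kx.
by rewrite (cut_cosection_coord tr bchi) chi1 mul1r.
Qed.

End Sections.

End Bundles.

(** * Tangent vectors along a subbundle *)

Section Tangent.
Variable R : realType.

Lemma near_eq_derive1 (f g : R -> R) (t : R) : (\forall s \near t, f s = g s) ->
  derive1 f t = derive1 g t.
Proof. by move=> fg; rewrite !derive1E; exact: near_eq_derive. Qed.

Lemma RD_derivable (f : R -> R) (t : R) : @Cinf R (RD R) f -> derivable f t 1.
Proof. by move=> Cf; exact: (Cf 0%N). Qed.

Lemma derive1M (f g : R -> R) (t : R) : derivable f t 1 -> derivable g t 1 ->
  derive1 (fun s => f s * g s) t = f t * derive1 g t + g t * derive1 f t.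
Proof.
move=> df dg; rewrite !derive1E.
exact: (@deriveM R R f g t 1 df dg).
Qed.

Lemma derive1D (f g : R -> R) (t : R) : derivable f t 1 -> derivable g t 1 ->
  derive1 (fun s => f s + g s) t = derive1 f t + derive1 g t.
Proof.
move=> df dg; rewrite !derive1E.
exact: (@deriveD R R R f g t 1 df dg).
Qed.

Lemma derive1_smooth_comp n phi (f : 'I_n -> R -> R) (t : R) :
  smooth_fun_on setT phi -> (forall i, @Cinf R (RD R) (f i)) ->
  derive1 (fun s => phi (\row_i f i s)) t =
  \sum_i 'D_(delta_mx 0 i : 'rV_n) phi (\row_i f i t) * derive1 (f i) t.
Proof.
move=> sphi Cf; rewrite derive1E.
have dphi : differentiable phi (\row_i f i t) by exact: (sphi 1%N).1.
by have [_ ->] := chain_rule dphi (fun i => RD_derivable (Cf i)).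
Qed.

(** Near the common starting point h is a smooth function of generators, each depending on the base
    point alone or on the coordinates alone. With a common base curve, the chain rule sees only the
    first derivatives of the coordinates. *)
Lemma derive1_prod_curve (M : diffspace R) k (mu : R -> M) (a a' : 'I_k -> R -> R)
    (h : prodD M (RnD R k) -> R) :
  smooth (X := RD R) mu ->
  (forall i, @Cinf R (RD R) (a i)) -> (forall i, @Cinf R (RD R) (a' i)) ->
  (forall i, a i 0 = a' i 0) -> (forall i, derive1 (a i) 0 = derive1 (a' i) 0) ->
  Cinf h ->
  derive1 (fun t => h (mu t, \row_i a i t)) 0 = derive1 (fun t => h (mu t, \row_i a' i t)) 0.
Proof.
move=> smu Ca Ca' aa0 daa Ch.
have row0 : \row_i a i 0 = \row_i a' i 0 by apply/rowP => j; rewrite !mxE.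
have [n [g [phi [e [e0 Gg sphi gh]]]]] := Ch (mu 0, \row_i a i 0).
have sz b : (forall i, @Cinf R (RD R) (b i)) ->
    smooth (X := RD R) (Y := prodD M (RnD R k)) (fun t => (mu t, \row_i b i t)).
  by move=> Cb; exact: (smooth_pair (@closed_RD R) smu (smooth_row (@closed_RD R) Cb)).
have Cg b : (forall i, @Cinf R (RD R) (b i)) ->
    forall i, @Cinf R (RD R) (fun t => g i (mu t, \row_j b j t)).
  move=> Cb i; case: (Gg i) => -[f Cf ->] /=; first exact: smu.
  exact: (smooth_row (@closed_RD R) Cb).
have nearh b : (forall i, @Cinf R (RD R) (b i)) -> \row_i b i 0 = \row_i a i 0 ->
    \forall t \near (0 : R), h (mu t, \row_i b i t) = phi (\row_i g i (mu t, \row_j b j t)).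
  move=> Cb b0; have := @near_norm _ _ _ 0 e e0 (Cg b Cb).
  by apply: filterS => t H; apply: gh => i; have := H i; rewrite b0.
rewrite (near_eq_derive1 (nearh a Ca erefl)) (near_eq_derive1 (nearh a' Ca' (esym row0))).
rewrite !derive1_smooth_comp //; try exact: Cg.
apply: eq_bigr => i _; rewrite row0; congr (_ * _).
case: (Gg i) => -[f Cf ->] //=.
by rewrite !derive1_smooth_comp // row0; apply: eq_bigr => j _; rewrite daa.
Qed.

Variables (Q M : diffspace R) (V : vbundle Q M) (U : set Q).
Hypothesis vbV : vector_bundle V.
Hypothesis subU : subbundle V U setT.
Let fV : fibre_space V. Proof. by case: vbV. Qed.
Let sV : smooth (vproj V). Proof. by case: vbV. Qed.
Let cM : closedD M. Proof. by case: vbV => _ /manifold_closed. Qed.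

(** A curve with velocity v may leave U. Its base curve mu is kept, and its fibre part is replaced
    by u(mu) + s w(mu) with u, w sections of U. Choosing u through q matches the position, and w is
    chosen to match the velocity. *)
Lemma tangent_subbundle (q : Q) (v : (Q -> R) -> R) : U q -> tangent_at q v ->
  (forall xi, Gamma (vproj (dual_vb V setT)) xi -> Cinf (fun x => xi (vproj V x) x) ->
     kills_sub U xi -> v (fun x => xi (vproj V x) x) = 0) ->
  exists gamma, [/\ curve_at q gamma, forall t, U (gamma t) & represents gamma v].
Proof.
move=> Uq [ga [sga ga0] rga] vxi.
have [u [[su pu] uU uq]] := subbundle_section vbV subU Uq.
have [_ [k [r Ht]]] := subU.
have [W [t [c [tr Wm HU]]]] := Ht (vproj V q) I.
pose mu s := vproj V (ga s).
have smu : smooth (X := RD R) mu by exact: smooth_comp sga sV.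
have mu0 : mu 0 = vproj V q by rewrite /mu ga0.
have sumu : smooth (X := RD R) (fun s => u (mu s)) by exact: smooth_comp smu su.
have nearW : \forall s \near (0 : R), W (mu s).
  by apply: near_openD smu (triv_open tr) _; rewrite mu0.
have rep (f : R -> Q) : smooth (X := RD R) f -> (forall s, vproj V (f s) = mu s) ->
    exists b : 'I_k -> R -> R, [/\ forall i, @Cinf R (RD R) (b i),
      \row_i b i 0 = c (f 0) &
      \forall s \near (0 : R), c (f s) = \row_i b i s].
  move=> sf pf; have Wf0 : W (vproj V (f 0)) by rewrite pf mu0.
  have [b [N [Cb oN N0 bN]]] := Cinf_on_vec (@closed_RD R)
    (fun j => Cinf_on_preim sf (coord_Cinf_on tr j)) Wf0.
  have rowb s : N s -> c (f s) = \row_i b i s.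
    by move=> Ns; apply/rowP => j; rewrite mxE bN.
  exists b; split=> //; first by rewrite -rowb.
  have := near_openD (@smooth_id _ (RD R)) oN N0.
  by apply: filterS.
have [b [Cb b0 nb]] := rep ga sga (fun=> erefl).
have [b' [Cb' b'0 nb']] := rep _ sumu (fun s => pu (mu s)).
(* The fibre part of the velocity relative to the section u; the curve stays in U to first order
   exactly when a lies in U. *)
pose a : 'rV[R]_k := \row_j (derive1 (b j) 0 - derive1 (b' j) 0).
have a_ge (j : 'I_k) : (r <= j)%N -> a 0 j = 0.
  move=> rj; rewrite mxE.
  have -> : derive1 (b' j) 0 = 0.
    transitivity (derive1 (fun=> 0 : R) (0 : R)); last exact: derive1_cst.
    apply: near_eq_derive1; move: nb' nearW; apply: filterS2 => s bs Ws.
    have := congr1 (fun x : 'rV_k => x 0 j) bs; rewrite mxE => <-.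
    by apply: (HU (u (mu s)) _ I).1; rewrite ?pu.
  (* The test function is chi times the j-th coordinate. In the product rule the term with the
     derivative of chi drops out because that coordinate of q is 0. *)
  have [chi bchi chi1] := exists_bump cM (triv_open tr) Wm.
  pose al i : R := (i == j)%:R.
  have formE e : cut_form V c chi al e = chi (vproj V e) * c e 0 j.
    by rewrite -(cut_cosection_coord vbV tr bchi) (cut_cosectionE vbV tr bchi).
  have kx := kills_cut_cosection vbV tr bchi (fun e We Ue => (HU e We I).1 Ue) rj.
  have Cal := Cinf_cut_form vbV tr bchi al.
  have := vxi _ (Gamma_cut_cosection vbV tr bchi al).
  rewrite (cut_cosection_fun vbV tr bchi) => /(_ Cal kx); rewrite rga //.
  rewrite /velocity; have -> : derive1 (fun s => cut_form V c chi al (ga s)) 0 =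
      derive1 (fun s => chi (mu s) * b j s) 0.
    apply: near_eq_derive1; move: nb; apply: filterS => s bs.
    by rewrite formE bs mxE.
  have dchi : derivable (fun s => chi (mu s)) 0 1.
    by apply: RD_derivable; apply: smu; exact: bchi.1.
  rewrite (derive1M dchi (RD_derivable (Cb j))).
  have -> : b j 0 = 0.
    have := congr1 (fun x : 'rV_k => x 0 j) b0; rewrite mxE => ->.
    by rewrite ga0; apply: (HU q Wm I).1.
  by rewrite mul0r addr0 mu0 chi1 mul1r => ->; rewrite subrr.
have Uw0 : U (t (vproj V q) a).
  apply/HU; rewrite ?(triv_proj tr) // => j rj.
  by rewrite (triv_coord tr) // a_ge.
have [w [[sw pw] wU ww]] := subbundle_section vbV subU Uw0.
rewrite (triv_proj tr) // in ww.
have swmu : smooth (X := RD R) (fun s => w (mu s)) by exact: smooth_comp smu sw.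
have [b'' [Cb'' b''0 nb'']] := rep _ swmu (fun s => pw (mu s)).
pose ga' s := vadd V (u (mu s)) (vscale V s (w (mu s))).
have puw s : vproj V (u (mu s)) = vproj V (vscale V s (w (mu s))).
  by rewrite proj_scale // pu pw.
have pga' s : vproj V (ga' s) = mu s by rewrite /ga' proj_add // pu.
have sga' : smooth (X := RD R) ga'.
  have sw' := vscale_smooth vbV (@closed_RD R) (@Cinf_RD_id R) swmu.
  exact: (vadd_smooth vbV (@closed_RD R) sumu sw' puw).
have ga'0 : ga' 0 = q.
  by rewrite /ga' (vscale0 fV (pw _)) vaddr0 ?pu // mu0.
exists ga'; split=> //.
  move=> s; apply: (subbundle_add vbV subU) => //.
  exact: (subbundle_scale vbV).
move=> f Cf; rewrite rga // /velocity.
have Wq : W (mu 0) by rewrite mu0.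
have [h [N [Ch oN Nq hN]]] := triv_Cinf_on tr Cf (p := (mu 0, c q)) Wq.
(* Coordinates of the new curve: at 0 they equal those of q, and their derivative there is that of
   b' plus a, that is, that of b. *)
pose d i s := b' i s + s * b'' i s.
have Cd i : @Cinf R (RD R) (d i).
  apply: (Cinf_add (@closed_RD R)) => //; apply: (Cinf_mul (@closed_RD R)) => //.
  exact: Cinf_RD_id.
have nearf (f' : R -> Q) (e : 'I_k -> R -> R) : (forall s, vproj V (f' s) = mu s) ->
   f' 0 = q -> (forall i, @Cinf R (RD R) (e i)) ->
   (\forall s \near (0 : R), c (f' s) = \row_i e i s) ->
   derive1 (fun s => f (f' s)) 0 = derive1 (fun s => h (mu s, \row_i e i s)) 0.
  move=> pf f0 Ce ne; apply: near_eq_derive1.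
  have sz : smooth (X := RD R) (Y := prodD M (RnD R k)) (fun s => (mu s, \row_i e i s)).
    exact: (smooth_pair (@closed_RD R) smu (smooth_row (@closed_RD R) Ce)).
  have e0 : \row_i e i 0 = c q by rewrite -f0; exact/esym/(nbhs_singleton ne).
  have nN : \forall s \near (0 : R), N (mu s, \row_i e i s).
    by apply: near_openD sz oN _; rewrite e0.
  move: ne nearW nN; apply: filterS3 => s es Ws Ns.
  rewrite -(hN _ Ns) /= -es (triv_coordK tr) ?pf //.
rewrite (nearf ga b) // (nearf ga' d) //; last first.
  move: nb' nb'' nearW; apply: filterS3 => s bs' bs'' Ws.
  rewrite /ga' (coordD tr _ (puw s)) ?pu // (coordZ tr) ?pw // bs' bs''.
  by apply/rowP => j; rewrite !mxE.
apply: derive1_prod_curve => // i.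
  have := congr1 (fun x : 'rV_k => x 0 i) b0.
  have := congr1 (fun x : 'rV_k => x 0 i) b'0.
  by rewrite !mxE /d mul0r addr0 => -> ->; rewrite mu0 uq ga0.
have did : derivable (id : R -> R) 0 1 by exact: derivable_id.
have db'' := RD_derivable (Cb'' i).
have -> : derive1 (d i) 0 = derive1 (b' i) 0 + b'' i 0.
  rewrite (derive1D (RD_derivable (Cb' i)) (derivableM did (db'' _))).
  rewrite (derive1M did (db'' _)) mul0r add0r.
  suff -> : derive1 (fun s : R => s) 0 = 1 by rewrite mulr1.
  by rewrite derive1E; exact: derive_id.
have := congr1 (fun x : 'rV_k => x 0 i) b''0.
rewrite mxE => ->; rewrite mu0 ww (triv_coord tr) // mxE.
by rewrite addrC subrK.
Qed.

End Tangent.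

(** * Metric double vector bundles with a Lagrangian splitting *)

Section DvbAlgebra.
Variables (R : realType) (X : dvb R).
Hypothesis hX : double_vector_bundle X.
Implicit Types (e d c : tE X) (q u : tQ X) (b : tB X) (m : tM X).
Local Notation prQ := (vproj (vQ X)).
Local Notation prB := (vproj (vB X)).
Local Notation pQ := (vproj (qQ X)).
Local Notation pB := (vproj (qB X)).
Local Notation zQ := (vzero (vQ X)).
Local Notation zB := (vzero (vB X)).
Local Notation "e +Q e'" := (vadd (vQ X) e e') (at level 50, left associativity).
Local Notation "e +B e'" := (vadd (vB X) e e') (at level 50, left associativity).
Local Notation "a *Q e" := (vscale (vQ X) a e) (at level 40).
Local Notation "a *B e" := (vscale (vB X) a e) (at level 40).

Lemma dvb_vQ : vector_bundle (vQ X). Proof. by case: hX => [[]]. Qed.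
Lemma dvb_vB : vector_bundle (vB X). Proof. by case: hX => [[]]. Qed.
Lemma dvb_qQ : vector_bundle (qQ X). Proof. by case: hX => [[]]. Qed.
Lemma dvb_qB : vector_bundle (qB X). Proof. by case: hX => [[]]. Qed.

Lemma vb_fibre (E' M' : diffspace R) (V : vbundle E' M') : vector_bundle V -> fibre_space V.
Proof. by case. Qed.

Let fQ := vb_fibre dvb_vQ.
Let fB := vb_fibre dvb_vB.
Let fqQ := vb_fibre dvb_qQ.
Let fqB := vb_fibre dvb_qB.

Lemma pB_prB e : pB (prB e) = pQ (prQ e).
Proof. by case: hX => _ [_ _ H _ _] _ _ _; exact: H. Qed.

Lemma prB_addQ e e' : prQ e = prQ e' -> prB (e +Q e') = vadd (qB X) (prB e) (prB e').
Proof. by case: hX => _ [_ _ _ H _] _ _ _; exact: H. Qed.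

Lemma prB_scQ a e : prB (a *Q e) = vscale (qB X) a (prB e).
Proof. by case: hX => _ [_ _ _ _ H] _ _ _; exact: H. Qed.

Lemma prQ_zB b : prQ (zB b) = vzero (qQ X) (pB b).
Proof. by case: hX => _ _ [_ _ H _ _] _ _; exact: H. Qed.

Lemma zBD b b' : pB b = pB b' -> zB (vadd (qB X) b b') = zB b +Q zB b'.
Proof. by case: hX => _ _ [_ _ _ H _] _ _; exact: H. Qed.

Lemma prQ_scB a e : prQ (a *B e) = vscale (qQ X) a (prQ e).
Proof. by case: hX => _ _ _ H _; case: (H a). Qed.

Lemma scB_addQ a e e' : prQ e = prQ e' -> a *B (e +Q e') = a *B e +Q a *B e'.
Proof. by case: hX => _ _ _ H _; case: (H a) => _ _ _ K _; exact: K. Qed.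

Lemma prQ_addB e e' : prB e = prB e' -> prQ (e +B e') = vadd (qQ X) (prQ e) (prQ e').
Proof. by case: hX => _ _ _ _ [H _ _]; exact: H. Qed.

Lemma interchange e1 e2 e3 e4 : prB e1 = prB e2 -> prB e3 = prB e4 ->
  prQ e1 = prQ e3 -> prQ e2 = prQ e4 ->
  (e1 +Q e3) +B (e2 +Q e4) = (e1 +B e2) +Q (e3 +B e4).
Proof. by case: hX => _ _ _ _ [_ H _]; exact: H. Qed.

Lemma scQ_addB a e e' : prB e = prB e' -> a *Q (e +B e') = a *Q e +B a *Q e'.
Proof. by case: hX => _ _ _ _ [_ _ H] ee'; rewrite H. Qed.

Lemma prB_zQ q : prB (zQ q) = vzero (qB X) (pQ q).
Proof.
have pz := proj_zero fQ q.
have := congr1 prB (vscale0 fQ pz); rewrite prB_scQ => <-.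
by rewrite (vscale0 fqB (m := pQ q)) // pB_prB pz.
Qed.

(** By the interchange law the right-hand side is its own double for the addition over Q, hence a
    zero of that structure. *)
Lemma zQ_addB q q' : pQ q = pQ q' -> zQ (vadd (qQ X) q q') = zQ q +B zQ q'.
Proof.
move=> qq'; have bb' : prB (zQ q) = prB (zQ q') by rewrite !prB_zQ qq'.
have := @vadd_idem _ _ _ _ fQ (zQ q +B zQ q'); rewrite prQ_addB // !(proj_zero fQ) => -> //.
by rewrite -interchange // !(vaddr0 fQ) // (proj_zero fQ).
Qed.

Lemma zQ_scB a q : zQ (vscale (qQ X) a q) = a *B zQ q.
Proof.
have := @vadd_idem _ _ _ _ fQ (a *B zQ q); rewrite prQ_scB (proj_zero fQ) => -> //.
by rewrite -scB_addQ // (vaddr0 fQ) // (proj_zero fQ).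
Qed.

Lemma zQ_zero m : zQ (vzero (qQ X) m) = zB (vzero (qB X) m).
Proof.
have := @vadd_idem _ _ _ _ fQ (zB (vzero (qB X) m)).
rewrite prQ_zB (proj_zero fqB) => -> //.
by rewrite -zBD // (vaddr0 fqB) // (proj_zero fqB).
Qed.

Lemma coreP c : core c ->
  prQ c = vzero (qQ X) (pQ (prQ c)) /\ prB c = vzero (qB X) (pQ (prQ c)).
Proof. by move=> [m [-> ->]]; rewrite (proj_zero fqQ). Qed.

Lemma core_intro e m : prQ e = vzero (qQ X) m -> prB e = vzero (qB X) m -> core e.
Proof. by exists m. Qed.

(** The Eckmann-Hilton argument: both structures have the same zeros over m, and they satisfy the
    interchange law. *)
Lemma core_addBQ c c' : core c -> core c' -> pQ (prQ c) = pQ (prQ c') -> c +B c' = c +Q c'.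
Proof.
move=> /coreP[qc bc] /coreP[qc' bc'] cc'.
set m := pQ (prQ c) in qc bc cc' *; rewrite -cc' in qc' bc'.
have z0 := zQ_zero m.
have e1 : c = c +Q zQ (vzero (qQ X) m) by rewrite (vaddr0 fQ).
have e2 : c' = zQ (vzero (qQ X) m) +Q c' by rewrite (vadd0r fQ).
rewrite [in LHS]e1 [in LHS]e2 interchange ?(proj_zero fQ) //.
- by rewrite {1}z0 (vaddr0 fB) // z0 (vadd0r fB).
- by rewrite prB_zQ (proj_zero fqQ).
- by rewrite prB_zQ (proj_zero fqQ).
Qed.

Lemma prB_core_add q c : core c -> pQ (prQ c) = pQ q -> prB (zQ q +B c) = vzero (qB X) (pQ q).
Proof. by move=> /coreP[_ bc] cq; rewrite (proj_add fB) prB_zQ // bc cq. Qed.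

Lemma prQ_core_add q c : core c -> pQ (prQ c) = pQ q -> prQ (zQ q +B c) = q.
Proof.
move=> /coreP[qc bc] cq; rewrite prQ_addB ?prB_zQ ?bc ?cq //.
by rewrite (proj_zero fQ) qc (vaddr0 fqQ).
Qed.

(** The kernel of the projection to B is the sum of Q and the core; c is obtained by subtracting the
    zero vector over [prQ e] along B. *)
Lemma zero_decomp e m : prB e = vzero (qB X) m -> exists c,
  [/\ core c, pQ (prQ c) = m & e = zQ (prQ e) +B c].
Proof.
move=> be; have m_e : pQ (prQ e) = m by rewrite -pB_prB be (proj_zero fqB).
have bz : prB (-1 *B zQ (prQ e)) = prB e by rewrite (proj_scale fB) prB_zQ m_e be.
exists (e +B (-1 *B zQ (prQ e))).
have qc : prQ (e +B -1 *B zQ (prQ e)) = vzero (qQ X) m.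
  by rewrite prQ_addB // prQ_scB (proj_zero fQ) (vaddN fqQ) m_e.
split.
- by apply: (@core_intro _ m) => //; rewrite (proj_add fB).
- by rewrite qc (proj_zero fqQ).
have bz' : prB (zQ (prQ e)) = prB e by rewrite prB_zQ m_e be.
rewrite (@vaddC _ _ _ _ fB e) // (vaddA fB) ?bz' ?bz // (vaddN fB) bz'.
by rewrite (vadd0r fB).
Qed.

End DvbAlgebra.

(** * The metric in terms of a Lagrangian splitting *)

Section MetricAlgebra.
Variables (R : realType) (X : dvb R) (g : tE X -> tE X -> R) (Sg : tQ X -> tB X -> tE X).
Hypothesis hg : metric_dvb g.
Hypothesis hS : lagrangian_splitting g Sg.
Implicit Types (e d c : tE X) (q u : tQ X) (b : tB X) (m : tM X).
Local Notation prQ := (vproj (vQ X)).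
Local Notation prB := (vproj (vB X)).
Local Notation pQ := (vproj (qQ X)).
Local Notation pB := (vproj (qB X)).
Local Notation zQ := (vzero (vQ X)).
Local Notation zB := (vzero (vB X)).
Local Notation "e +Q e'" := (vadd (vQ X) e e') (at level 50, left associativity).
Local Notation "e +B e'" := (vadd (vB X) e e') (at level 50, left associativity).
Local Notation "a *Q e" := (vscale (vQ X) a e) (at level 40).
Local Notation "a *B e" := (vscale (vB X) a e) (at level 40).

Lemma metric_dvbX : double_vector_bundle X. Proof. by case: hg. Qed.
Let hX := metric_dvbX.
Let fQ := vb_fibre (dvb_vQ hX).
Let fB := vb_fibre (dvb_vB hX).
Let fqQ := vb_fibre (dvb_qQ hX).
Let fqB := vb_fibre (dvb_qB hX).

Lemma gC e d : prB e = prB d -> g e d = g d e.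
Proof. by case: hg => _ [H _ _ _ _] _; exact: H. Qed.

Lemma gDl e e' d : prB e = prB e' -> prB e' = prB d -> g (e +B e') d = g e d + g e' d.
Proof. by case: hg => _ [_ H _ _ _] _; exact: H. Qed.

Lemma gZl a e d : prB e = prB d -> g (a *B e) d = a * g e d.
Proof. by case: hg => _ [_ _ H _ _] _; exact: H. Qed.

Lemma gDr e d d' : prB d = prB d' -> prB d' = prB e -> g e (d +B d') = g e d + g e d'.
Proof.
move=> dd' d'e; rewrite gC ?(proj_add fB) ?dd' // gDl //.
by rewrite (gC (e := d)) ?dd' // (gC (e := d')).
Qed.

Lemma gZr a e d : prB e = prB d -> g e (a *B d) = a * g e d.
Proof. by move=> ed; rewrite gC ?(proj_scale fB) // gZl // gC. Qed.

Lemma g_nondegenerate e : (forall d, prB e = prB d -> g e d = 0) -> e = zB (prB e).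
Proof. by case: hg => _ [_ _ _ H _] _; exact: H. Qed.

Lemma g0l e b : prB e = b -> g (zB b) e = 0.
Proof.
move=> eb; rewrite -(vscale_zero fB 0 b) gZl ?(proj_zero fB) //.
by rewrite mul0r.
Qed.

Lemma betaE e d : prB d = prB e -> beta g e d = g e d.
Proof.
move=> de; apply: mkdualTE => //; split=> [d1 d2 _ _ b1 b2|a d1 _ b1].
  by rewrite gDr ?b1 ?b2.
by rewrite gZr ?b1.
Qed.

(** This is the compatibility of [beta] with the additions over Q and over C^*, evaluated on pairs
    of points. *)
Lemma g_addQ e e' d d' : prQ e = prQ e' -> prQ d = prQ d' -> prB d = prB e ->
  prB d' = prB e' -> g (e +Q e') (d +Q d') = g e d + g e' d'.
Proof.
move=> ee' dd' de d'e'; case: hg => _ _ [_ _ _ _ [H _]].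
have [_ /(_ d d')] := H _ _ ee'; rewrite !mkdual_base !betaE //; first exact.
by rewrite !(prB_addQ hX) // de d'e'.
Qed.

Lemma g_scQ a e d : prB d = prB e -> g (a *Q e) (a *Q d) = a * g e d.
Proof.
move=> de; case: hg => _ _ [_ _ _ _ [_ H]].
have [_ _ /(_ d)] := H a e; rewrite mkdual_base !betaE //; first exact.
by rewrite !(prB_scQ hX) de.
Qed.

Lemma g_core c c' : core c -> core c' -> pQ (prQ c) = pQ (prQ c') -> g c c' = 0.
Proof.
move=> kc kc' cc'; have [qc bc] := coreP hX kc; have [qc' bc'] := coreP hX kc'.
have b1 : prB c = prB c' by rewrite bc bc' cc'.
(* Doubling is the same in both bundle structures on the core, and pairing is
   additive along Q but bilinear along B: 2 g(c,c') = 4 g(c,c'). *)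
have := @g_addQ c c c' c' erefl erefl (esym b1) (esym b1).
rewrite -!(core_addBQ hX) // gDl ?(proj_add fB) // !gDr //.
move=> H; have : g c c' + g c c' = 0.
  by apply: (@addrI _ (g c c' + g c c')); rewrite addr0.
by move/eqP; rewrite -mulr2n mulrn_eq0 /= => /eqP.
Qed.

Lemma Sg_prQ q b : pQ q = pB b -> prQ (Sg q b) = q.
Proof. by case: hS => -[H _ _ _ _] _ /H[]. Qed.

Lemma Sg_prB q b : pQ q = pB b -> prB (Sg q b) = b.
Proof. by case: hS => -[H _ _ _ _] _ /H[]. Qed.

Lemma Sg_addl q q' b : pQ q = pB b -> pQ q' = pB b ->
  Sg (vadd (qQ X) q q') b = Sg q b +B Sg q' b.
Proof. by case: hS => -[_ H _ _ _] _; exact: H. Qed.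

Lemma Sg_addr q b b' : pQ q = pB b -> pQ q = pB b' ->
  Sg q (vadd (qB X) b b') = Sg q b +Q Sg q b'.
Proof. by case: hS => -[_ _ H _ _] _; exact: H. Qed.

Lemma Sg_scl a q b : pQ q = pB b -> Sg (vscale (qQ X) a q) b = a *B Sg q b.
Proof. by case: hS => -[_ _ _ H _] _ /(H a)[]. Qed.

Lemma Sg_scr a q b : pQ q = pB b -> Sg q (vscale (qB X) a b) = a *Q Sg q b.
Proof. by case: hS => -[_ _ _ H _] _ /(H a)[]. Qed.

Lemma Sg_zeror q : Sg q (vzero (qB X) (pQ q)) = zQ q.
Proof.
have o : pQ q = pB (vzero (qB X) (pQ q)) by rewrite (proj_zero fqB).
have := @vadd_idem _ _ _ _ fQ (Sg q (vzero (qB X) (pQ q))); rewrite Sg_prQ //; apply.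
by rewrite -Sg_addr // (vaddr0 fqB) // (proj_zero fqB).
Qed.

Lemma Sg_lagrangian q q' b : pQ q = pB b -> pQ q' = pB b -> g (Sg q b) (Sg q' b) = 0.
Proof. by case: hS => _ /(_ b)[_ H _] qb q'b; apply: H; [exists q|exists q']. Qed.

Lemma g_zQ q q' : pQ q = pQ q' -> g (zQ q) (zQ q') = 0.
Proof.
by move=> qq'; rewrite -(Sg_zeror q) -(Sg_zeror q') qq' Sg_lagrangian ?(proj_zero fqB).
Qed.

(* With the splitting, e corresponds to the triple of its two projections and
   the covector [covec e] on the fibre of Q, its core component. *)
Definition covec e q := g e (Sg q (prB e)).

Let over_e e q : pQ q = pQ (prQ e) -> pQ q = pB (prB e).
Proof. by rewrite (pB_prB hX). Qed.

(** The B-component changes under addition over Q, but the splitting is additive in B too, so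
    [g_addQ] applies to both arguments. *)
Lemma covecD e e' q : prQ e = prQ e' -> pQ q = pQ (prQ e) ->
  covec (e +Q e') q = covec e q + covec e' q.
Proof.
move=> ee' qe; have o := over_e qe; have o' : pQ q = pB (prB e').
  by apply: over_e; rewrite -ee'.
by rewrite /covec (prB_addQ hX) // Sg_addr // g_addQ ?Sg_prQ ?Sg_prB.
Qed.

Lemma covecZ a e q : pQ q = pQ (prQ e) -> covec (a *Q e) q = a * covec e q.
Proof.
by move=> qe; have o := over_e qe; rewrite /covec (prB_scQ hX) Sg_scr // g_scQ ?Sg_prB.
Qed.

Lemma covec_linear e : linear_at (qQ X) setT (pQ (prQ e)) (covec e).
Proof.
split=> [q q' _ _ qe qe'|a q _ qe]; rewrite /covec.
  by rewrite Sg_addl ?gDr ?Sg_prB //; exact: over_e.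
by rewrite Sg_scl ?gZr ?Sg_prB //; exact: over_e.
Qed.

Lemma covec_Sg q q' b : pQ q = pB b -> pQ q' = pB b -> covec (Sg q b) q' = 0.
Proof. by move=> o o'; rewrite /covec Sg_prB // Sg_lagrangian. Qed.

Lemma covec_core c q q' : core c -> pQ (prQ c) = pQ q -> pQ q' = pQ q ->
  covec (zQ q +B c) q' = g c (zQ q').
Proof.
move=> kc cq q'q; have [qc bc] := coreP hX kc; rewrite /covec (prB_core_add hX) // -q'q Sg_zeror.
by rewrite gDl ?(prB_zQ hX) ?bc ?cq ?q'q // g_zQ ?add0r.
Qed.

(** Write d as a zero vector plus a core element c. Since the core is isotropic, pairing c with any
    point over the zero of B only involves the covector of d; so c is in the kernel of the
    metric. *)
Lemma covec_eq0 d m : prB d = vzero (qB X) m -> (forall q, pQ q = m -> covec d q = 0) ->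
  d = zQ (prQ d).
Proof.
move=> bd ld; have [c [kc cm dc]] := zero_decomp hX bd.
have md : pQ (prQ d) = m by rewrite -(pB_prB hX) bd (proj_zero fqB).
have [qc bc] := coreP hX kc; rewrite cm in qc bc.
suff c0 : c = zB (prB c).
  by rewrite {1}dc c0 (vaddr0 fB) // (prB_zQ hX) md bc.
apply: g_nondegenerate => e be.
have me : prB e = vzero (qB X) m by rewrite -be bc.
have [c' [kc' c'm ec]] := zero_decomp hX me.
have mqe : pQ (prQ e) = m by rewrite -(pB_prB hX) me (proj_zero fqB).
have [_ bc'] := coreP hX kc'; rewrite c'm in bc'.
rewrite ec gDr ?(prB_zQ hX) ?mqe ?bc' ?bc // (g_core kc kc') ?cm // addr0.
by rewrite -(covec_core (q := prQ d)) ?cm ?mqe ?md // -dc ld.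
Qed.

(** The difference along Q lies over the zero of B and has zero covector, which reduces to
    [covec_eq0]. *)
Lemma covec_inj e e' : prQ e = prQ e' -> prB e = prB e' ->
  (forall q, pQ q = pQ (prQ e) -> covec e q = covec e' q) -> e = e'.
Proof.
move=> qee' bee' lee'; pose d := e +Q -1 *Q e'.
have qe' : prQ e = prQ (-1 *Q e') by rewrite (proj_scale fQ).
have bd : prB d = vzero (qB X) (pQ (prQ e)).
  by rewrite (prB_addQ hX) // (prB_scQ hX) bee' (vaddN fqB) (pB_prB hX) qee'.
have d0 : d = zQ (prQ e).
  rewrite (covec_eq0 bd) ?(proj_add fQ) // => q qe.
  by rewrite covecD // covecZ ?lee' ?mulN1r ?subrr // -qee'.
have : d +Q e' = e'.
  by rewrite d0 (vadd0r fQ).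
rewrite /d -(vaddA fQ) ?(proj_scale fQ) // (@vaddC _ _ _ _ fQ (-1 *Q e')) ?(proj_scale fQ) //.
by rewrite (vaddN fQ) (vaddr0 fQ).
Qed.

(** Subtract from e and d, along B, the lifts of their Q-components. The lifts pair to zero, the
    remainders lie over the zero of Q and pair to zero as well, and the two mixed terms are the
    covectors. *)
Lemma g_covec e d : prB e = prB d -> g e d = covec e (prQ d) + covec d (prQ e).
Proof.
set b := prB e => bd.
have fl f : prB f = b -> exists f', [/\ prB f' = b, prQ f' = vzero (qQ X) (pB b) &
    f = f' +B Sg (prQ f) b].
  move=> bf; have of_ : pQ (prQ f) = pB b by rewrite -(pB_prB hX) bf.
  exists (f +B -1 *B Sg (prQ f) b).
  have bS : prB f = prB (-1 *B Sg (prQ f) b) by rewrite (proj_scale fB) Sg_prB.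
  split; first by rewrite (proj_add fB).
    by rewrite (prQ_addB hX) // (prQ_scB hX) Sg_prQ // (vaddN fqQ) of_.
  have pS : prB (Sg (prQ f) b) = prB f by rewrite Sg_prB.
  rewrite -(vaddA fB) ?(proj_scale fB) //.
  by rewrite (@vaddC _ _ _ _ fB (-1 *B _)) ?(proj_scale fB) // (vaddN fB) pS (vaddr0 fB).
(* Points over b and over the zero of Q are core elements added along Q to the zero vector of b;
   [g_addQ] then splits the pairing into two vanishing terms. *)
have vert x y : prB x = b -> prQ x = vzero (qQ X) (pB b) ->
    prB y = b -> prQ y = vzero (qQ X) (pB b) -> g x y = 0.
  have dec h : prB h = b -> prQ h = vzero (qQ X) (pB b) ->
      exists c, [/\ core c, prQ c = vzero (qQ X) (pB b) & h = c +Q zB b].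
    move=> bh qh; exists (h +Q -1 *Q zB b).
    have qh' : prQ h = prQ (-1 *Q zB b) by rewrite (proj_scale fQ) (prQ_zB hX).
    have qc : prQ (h +Q -1 *Q zB b) = vzero (qQ X) (pB b) by rewrite (proj_add fQ).
    split=> //.
      apply: (core_intro qc); rewrite (prB_addQ hX) // (prB_scQ hX) (proj_zero fB) bh.
      by rewrite (vaddN fqB).
    have qhz : prQ h = prQ (zB b) by rewrite qh (prQ_zB hX).
    rewrite -(vaddA fQ) ?(proj_scale fQ) //.
    by rewrite (@vaddC _ _ _ _ fQ (-1 *Q _)) ?(proj_scale fQ) // (vaddN fQ) (vaddr0 fQ).
  move=> bx qx by_ qy.
  have [c [kc qc ->]] := dec x bx qx; have [c' [kc' qc' ->]] := dec y by_ qy.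
  have [_ bc] := coreP hX kc; have [_ bc'] := coreP hX kc'.
  rewrite g_addQ ?qc ?qc' ?(prQ_zB hX) ?bc ?bc' ?qc ?qc' //.
  by rewrite g_core ?qc ?qc' // g0l ?(proj_zero fB) // addr0.
have [e' [be' qe' eE]] := fl e erefl; have [d' [bd' qd' dE]] := fl d (esym bd).
have oe : pQ (prQ e) = pB b by rewrite -(pB_prB hX).
have od : pQ (prQ d) = pB b by rewrite -(pB_prB hX) -bd.
have -> : covec e (prQ d) = g e' (Sg (prQ d) b).
  by rewrite /covec -/b {1}eE gDl ?Sg_prB // Sg_lagrangian // addr0.
have -> : covec d (prQ e) = g d' (Sg (prQ e) b).
  by rewrite /covec -bd {1}dE gDl ?Sg_prB // Sg_lagrangian // addr0.
rewrite {1}eE {1}dE gDl ?gDr ?(proj_add fB) ?Sg_prB ?be' ?bd' //.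
rewrite vert // add0r Sg_lagrangian // addr0; congr (_ + _).
by rewrite gC ?Sg_prB.
Qed.

Lemma beta_coreE c q : core c -> pQ q = pQ (prQ c) -> beta_core g c q = g c (zQ q).
Proof.
move=> kc qc; have [_ bc] := coreP hX kc.
apply: mkdualTE => //; split=> [q1 q2 _ _ q1c q2c|a q1 _ q1c].
  have bz i : pQ i = pQ (prQ c) -> prB (zQ i) = prB c by move=> ic; rewrite (prB_zQ hX) bc ic.
  by rewrite (zQ_addB hX) ?gDr ?bz // q1c q2c.
by rewrite (zQ_scB hX) gZr // (prB_zQ hX) bc q1c.
Qed.

Lemma Gamma_sigmaB (b' : tM X -> tB X) : Gamma pB b' -> Gamma prQ (sigmaB Sg b').
Proof.
move=> [sb pb]; have o q : pQ q = pB (b' (pQ q)) by rewrite pb.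
split=> [|q]; last by rewrite /sigmaB Sg_prQ.
have cQ : closedD (tQ X) by case: (dvb_qQ hX) => /manifold_closed.
have spQ : smooth pQ by case: (dvb_qQ hX).
have sp := smooth_pair cQ (@smooth_id _ (tQ X)) (smooth_comp spQ sb).
case: hS => -[_ _ _ _ sS] _.
exact: smooth_comp (smooth_sub cQ o sp) sS.
Qed.

Lemma sigmaB_prB (b' : tM X -> tB X) q : Gamma pB b' -> prB (sigmaB Sg b' q) = b' (pQ q).
Proof. by move=> [_ pb]; rewrite /sigmaB Sg_prB // pb. Qed.

Lemma Gamma_core_base (c' : tM X -> tE X) m : Gamma_core c' -> pQ (prQ (c' m)) = m.
Proof. by move=> [[_ H] _]; exact: H. Qed.

Lemma core_section_prB (c' : tM X -> tE X) q : Gamma_core c' ->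
  prB (core_section c' q) = vzero (qB X) (pQ q).
Proof.
by move=> gc; apply: (prB_core_add hX); [exact: gc.2|exact: Gamma_core_base].
Qed.

Lemma core_section_prQ (c' : tM X -> tE X) q : Gamma_core c' -> prQ (core_section c' q) = q.
Proof.
by move=> gc; apply: (prQ_core_add hX); [exact: gc.2|exact: Gamma_core_base].
Qed.

Lemma core_section_covec (c' : tM X -> tE X) q q' : Gamma_core c' -> pQ q' = pQ q ->
  covec (core_section c' q) q' = beta_core g (c' (pQ q)) q'.
Proof.
move=> gc q'q; have kc := gc.2 (pQ q); have cm := Gamma_core_base (pQ q) gc.
by rewrite beta_coreE ?cm // covec_core.
Qed.

Lemma Gamma_core_section (c' : tM X -> tE X) : Gamma_core c' -> Gamma prQ (core_section c').
Proof.
move=> gc; split=> [|q]; last exact: core_section_prQ.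
have cQ : closedD (tQ X) by case: (dvb_qQ hX) => /manifold_closed.
have spQ : smooth pQ by case: (dvb_qQ hX).
have sz := vzero_smooth (dvb_vQ hX) cQ (@smooth_id _ (tQ X)).
have sc := smooth_comp spQ gc.1.1.
apply: (vadd_smooth (dvb_vB hX) cQ sz sc) => q.
have [_ bc] := coreP hX (gc.2 (pQ q)).
by rewrite (prB_zQ hX) /= bc Gamma_core_base.
Qed.

Lemma Cinf_generator (T : Type) (G : set (T -> R)) f : G f -> generated G f.
Proof.
move=> Gf p; exists 1%N, (fun=> f), (fun x => x 0 0), 1; split=> //.
  exact: smooth_coord.
by move=> x _; rewrite mxE.
Qed.

(** The section is the preimage under [beta] of the functional tau o prQ on the fibre over the zero
    of B. It lies over the zero of B by construction; that it also lies over the zero of Q follows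
    from nondegeneracy, because the functional vanishes on the core. *)
Lemma exists_core_section tau : @GammaQdual _ X tau ->
  exists2 c' : tM X -> tE X, Gamma_core c' & forall m, beta_core g (c' m) = tau m.
Proof.
move=> [stau ptau].
have cM : closedD (tM X) by case: (dvb_qQ hX) => _ /manifold_closed.
have [_ [bi [sbi betaK biK]]] : diffeo (beta g) by case: hg => _ _ [].
have lint m : linear_at (vB X) setT (vzero (qB X) m) (fun e => tau m (prQ e)).
  have [lD lZ] := Defs.dlin (tau m); have bm := ptau m.
  have base e : prB e = vzero (qB X) m -> pQ (prQ e) = dbase (tau m).
    by move=> be; rewrite -(pB_prB hX) be (proj_zero fqB); exact/esym/bm.
  split=> [e e' _ _ be be'|a e _ be].
    by rewrite (prQ_addB hX) ?be ?be' // lD //; exact: base.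
  by rewrite (prQ_scB hX) lZ //; exact: base.
pose Psi m : EdualB X := mkdual (vB X) setT (vzero (qB X) m) (fun e => tau m (prQ e)).
have sPsi : smooth Psi.
  apply: (@smooth_generated _ _ cM _ _ Psi) => _ [[f Cf ->]|[s [[ss ps] _] ->]].
    under eq_fun do rewrite mkdual_base.
    exact: (vzero_smooth (dvb_qB hX) cM (@smooth_id _ (tM X)) Cf).
  pose v m := prQ (s (vzero (qB X) m)).
  have gv : Gamma pQ v.
    split=> [|m]; last by rewrite /v -(pB_prB hX) ps (proj_zero fqB).
    have sz := vzero_smooth (dvb_qB hX) cM (@smooth_id _ (tM X)).
    apply: smooth_comp (smooth_comp sz ss) _.
    by case: (dvb_vQ hX).
  (* Smoothness of Psi reduces to that of tau: a section of E over B induces the section v of Q,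
     obtained along the zero section of B. *)
  have -> : (fun m => @ev R _ _ (vB X) setT s (Psi m)) =
      fun m => @ev R _ _ (qQ X) setT v (tau m).
    apply/funext => m; rewrite /ev mkdual_base (mkdualTE fB (lint m) (ps _)).
    by congr (tau m (v _)); exact/esym/ptau.
  by apply: stau; apply: Cinf_generator; right; exists v.
pose c' m := bi (Psi m).
have bc m : prB (c' m) = vzero (qB X) m.
  by have := congr1 (@dbase _ _ _ _ _) (biK (Psi m)); rewrite !mkdual_base.
have gc m d : prB d = vzero (qB X) m -> g (c' m) d = tau m (prQ d).
  by move=> bd; rewrite -betaE ?bc // biK mkdualTE.
have tau0 m : tau m (vzero (qQ X) m) = 0.
  by apply: linear_at_zero => //; have := Defs.dlin (tau m); rewrite (ptau m : dbase _ = m).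
have qc m : prQ (c' m) = vzero (qQ X) m.
  have [c1 [kc1 c1m cE]] := zero_decomp hX (bc m).
  have pm : pQ (prQ (c' m)) = m by rewrite -(pB_prB hX) bc (proj_zero fqB).
  have [_ bc1] := coreP hX kc1; rewrite c1m in bc1.
  have bz : prB (zQ (prQ (c' m))) = vzero (qB X) m by rewrite (prB_zQ hX) pm.
  (* The zero vector over the Q-component is orthogonal to the whole fibre: to zero vectors by
     isotropy, and to core elements because c' is orthogonal to them and so is its own core part. *)
  have z0 : zQ (prQ (c' m)) = zB (vzero (qB X) m).
    rewrite -bz; apply: g_nondegenerate; rewrite bz => e be.
    have [c2 [kc2 c2m eE]] := zero_decomp hX (esym be).
    have [qc2 bc2] := coreP hX kc2; rewrite c2m in bc2 qc2.
    have pme : pQ (prQ e) = m by rewrite -(pB_prB hX) -be (proj_zero fqB).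
    rewrite eE gDr ?(prB_zQ hX) ?pme ?pm ?bc2 // g_zQ ?pm ?pme // add0r.
    have := gc m c2 bc2; rewrite qc2 tau0 {1}cE gDl ?bz ?bc1 ?bc2 //.
    by rewrite (g_core kc1 kc2) ?c1m ?c2m // addr0.
  by have := congr1 prQ z0; rewrite (proj_zero fQ) (prQ_zB hX) (proj_zero fqB).
have kc m : core (c' m) by exists m.
exists c'; first split=> //.
  split=> [|m]; last by rewrite /= qc (proj_zero fqQ).
  exact: smooth_comp sPsi sbi.
move=> m; apply: dual_ext; first by rewrite mkdual_base /= qc (proj_zero fqQ); exact/esym/ptau.
rewrite mkdual_base /= qc (proj_zero fqQ) => q _ qm.
rewrite beta_coreE ?qc ?(proj_zero fqQ) // gc ?(prB_zQ hX) ?qm //.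
by rewrite (proj_zero fQ).
Qed.

(** * Points of a maximal isotropic double subbundle *)

Section Isotropic.
Variables (D : set (tE X)) (U : set (tQ X)) (B' : set (tB X)).
Hypothesis hD : maximal_isotropic_dvb g D U B'.
Hypothesis hA : adapted Sg D U B'.

Lemma D_prQ e : D e -> U (prQ e).
Proof. by case: hD => -[[H _] _ _ _] _; exact: H. Qed.

Lemma D_prB e : D e -> B' (prB e).
Proof. by case: hD => -[_ [H _] _ _] _; exact: H. Qed.

(** The span of S and e is still isotropic, so maximality forces e into S. *)
Lemma max_isotropic_in b (S : set (tE X)) e : maximal_isotropic_fibre g b S ->
  prB e = b -> (forall s, S s -> g e s = 0) -> g e e = 0 -> S e.
Proof.
move=> [[Sb S0 SD SZ] Si Smax] be es ee.
have bS s a : S s -> prB s = prB (a *B e) by move=> Ss; rewrite (proj_scale fB) be Sb.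
apply: (Smax [set x | exists s a, S s /\ x = s +B a *B e]).
- split.
  + by move=> _ [s [a [Ss ->]]]; rewrite (proj_add fB (bS s a Ss)) Sb.
  + exists (zB b), 0; split=> //.
    by rewrite (vscale0 fB be) (vaddr0 fB) // (proj_zero fB).
  + move=> _ _ [s [a [Ss ->]]] [s' [a' [Ss' ->]]].
    exists (s +B s'), (a + a'); split; first exact: SD.
    have bs a1 := bS s a1 Ss; have bs' a1 := bS s' a1 Ss'.
    have ss' : prB s = prB s' by rewrite !Sb.
    have pe a1 : prB (a1 *B e) = b by rewrite (proj_scale fB).
    have ps := Sb _ Ss; have ps' := Sb _ Ss'.
    rewrite (vscaleDl fB) (vaddA fB) ?(proj_add fB) ?pe ?ps ?ps' //.
    rewrite (vaddA fB) ?(proj_add fB) ?pe ?ps ?ps' //; congr (_ +B _).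
    rewrite -(vaddA fB) ?pe ?ps ?ps' // (@vaddC _ _ _ _ fB (a *B e)) ?pe ?ps ?ps' //.
    by rewrite (vaddA fB) ?pe ?ps ?ps'.
  + move=> r _ [s [a [Ss ->]]]; exists (r *B s), (r * a); split; first exact: SZ.
    by rewrite (vscaleDr fB) ?(vscaleA fB) //; exact: bS.
- move=> _ _ [s [a [Ss ->]]] [s' [a' [Ss' ->]]].
  have ps := Sb _ Ss; have ps' := Sb _ Ss'.
  have pe a1 : prB (a1 *B e) = b by rewrite (proj_scale fB).
  rewrite gDl ?gDr ?(proj_add fB) ?pe ?ps ?ps' // !gZr ?gZl ?pe ?ps ?ps' ?be //.
  rewrite Si // es // ee (gC (e := s)) ?ps ?be // es //.
  by rewrite !mulr0 !addr0.
- move=> s Ss; exists s, 0; split=> //.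
  by rewrite (vscale0 fB be) (vaddr0 fB) // Sb.
exists (zB b), 1; split=> //.
by rewrite (vscale1 fB) (vadd0r fB).
Qed.

(** An adapted splitting places the lifts of U over B' in D, and isotropy makes the covector vanish
    on U. Conversely, by [g_covec], e is orthogonal to itself and to the fibre of D, which is
    maximal. *)
Lemma D_iff e : U (prQ e) ->
  D e <-> B' (prB e) /\ forall u, U u -> pQ u = pQ (prQ e) -> covec e u = 0.
Proof.
move=> Ue; split=> [De|[Be le]].
  have Be := D_prB De; split=> // u Uu ue.
  have [_ /(_ _ Be)[_ Si _]] := hD.
  apply: Si; first by [].
  split; first by apply: hA => //; rewrite (pB_prB hX).
  by rewrite Sg_prB // (pB_prB hX).
have [_ /(_ _ Be) max] := hD.
suff [] : [set e' | D e' /\ prB e' = prB e] e by [].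
apply: (max_isotropic_in max) => //.
  move=> s [Ds sb]; have Us := D_prQ Ds.
  have pse : pQ (prQ s) = pQ (prQ e) by rewrite -!(pB_prB hX) sb.
  rewrite g_covec // le // add0r /covec.
  have [_ Si _] := max; apply: Si; split=> //.
    by apply: hA => //; [rewrite sb|rewrite sb (pB_prB hX)].
  by rewrite Sg_prB ?sb // (pB_prB hX).
by rewrite g_covec // le // addr0.
Qed.

Let subB' : subbundle (qB X) B' setT. Proof. by case: hD => -[]. Qed.

(** The general lemmas on subbundles are for a subbundle over the whole base; for D, over U, closure
    under the operations is read off from [D_iff]. *)
Lemma D_zero q : U q -> D (zQ q).
Proof.
move=> Uq; apply/D_iff; rewrite (proj_zero fQ) // (prB_zQ hX); split.
  exact: (subbundle_zero (dvb_qB hX)).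
by move=> u Uu uq; rewrite /covec (prB_zQ hX) -uq Sg_zeror g_zQ.
Qed.

Lemma D_addQ e e' : D e -> D e' -> prQ e = prQ e' -> D (e +Q e').
Proof.
move=> De De' ee'; have Ue := D_prQ De.
have [Be le] := (D_iff Ue).1 De.
have [Be' le'] : B' (prB e') /\ forall u, U u -> pQ u = pQ (prQ e') -> covec e' u = 0.
  by apply/D_iff => //; rewrite -ee'.
apply/D_iff; rewrite (proj_add fQ) //; split.
  rewrite (prB_addQ hX) //; apply: (subbundle_add (dvb_qB hX)) => //.
  by rewrite !(pB_prB hX) ee'.
by move=> u Uu ue; rewrite covecD // le // le' ?addr0 // -ee'.
Qed.

Lemma D_scQ a e : D e -> D (a *Q e).
Proof.
move=> De; have Ue := D_prQ De; have [Be le] := (D_iff Ue).1 De.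
apply/D_iff; rewrite (proj_scale fQ) //; split.
  by rewrite (prB_scQ hX); exact: (subbundle_scale (dvb_qB hX)).
by move=> u Uu ue; rewrite covecZ // le // mulr0.
Qed.

End Isotropic.

End MetricAlgebra.

(** * Duality of the two connections *)

Section LieAlgebroids.
Variables (R : realType) (E M : diffspace R) (V : vbundle E M) (L : lie_ops E M).
Hypothesis hL : lie_algebroid V L.
Local Notation Gam := (Gamma (vproj V)).

Lemma lie_vb : vector_bundle V. Proof. by case: hL. Qed.
Let fV : fibre_space V. Proof. exact: vb_fibre lie_vb. Qed.

Lemma anchor_tangent e : tangent_at (vproj V e) (anchor L e).
Proof. by case: hL => _ [[H _ _ _] _]; exact: H. Qed.

Lemma anchorD e e' f : vproj V e = vproj V e' -> Cinf f ->
  anchor L (vadd V e e') f = anchor L e f + anchor L e' f.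
Proof. by case: hL => _ [[_ H _ _] _]; exact: H. Qed.

Lemma anchor_cst0 e : anchor L e (fun=> 0) = 0.
Proof.
have cM : closedD M by case: lie_vb => _ /manifold_closed.
have [ga _ ->] := anchor_tangent e; last exact: Cinf_cst.
exact: derive1_cst.
Qed.

Lemma bracket_Gamma s s' : Gam s -> Gam s' -> Gam (bracket L s s').
Proof. by case: hL => _ [_ [[H _ _ _ _] _]]; exact: H. Qed.

Lemma bracketD s s1 s2 : Gam s -> Gam s1 -> Gam s2 ->
  bracket L s (addS V s1 s2) = addS V (bracket L s s1) (bracket L s s2).
Proof. by case: hL => _ [_ [[_ H _ _ _] _]]; exact: H. Qed.

Lemma bracketC s s' : Gam s -> Gam s' -> bracket L s s' = scaleS V (fun=> -1) (bracket L s' s).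
Proof. by case: hL => _ [_ [[_ _ H _ _] _]]; exact: H. Qed.

Lemma bracket_leibniz s s' f : Gam s -> Gam s' -> Cinf f ->
  bracket L s (scaleS V f s') =
  addS V (scaleS V f (bracket L s s')) (scaleS V (anchorS L s f) s').
Proof. by case: hL => _ [_ [[_ _ _ _ H] _]]; exact: H. Qed.

(** Fibrewise addition obeys the group laws only within a fibre, so values of the sum are computed
    by testing it with linear functionals ([linear_sumS]). *)
Definition sumS (I : Type) (r : seq I) (f : I -> M -> R) (S : I -> M -> E) : M -> E :=
  foldr (addS V) (vzero V) [seq scaleS V (f i) (S i) | i <- r].

Lemma Gamma_sumS (I : Type) (r : seq I) f (S : I -> M -> E) :
  (forall i, Cinf (f i)) -> (forall i, Gam (S i)) -> Gam (sumS r f S).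
Proof.
move=> Cf GS; elim: r => [|i r IH]; first exact: (Gamma_zero lie_vb).
by apply: (Gamma_add lie_vb) => //; exact: (Gamma_scale lie_vb).
Qed.

Lemma linear_sumS (I : Type) (r : seq I) f (S : I -> M -> E) m psi :
  (forall i, vproj V (S i m) = m) -> linear_at V setT m psi ->
  vproj V (sumS r f S m) = m /\ psi (sumS r f S m) = \sum_(i <- r) f i m * psi (S i m).
Proof.
move=> pS lin; have [lD lZ] := lin; elim: r => [|i r [pr IH]] /=.
  by rewrite big_nil (linear_at_zero fV lin) (proj_zero fV).
have pi : vproj V (scaleS V (f i) (S i) m) = m by rewrite (proj_scale fV) pS.
rewrite /sumS /= /addS (proj_add fV) ?pi ?pr // big_cons lD ?pi ?pr //.
by rewrite -/(sumS r f S) IH lZ.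
Qed.

Lemma sumS_eq0 (I : Type) (r : seq I) f (S : I -> M -> E) m :
  (forall i, vproj V (S i m) = m) -> (forall i, f i m = 0) -> sumS r f S m = vzero V m.
Proof.
move=> pS f0; elim: r => [|i r IH] //=.
rewrite /sumS /= /addS -/(sumS r f S) IH /scaleS f0 (vscale0 fV (pS i)).
by rewrite (vaddr0 fV) // (proj_zero fV).
Qed.

End LieAlgebroids.

(** * The dual Poisson structure read through the metric *)

Section Representation.
Variables (R : realType) (X : dvb R) (g : tE X -> tE X -> R)
    (L : lie_ops (tE X) (tQ X)) (LB : lie_ops (tB X) (tM X))
    (Sg : tQ X -> tB X -> tE X)
    (dQ : Qdual X -> tQ X)
    (nablaQ : (tM X -> tB X) -> (tM X -> tQ X) -> (tM X -> tQ X))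
    (nablaQd : (tM X -> tB X) -> (tM X -> Qdual X) -> (tM X -> Qdual X))
    (Rc : tB X -> tB X -> tQ X -> Qdual X).
Hypothesis hE : metric_vb_algebroid g L LB.
Hypothesis hS : lagrangian_splitting g Sg.
Hypothesis hrep : two_representation g L LB Sg dQ nablaQ nablaQd Rc.
Local Notation prQ := (vproj (vQ X)).
Local Notation prB := (vproj (vB X)).
Local Notation pQ := (vproj (qQ X)).
Local Notation pB := (vproj (qB X)).
Local Notation zQ := (vzero (vQ X)).
Local Notation "e +Q e'" := (vadd (vQ X) e e') (at level 50, left associativity).
Local Notation "e +B e'" := (vadd (vB X) e e') (at level 50, left associativity).
Local Notation "a *Q e" := (vscale (vQ X) a e) (at level 40).
Local Notation lam := (covec g Sg).

Let hg : metric_dvb g. Proof. by case: hE. Qed.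
Let hX : double_vector_bundle X. Proof. exact: metric_dvbX hg. Qed.
Let fQ := vb_fibre (dvb_vQ hX).
Let fqB := vb_fibre (dvb_qB hX).

Lemma core_add e e' : core e -> core e' -> vproj (core_vb X) e = vproj (core_vb X) e' ->
  core (vadd (core_vb X) e e') /\ vproj (core_vb X) (vadd (core_vb X) e e') = vproj (core_vb X) e.
Proof.
move=> ke ke' /= ee'; have [qe be] := coreP hX ke; have [qe' be'] := coreP hX ke'.
have qq : prQ e = prQ e' by rewrite qe qe' ee'.
split; last by rewrite (proj_add fQ).
apply: (core_intro (m := pQ (prQ e))); first by rewrite (proj_add fQ).
by rewrite (prB_addQ hX) // be be' -ee' (vaddr0 fqB) // (proj_zero fqB).
Qed.

Lemma core_scale a e : core e ->
  core (vscale (core_vb X) a e) /\ vproj (core_vb X) (vscale (core_vb X) a e) = vproj (core_vb X) e.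
Proof.
move=> ke; have [qe be] := coreP hX ke.
split=> /=; last by rewrite (proj_scale fQ).
apply: (core_intro (m := pQ (prQ e))); first by rewrite (proj_scale fQ).
by rewrite (prB_scQ hX) be (vscale_zero fqB).
Qed.

(** [mkdual] falls back to 0 on nonlinear input, so the formula rests on linearity over the core,
    which is an instance of the interchange law. *)
Lemma EdualQ_C_core (Phi : EdualQ X) c : core c -> pQ (prQ c) = pQ (dbase Phi) ->
  EdualQ_C Phi c = Phi (zQ (dbase Phi) +B c).
Proof.
move=> kc cm; apply: mkdualE => //; apply: linear_at_cut.
- by move=> e e' ke ke' ee'; exact: core_add.
- by move=> a e ke; exact: core_scale.
have [lD lZ] := Defs.dlin Phi.
set q := dbase Phi in cm lD lZ *.
have bz e : core e -> pQ (prQ e) = pQ q -> prB (zQ q) = prB e.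
  by move=> ke eq_; have [_ ->] := coreP hX ke; rewrite (prB_zQ hX) eq_.
split=> [e e' ke ke' /= eq_ e'q|a e ke /= eq_].
  have [qe _] := coreP hX ke; have [qe' _] := coreP hX ke'.
  have qq : prQ e = prQ e' by rewrite qe qe' eq_ e'q.
  rewrite -lD ?(prQ_core_add hX) // -(interchange hX) ?bz // ?(proj_zero fQ) //.
  - by rewrite (vaddr0 fQ) // (proj_zero fQ).
  - exact: bz.
  - exact: bz.
have e1 := lZ a (zQ q +B e) I; rewrite (prQ_core_add hX) // in e1.
rewrite -e1 // (scQ_addB hX _ (bz e ke eq_)).
by rewrite (vscale_zero fQ).
Qed.

Lemma beta_Q_core q c : core c -> pQ (prQ c) = pQ q -> beta_Q g q c = g (zQ q) c.
Proof.
move=> kc cm; apply: mkdualE => //; apply: linear_at_cut.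
- by move=> e e' ke ke' ee'; exact: core_add.
- by move=> a e ke; exact: core_scale.
have bz e : core e -> pQ (prQ e) = pQ q -> prB (zQ q) = prB e.
  by move=> ke eq_; have [_ ->] := coreP hX ke; rewrite (prB_zQ hX) eq_.
split=> [e e' ke ke' /= eq_ e'q|a e ke /= eq_].
  by rewrite -(core_addBQ hX) ?eq_ ?e'q // (gDr hg) -?bz.
by rewrite -(g_scQ hg) -?bz // (vscale_zero fQ).
Qed.

Lemma beta_Q_Cinf (c : tM X -> tE X) : Gamma_core c ->
  (fun q => @ev R _ _ (core_vb X) (@core R X) c (beta_Q g q)) =
  fun q => beta_core g (c (pQ q)) q.
Proof.
move=> gc; apply/funext => q; rewrite /ev mkdual_base.
have kc := gc.2 (pQ q); have cm := Gamma_core_base (pQ q) gc.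
rewrite beta_Q_core ?cm // (beta_coreE hg) ?cm // (gC hg) //.
by have [_ ->] := coreP hX kc; rewrite (prB_zQ hX) cm.
Qed.

(** Subtracting along Q the lift over b leaves a point over the zero of B, where Phi sees only its
    image in C^*. Hence Phi d minus the pairing of d with [Sg q b] does not depend on d: the lift of
    b defines a linear function on E^*_Q. *)
Lemma EdualQ_decomp (Phi : EdualQ X) d q b : prQ d = dbase Phi -> prB d = b ->
  pQ q = pB b -> EdualQ_C Phi = beta_Q g q ->
  Phi d = Phi (Sg (dbase Phi) b) + g d (Sg q b).
Proof.
move=> dP bd qb PC; set q0 := dbase Phi in dP *.
have q0b : pQ q0 = pB b by rewrite -dP -(pB_prB hX) bd.
have [lD lZ] := Defs.dlin Phi; rewrite -/q0 in lD lZ.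
have qS := Sg_prQ hS q0b; have bS := Sg_prB hS q0b.
have qS' : prQ d = prQ (-1 *Q Sg q0 b) by rewrite (proj_scale fQ) qS.
pose x := d +Q -1 *Q Sg q0 b.
have qx : prQ x = q0 by rewrite (proj_add fQ).
have bx : prB x = vzero (qB X) (pB b).
  by rewrite (prB_addQ hX) // (prB_scQ hX) bS bd (vaddN fqB).
have dx : d = x +Q Sg q0 b.
  rewrite /x -(vaddA fQ) ?(proj_scale fQ) ?qS //.
  rewrite (@vaddC _ _ _ _ fQ (-1 *Q _)) ?(proj_scale fQ) //.
  by rewrite (vaddN fQ) qS (vaddr0 fQ).
have [c [kc cm xE]] := zero_decomp hX bx; rewrite qx in xE.
have lx : g d (Sg q b) = lam x q.
  have -> : g d (Sg q b) = lam d q by rewrite /covec bd.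
  by rewrite dx (covecD hg hS) ?qx ?qS ?q0b ?qb // (covec_Sg hS) ?addr0.
rewrite lx {1}dx lD ?qx ?qS // addrC; congr (_ + _).
rewrite {1}xE -EdualQ_C_core ?cm // PC beta_Q_core ?cm //.
rewrite xE (covec_core hg hS) ?cm ?qb ?q0b // (gC hg) //.
by have [_ ->] := coreP hX kc; rewrite (prB_zQ hX) cm qb.
Qed.

(** The Poisson bracket of the linear functions of the lift of b and of the core section of tau is
    computed twice: as the function of the bracket of the two sections, which gives the connection
    on Q^*, and as a derivative along the anchor of the dual structure, which the metric identifies
    with the anchor of the lift and hence with the derivation dual to [nablaQ b]. *)
Lemma nabla_dual b tau u m : Gamma pB b -> @GammaQdual _ X tau -> Gamma pQ u ->
  nablaQd b tau m (u m) =
  anchorS LB b (fun x => tau x (u x)) m - tau m (nablaQ b u m).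
Proof.
move=> gb gtau gu; have [c gc bc] := exists_core_section hg hS gtau.
have [_ _ /(_ b gb)[_ /(_ tau gtau)[tau' [gtau' dtau anc]]] H4 _] := hrep.
have [c' [gc' bc' brc]] := H4 b tau c gb gtau gc bc.
rewrite -(dtau u gu m); set q := u m.
have qm : pQ q = m by rewrite /q gu.2.
case: hE => _ _ [L' [[P [_ Pev _ _] [_ PC]] anc' _]].
have [[_ [bi [sbi bQK biK]]] _] : diffeo (beta_Q g) /\ True.
  by case: hg => _ _ [_ _ [H _] _ _].
have sbeta : smooth (beta g) by case: hg => _ _ [[]].
have [ssig psig] := Gamma_sigmaB hg hS gb.
(* The lift of b, carried by the metric to a section of E^*_B over C^*. *)
pose Psi x := beta g (sigmaB Sg b (bi x)).
have gPsi : Gamma (@EdualB_C R X) Psi.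
  split=> [|x]; first exact: smooth_comp (smooth_comp sbi ssig) sbeta.
  rewrite /Psi; case: hg => _ _ [_ _ _ -> _].
  by rewrite psig biK.
have pbi Phi : pQ (bi (EdualQ_C Phi)) = pQ (dbase Phi).
  have := congr1 (@dbase _ _ _ _ _) (biK (EdualQ_C Phi)).
  by rewrite !mkdual_base.
have ellF : ell_EdualB Psi (@ev R _ _ (vQ X) setT (sigmaB Sg b)).
  move=> Phi d qd bd; rewrite /Psi mkdual_base (sigmaB_prB hS _ gb) pbi in bd.
  have bm : prB d = prB (sigmaB Sg b (bi (EdualQ_C Phi))).
    by rewrite (sigmaB_prB hS _ gb) pbi.
  rewrite /Psi (betaE hg) // (gC hg) // /sigmaB pbi.
  rewrite (@EdualQ_decomp _ d (bi (EdualQ_C Phi)) (b (pQ (dbase Phi)))) ?biK //.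
    by rewrite addrK.
  by rewrite pbi gb.2.
(* The evaluation point vanishes on lifts and sends a core section to the value at q of its
   covector; its image in C^* is that of q. *)
pose Phi : EdualQ X := mkdual (vQ X) setT q (fun e => lam e q).
have linPhi : linear_at (vQ X) setT q (fun e => lam e q).
  split=> [e e' _ _ qe qe'|a e _ qe]; first by rewrite (covecD hg hS) ?qe ?qe'.
  by rewrite (covecZ hg hS) ?qe.
have PhiC : EdualQ_C Phi = beta_Q g q.
  apply: dual_ext; first by rewrite !mkdual_base.
  rewrite !mkdual_base => e ke /= qe.
  rewrite EdualQ_C_core ?mkdual_base // (mkdualTE fQ linPhi) ?(prQ_core_add hX) //.
  rewrite beta_Q_core // (covec_core hg hS) // (gC hg) //.
  by have [_ ->] := coreP hX ke; rewrite (prB_zQ hX) qe.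
have evc : (fun Phi => @ev R _ _ (core_vb X) (@core R X) c (EdualQ_C Phi)) =
    @ev R _ _ (vQ X) setT (core_section c).
  apply/funext => Phi'; rewrite /ev mkdual_base EdualQ_C_core //; first exact: gc.2.
  exact: Gamma_core_base.
have Cev : Cinf (d := Cdual X) (@ev R _ _ (core_vb X) (@core R X) c).
  by apply: Cinf_generator; right; exists c => //; case: gc.
have := PC Psi _ _ Phi gPsi ellF Cev.
rewrite evc Pev; [|by []|exact: (Gamma_core_section hg gc)].
rewrite brc PhiC /Psi bQK -anc' // (beta_Q_Cinf gc).
have -> : (fun q0 => beta_core g (c (pQ q0)) q0) = fun x => tau (pQ x) x.
  by apply/funext => x; rewrite bc.
rewrite anc qm => <-.
rewrite -bc' (beta_coreE hg) ?Gamma_core_base //; last exact: gc'.2.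
rewrite /ev mkdual_base (mkdualTE fQ linPhi) ?(core_section_prQ hg) //.
rewrite (covec_core hg hS) ?qm //; first exact: gc'.2.
exact: Gamma_core_base.
Qed.

End Representation.

(** * Subalgebroids *)

Section Subalgebroid.
Variables (R : realType) (X : dvb R) (g : tE X -> tE X -> R)
    (L : lie_ops (tE X) (tQ X)) (LB : lie_ops (tB X) (tM X))
    (D : set (tE X)) (U : set (tQ X)) (B' : set (tB X))
    (Sg : tQ X -> tB X -> tE X)
    (dQ : Qdual X -> tQ X)
    (nablaQ : (tM X -> tB X) -> (tM X -> tQ X) -> (tM X -> tQ X))
    (nablaQd : (tM X -> tB X) -> (tM X -> Qdual X) -> (tM X -> Qdual X))
    (Rc : tB X -> tB X -> tQ X -> Qdual X).
Hypothesis hE : metric_vb_algebroid g L LB.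
Hypothesis hD : maximal_isotropic_dvb g D U B'.
Hypothesis hS : lagrangian_splitting g Sg.
Hypothesis hA : adapted Sg D U B'.
Hypothesis hrep : two_representation g L LB Sg dQ nablaQ nablaQd Rc.
Local Notation prQ := (vproj (vQ X)).
Local Notation prB := (vproj (vB X)).
Local Notation pQ := (vproj (qQ X)).
Local Notation pB := (vproj (qB X)).
Local Notation zQ := (vzero (vQ X)).
Local Notation "e +Q e'" := (vadd (vQ X) e e') (at level 50, left associativity).
Local Notation "a *Q e" := (vscale (vQ X) a e) (at level 40).
Local Notation lam := (covec g Sg).
Local Notation GammaB b := (Gamma pB b).
Local Notation ell xi := (fun x => xi (pQ x) x).

Let hg : metric_dvb g. Proof. by case: hE. Qed.
Let hX : double_vector_bundle X. Proof. exact: metric_dvbX hg. Qed.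
Let hL : lie_algebroid (vQ X) L. Proof. by case: hE => _ [_ []]. Qed.
Let hLB : lie_algebroid (qB X) LB. Proof. by case: hE => _ [_ []]. Qed.
Let fQ := vb_fibre (dvb_vQ hX).
Let fqQ := vb_fibre (dvb_qQ hX).
Let fqB := vb_fibre (dvb_qB hX).
Let cQ : closedD (tQ X). Proof. by case: (dvb_qQ hX) => /manifold_closed. Qed.
Let cM : closedD (tM X). Proof. by case: (dvb_qQ hX) => _ /manifold_closed. Qed.
Let subU : subbundle (qQ X) U setT. Proof. by case: hD => -[]. Qed.
Let subB' : subbundle (qB X) B' setT. Proof. by case: hD => -[]. Qed.
Let D_iff := D_iff hg hS hD hA.

Lemma dual_linear (xi : tM X -> Qdual X) m : @GammaQdual _ X xi ->
  linear_at (qQ X) setT m (xi m).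
Proof. by move=> [_ /(_ m) /= pm]; rewrite -{1}pm; exact: Defs.dlin. Qed.

(** Along the line q + t w a linear function is affine in t, with slope its value on w. *)
Lemma vertical_anchor (tau eta : tM X -> Qdual X) c q :
  @GammaQdual _ X tau -> Gamma_core c -> (forall m, beta_core g (c m) = tau m) ->
  @GammaQdual _ X eta -> Cinf (ell eta) ->
  anchor L (core_section c q) (ell eta) = eta (pQ q) (dQ (tau (pQ q))).
Proof.
move=> gtau gc bc geta Ceta; have [[[_ _ pdQ _ _] _ _ _] vert _ _ _] := hrep.
rewrite (vert tau c gtau gc bc q) // /velocity.
set m := pQ q; set w := dQ (tau m).
have pw : pQ w = m by rewrite /w pdQ; exact: gtau.2.
have [lD lZ] := dual_linear m geta.
have -> : (fun t => eta (pQ (vadd (qQ X) q (vscale (qQ X) t w))) (vadd (qQ X) q (vscale (qQ X) t w)))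
    = fun t : R => eta m q + t * eta m w.
  apply/funext => t; have pt : pQ q = pQ (vscale (qQ X) t w) by rewrite (proj_scale fqQ) pw.
  by rewrite (proj_add fqQ) // lD ?(proj_scale fqQ) // lZ.
have did : derivable (id : R -> R) 0 1 by exact: derivable_id.
have dcst (a : R) : derivable (fun=> a : R) (0 : R) 1 by exact: derivable_cst.
rewrite (derive1D (dcst _) (derivableM did (dcst _))) (derive1M did (dcst _)).
rewrite mul0r add0r [derive1 (fun=> _) 0]derive1_cst add0r.
suff -> : derive1 (fun s : R => s) 0 = 1 by rewrite mulr1.
by rewrite derive1E; exact: derive_id.
Qed.

Lemma horizontal_anchor b u (eta : tM X -> Qdual X) m : GammaB b -> Gamma pQ u ->
  @GammaQdual _ X eta ->
  anchor L (sigmaB Sg b (u m)) (ell eta) =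
  anchorS LB b (fun x => eta x (u x)) m - eta m (nablaQ b u m).
Proof.
move=> gb gu geta; have [_ _ hor _ _] := hrep.
have [_ /(_ eta geta)[tau' [_ dtau ->]]] := hor b gb.
by rewrite gu.2 (dtau u gu).
Qed.

Lemma horizontal_anchor_kills b u (eta : tM X -> Qdual X) m : GammaB b -> Gamma pQ u ->
  (forall x, U (u x)) -> @GammaQdual _ X eta -> kills_sub U eta ->
  anchor L (sigmaB Sg b (u m)) (ell eta) = - eta m (nablaQ b u m).
Proof.
move=> gb gu uU geta keta; rewrite horizontal_anchor //.
have -> : (fun x => eta x (u x)) = fun=> 0.
  by apply/funext => x; have := keta _ (uU x); rewrite gu.2.
by rewrite /anchorS (anchor_cst0 hLB) sub0r.
Qed.

Lemma core_section_D (tau : tM X -> Qdual X) c q : @GammaQdual _ X tau -> Gamma_core c ->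
  (forall m, beta_core g (c m) = tau m) -> U q -> annihilator U (tau (pQ q)) ->
  D (core_section c q).
Proof.
move=> gtau gc bc Uq au; apply/D_iff; rewrite (core_section_prQ hg) //.
rewrite (core_section_prB hg) //; split; first exact: (subbundle_zero (dvb_qB hX)).
move=> u Uu uq; rewrite (core_section_covec hg hS) // bc au // uq.
exact/esym/gtau.2.
Qed.

Lemma sigmaB_D b q : GammaB b -> (forall m, B' (b m)) -> U q -> D (sigmaB Sg b q).
Proof. by move=> gb bB' Uq; apply: hA => //; rewrite gb.2. Qed.

(** The curvature term is a core section: it contributes nothing to the B-component, and the lift
    contributes nothing to the covector. *)
Lemma bracket_sigma b b' q : GammaB b -> GammaB b' ->
  prB (bracket L (sigmaB Sg b) (sigmaB Sg b') q) = bracket LB b b' (pQ q) /\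
  forall u, pQ u = pQ q -> lam (bracket L (sigmaB Sg b) (sigmaB Sg b') q) u =
    - Rc (b (pQ q)) (b' (pQ q)) q u.
Proof.
move=> gb gb'; have [[_ _ _ [Rt _ _ _ _]] _ _ _ br] := hrep.
have [phi [kphi bphi ->]] := br b b' gb gb'.
have gbb := bracket_Gamma hLB gb gb'.
have o : pB (b (pQ q)) = pQ q /\ pB (b' (pQ q)) = pQ q by rewrite gb.2 gb'.2.
have pphi : pQ (prQ (phi q)) = pQ q.
  have := congr1 (@dbase _ _ _ _ _) (bphi q); rewrite mkdual_base /= => ->.
  exact: (Rt _ _ _ o).1.
have bh : prB (hom_section phi q) = vzero (qB X) (pQ q) by apply: (prB_core_add hX).
have qh : prQ (hom_section phi q) = q by apply: (prQ_core_add hX).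
rewrite /addS /scaleS /=; set S := sigmaB _ _ _.
have qS : prQ S = q by exact: (Gamma_sigmaB hg hS gbb).2.
have bS : prB S = bracket LB b b' (pQ q) by exact: (sigmaB_prB hS _ gbb).
have qSh : prQ S = prQ (-1 *Q hom_section phi q) by rewrite (proj_scale fQ) qh.
split; first by rewrite (prB_addQ hX) // (prB_scQ hX) bS bh (vscale_zero fqB) (vaddr0 fqB) // gbb.2.
move=> u uq; rewrite (covecD hg hS qSh) ?qS // (covecZ hg hS) ?qh // (covec_Sg hS) ?gbb.2 //.
by rewrite (covec_core hg hS) // -(beta_coreE hg) ?pphi // bphi mulN1r add0r.
Qed.

Lemma covec_smooth s u : Gamma prQ s -> Gamma pQ u -> Cinf (fun q => lam (s q) (u (pQ q))).
Proof.
move=> [ss ps] [su pu].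
have spQ : smooth pQ by case: (dvb_qQ hX).
have sprB : smooth prB by case: (dvb_vB hX).
have o q : pQ (u (pQ q)) = pB (prB (s q)) by rewrite pu (pB_prB hX) ps.
have sp := smooth_pair cQ (smooth_comp spQ su) (smooth_comp ss sprB).
have sSg : smooth (fun q => Sg (u (pQ q)) (prB (s q))).
  by case: hS => -[_ _ _ _ sS] _; exact: smooth_comp (smooth_sub cQ o sp) sS.
have bb q : prB (s q) = prB (Sg (u (pQ q)) (prB (s q))) by rewrite (Sg_prB hS).
case: hg => _ [_ _ _ _ Cg] _.
exact: (smooth_sub cQ bb (smooth_pair cQ ss sSg) Cg).
Qed.

Lemma curve_kills q (v : (tQ X -> R) -> R) f :
  (exists gamma, [/\ curve_at q gamma, forall t, U (gamma t) & represents gamma v]) ->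
  Cinf f -> (forall x, U x -> f x = 0) -> v f = 0.
Proof.
move=> [ga [_ gaU rga]] Cf f0; rewrite rga // /velocity.
have -> : (fun t => f (ga t)) = fun=> 0 by apply/funext => t; exact: f0.
exact: derive1_cst.
Qed.

(** * Necessity of the four conditions *)

Section Forward.
Hypothesis hsub : lie_subalgebroid (vQ X) L D U.

Lemma sub_anchor_kills e f : D e -> Cinf f -> (forall q, U q -> f q = 0) -> anchor L e f = 0.
Proof. by move=> De; have [_ /(_ e De) H _] := hsub; exact: curve_kills H. Qed.

Lemma sub_bracket b b' q : GammaB b -> (forall m, B' (b m)) ->
  GammaB b' -> (forall m, B' (b' m)) -> U q ->
  D (bracket L (sigmaB Sg b) (sigmaB Sg b') q).
Proof.
move=> gb bB gb' bB' Uq; have [_ _ H] := hsub; apply: H => //.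
- exact: (Gamma_sigmaB hg hS).
- exact: (Gamma_sigmaB hg hS).
- by move=> q' Uq'; exact: sigmaB_D.
- by move=> q' Uq'; exact: sigmaB_D.
Qed.

Lemma sub_conditions :
  [/\ (forall tau, annihilator U tau -> U (dQ tau)),
      (forall u b, Gamma pQ u -> (forall m, U (u m)) ->
         GammaB b -> (forall m, B' (b m)) -> forall m, U (nablaQ b u m)),
      (forall b1 b2, GammaB b1 -> (forall m, B' (b1 m)) ->
         GammaB b2 -> (forall m, B' (b2 m)) -> forall m, B' (bracket LB b1 b2 m)) &
      (forall b1 b2, GammaB b1 -> (forall m, B' (b1 m)) ->
         GammaB b2 -> (forall m, B' (b2 m)) ->
         forall q, U q -> annihilator U (Rc (b1 (pQ q)) (b2 (pQ q)) q))].
Proof.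
have U0 m : U (vzero (qQ X) m) by exact: (subbundle_zero (dvb_qQ hX)).
split.
- move=> tau atau; set m := dbase tau.
  (* The extension xi is only known to annihilate U at m. This suffices, as its core section is used
     at the zero vector over m alone. *)
  have [xi gxi xim] := cosection_through (dvb_qQ hX) (Defs.dlin tau).
  have tauE : xi m = tau.
    apply: dual_ext; first exact: gxi.2.
    by move=> e _ pe; apply: xim; rewrite pe; exact: gxi.2.
  have [c gc bc] := exists_core_section hg hS gxi.
  have pdQ : pQ (dQ tau) = m by case: hrep => -[[_ _ H _ _] _ _ _] _ _ _ _; exact: H.
  apply: (subbundle_separated (dvb_qQ hX) subU) => eta geta Ceta keta.
  have pz : pQ (vzero (qQ X) m) = m by exact: (proj_zero fqQ).
  have := vertical_anchor (vzero (qQ X) m) gxi gc bc geta Ceta.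
  rewrite pz tauE pdQ => <-; apply: sub_anchor_kills => //.
  by apply: (core_section_D gxi gc bc) => //; rewrite pz tauE.
- move=> u b gu uU gb bB m.
  have pn : pQ (nablaQ b u m) = m.
    by case: hrep => -[_ [H _ _ _ _] _ _] _ _ _ _; exact: (H b u gb gu).2.
  apply: (subbundle_separated (dvb_qQ hX) subU) => eta geta Ceta keta; rewrite pn.
  have := horizontal_anchor_kills m gb gu uU geta keta.
  rewrite sub_anchor_kills //; last exact: sigmaB_D.
  by move/eqP; rewrite eq_sym oppr_eq0 => /eqP.
- move=> b1 b2 gb1 b1B gb2 b2B m.
  (* The bracket is evaluated at the zero vector over m, a point of U present in every fibre. *)
  have := D_prB hD (sub_bracket gb1 b1B gb2 b2B (U0 m)).
  by rewrite (bracket_sigma _ gb1 gb2).1 (proj_zero fqQ).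
- move=> b1 b2 gb1 b1B gb2 b2B q Uq q' Uq' pq'.
  have De := sub_bracket gb1 b1B gb2 b2B Uq.
  have [_ brl] := bracket_sigma q gb1 gb2.
  have pbr : prQ (bracket L (sigmaB Sg b1) (sigmaB Sg b2) q) = q.
    exact: (bracket_Gamma hL (Gamma_sigmaB hg hS gb1) (Gamma_sigmaB hg hS gb2)).2.
  have pqq : pQ q' = pQ q.
    rewrite pq'; have [[_ _ _ [Rt _ _ _ _]] _ _ _ _] := hrep.
    by have [|+ _] := Rt (b1 (pQ q)) (b2 (pQ q)) q; first by rewrite /= gb1.2 gb2.2.
  have Ubr : U (prQ (bracket L (sigmaB Sg b1) (sigmaB Sg b2) q)) by rewrite pbr.
  have [_ /(_ q' Uq')] := (D_iff Ubr).1 De.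
  rewrite pbr brl // => /(_ pqq) /eqP.
  by rewrite oppr_eq0 => /eqP.
Qed.

End Forward.

(** * Sufficiency of the four conditions *)

Section Backward.
Hypothesis h1 : forall tau, annihilator U tau -> U (dQ tau).
Hypothesis h2 : forall u b, Gamma pQ u -> (forall m, U (u m)) ->
   GammaB b -> (forall m, B' (b m)) -> forall m, U (nablaQ b u m).
Hypothesis h3 : forall b1 b2, GammaB b1 -> (forall m, B' (b1 m)) ->
   GammaB b2 -> (forall m, B' (b2 m)) -> forall m, B' (bracket LB b1 b2 m).
Hypothesis h4 : forall b1 b2, GammaB b1 -> (forall m, B' (b1 m)) ->
   GammaB b2 -> (forall m, B' (b2 m)) ->
   forall q, U q -> annihilator U (Rc (b1 (pQ q)) (b2 (pQ q)) q).

Lemma annihilator_dQ (tau : Qdual X) (eta : tM X -> Qdual X) m : annihilator U tau ->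
  dbase tau = m -> kills_sub U eta -> eta m (dQ tau) = 0.
Proof.
move=> atau tm keta; have := keta _ (h1 atau).
suff -> : pQ (dQ tau) = m by [].
by case: hrep => -[[_ _ H _ _] _ _ _] _ _ _ _; rewrite H.
Qed.

Lemma anchor_in_U e : D e -> exists gamma,
  [/\ curve_at (prQ e) gamma, forall t, U (gamma t) & represents gamma (anchor L e)].
Proof.
move=> De; set q := prQ e; have Uq : U q by exact: (D_prQ hD).
apply: (tangent_subbundle (dvb_qQ hX) subU Uq (anchor_tangent hL e)) => eta geta Ceta keta.
set m := pQ q.
have [Be le] := (D_iff Uq).1 De.
have [b [gb bB bm]] := subbundle_section (dvb_qB hX) subB' Be.
have [u [gu uU um]] := subbundle_section (dvb_qQ hX) subU Uq.
have [tau gtau taum] := cosection_through (dvb_qQ hX) (covec_linear hg hS e).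
rewrite -/q -/m in taum um.
have [c gc bc] := exists_core_section hg hS gtau.
rewrite (pB_prB hX) -/q -/m in bm.
have atau : annihilator U (tau m).
  move=> q' Uq' pq'; have pq'm : pQ q' = m by rewrite pq'; exact: gtau.2.
  by rewrite taum // le.
have gs := Gamma_sigmaB hg hS gb; have gcs := Gamma_core_section hg gc.
have qq : prQ (sigmaB Sg b q) = prQ (core_section c q) by rewrite gs.2 gcs.2.
(* The lift has the B-component of e and no covector, the core section has the covector and no
   B-component. Condition (2) handles the anchor of the former, condition (1) that of the latter. *)
have -> : e = sigmaB Sg b q +Q core_section c q.
  apply: (covec_inj hg hS).
  - by rewrite (proj_add fQ) // gs.2.
  - rewrite (prB_addQ hX) // (sigmaB_prB hS) // (core_section_prB hg) // bm.
    by rewrite (vaddr0 fqB) // (pB_prB hX).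
  move=> q' q'm; rewrite (covecD hg hS qq) ?gs.2 //.
  by rewrite (covec_Sg hS) ?gb.2 // add0r (core_section_covec hg hS) // bc taum.
rewrite (anchorD hL) // (vertical_anchor q gtau gc bc geta Ceta) -/m.
rewrite (annihilator_dQ atau (gtau.2 m) keta) addr0 -um.
rewrite (horizontal_anchor_kills m gb gu uU geta keta).
have := keta _ (h2 gu uU gb bB m).
have -> : pQ (nablaQ b u m) = m.
  by case: hrep => -[_ [H _ _ _ _] _ _] _ _ _ _; exact: (H b u gb gu).2.
by move=> ->; rewrite oppr0.
Qed.

Lemma anchor_kills e f : D e -> Cinf f -> (forall q, U q -> f q = 0) -> anchor L e f = 0.
Proof. by move=> De; exact: curve_kills (anchor_in_U De). Qed.

(* Up to sections vanishing on U, these generate the sections of E -> Q that take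
   values in D on U. *)
Definition D_generator (S : tQ X -> tE X) :=
  (exists b, [/\ GammaB b, forall m, B' (b m) & S = sigmaB Sg b]) \/
  (exists c tau, [/\ Gamma_core c, @GammaQdual _ X tau, forall m, annihilator U (tau m),
     forall m, beta_core g (c m) = tau m & S = core_section c]).

Lemma D_generator_Gamma S : D_generator S -> Gamma prQ S.
Proof.
move=> [[b [gb _ ->]]|[c [tau [gc _ _ _ ->]]]]; first exact: (Gamma_sigmaB hg hS).
exact: (Gamma_core_section hg gc).
Qed.

Lemma D_generator_D S q : D_generator S -> U q -> D (S q).
Proof.
move=> [[b [gb bB ->]]|[c [tau [gc gtau atau bc ->]]]] Uq; first exact: sigmaB_D.
exact: (core_section_D gtau gc bc).
Qed.

Lemma bracketC_D s s' q : Gamma prQ s -> Gamma prQ s' -> D (bracket L s s' q) ->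
  D (bracket L s' s q).
Proof.
by move=> gs gs' Dss'; rewrite (bracketC hL) //; exact: (D_scQ hg hS hD hA).
Qed.

(** By duality, the derivative of tau applied to a section u of U is the derivative of tau(u) = 0
    minus tau of a section which (2) keeps in U. *)
Lemma bracket_sigma_core_D b c (tau : tM X -> Qdual X) q : GammaB b -> (forall m, B' (b m)) ->
  Gamma_core c -> @GammaQdual _ X tau -> (forall m, annihilator U (tau m)) ->
  (forall m, beta_core g (c m) = tau m) -> U q ->
  D (bracket L (sigmaB Sg b) (core_section c) q).
Proof.
move=> gb bB gc gtau atau bc Uq.
have [[_ _ [GN _ _ _ _] _] _ _ H4 _] := hrep.
have [c' [gc' bc' ->]] := H4 b tau c gb gtau gc bc.
apply: (core_section_D (GN b tau gb gtau) gc' bc') => // q' Uq' pq'.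
have [u [gu uU uq']] := subbundle_section (dvb_qQ hX) subU Uq'.
have pm : pQ q' = pQ q by rewrite pq'; exact: (GN b tau gb gtau).2.
rewrite -uq' pm (nabla_dual hE hS hrep) //.
have tau0 m x : U x -> pQ x = m -> tau m x = 0.
  by move=> Ux xm; rewrite atau // xm; exact/esym/gtau.2.
have -> : (fun x => tau x (u x)) = fun=> 0.
  by apply/funext => x; apply: tau0 => //; exact: gu.2.
rewrite /anchorS (anchor_cst0 hLB) tau0 ?subrr //; first exact: h2.
by case: hrep => -[_ [H _ _ _ _] _ _] _ _ _ _; exact: (H b u gb gu).2.
Qed.

Lemma D_generator_bracket S S' q : D_generator S -> D_generator S' -> U q -> D (bracket L S S' q).
Proof.
move=> gS gS' Uq.
case: (gS) (gS') => [[b [gb bB SE]]|[c [tau [gc gtau atau bc SE]]]]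
  [[b' [gb' bB' SE']]|[c' [tau' [gc' gtau' atau' bc' SE']]]].
- have gg := bracket_Gamma hL (D_generator_Gamma gS) (D_generator_Gamma gS').
  have [brB brl] := bracket_sigma q gb gb'; rewrite -SE -SE' in brB brl.
  apply/D_iff; rewrite gg.2 // brB; split; first exact: h3.
  move=> u Uu uq; rewrite brl // h4 ?oppr0 // uq.
  have [[_ _ _ [Rt _ _ _ _]] _ _ _ _] := hrep.
  by have [|RE _] := Rt (b (pQ q)) (b' (pQ q)) q; [rewrite /= gb.2 gb'.2|exact: esym RE].
- by rewrite SE SE'; exact: bracket_sigma_core_D gc' gtau' atau' bc' Uq.
- apply: bracketC_D; [exact: D_generator_Gamma|exact: D_generator_Gamma|].
  by rewrite SE SE'; exact: bracket_sigma_core_D gc gtau atau bc Uq.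
- case: hE => _ [_ _ _ [_ _ H]] _.
  by rewrite SE SE' H //; exact: (D_zero hg hS hD hA).
Qed.

(** Leibniz gives f [s, S] plus the derivative of f along the anchor of s, times S. If f vanishes on
    U, both coefficients are 0 at q, because that anchor is tangent to U. *)
Lemma bracket_scale_D s S f q : Gamma prQ s -> (forall x, U x -> D (s x)) ->
  Gamma prQ S -> Cinf f -> U q ->
  (D (bracket L s S q) /\ D (S q)) \/ (forall x, U x -> f x = 0) ->
  D (bracket L s (scaleS (vQ X) f S) q).
Proof.
move=> gs sD gS Cf Uq H; rewrite (bracket_leibniz hL) // /addS /scaleS.
have gb := bracket_Gamma hL gs gS.
case: H => [[DD DS]|f0].
  apply: (D_addQ hg hS hD hA); [exact: (D_scQ hg hS hD hA)..|].
  by rewrite !(proj_scale fQ) gb.2 gS.2.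
rewrite /anchorS (f0 q Uq) (anchor_kills (sD q Uq) Cf f0).
rewrite (vscale0 fQ (gb.2 q)) (vscale0 fQ (gS.2 q)) (vaddr0 fQ) ?(proj_zero fQ) //.
exact: (D_zero hg hS hD hA).
Qed.

Lemma bracket_sum_D s (I : Type) (r : seq I) f (S : I -> tQ X -> tE X) q :
  Gamma prQ s -> (forall x, U x -> D (s x)) -> (forall i, Gamma prQ (S i)) ->
  (forall i, Cinf (f i)) -> U q ->
  (forall i, (D (bracket L s (S i) q) /\ D (S i q)) \/ (forall x, U x -> f i x = 0)) ->
  D (bracket L s (sumS (vQ X) r f S) q).
Proof.
move=> gs sD gS Cf Uq H; elim: r => [|i r IH].
  (* The empty sum is written as 0 times a section so that the previous lemma covers it. *)
  have -> : sumS (vQ X) [::] f S = scaleS (vQ X) (fun=> 0) zQ.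
    by apply/funext => x; rewrite /scaleS (vscale_zero fQ).
  apply: bracket_scale_D => //; [exact: (Gamma_zero (dvb_vQ hX))|exact: Cinf_cst|by right].
have gr := Gamma_sumS hL r Cf gS.
have gi := Gamma_scale (dvb_vQ hX) (Cf i) (gS i).
have -> : sumS (vQ X) (i :: r) f S =
  addS (vQ X) (scaleS (vQ X) (f i) (S i)) (sumS (vQ X) r f S) by [].
rewrite (bracketD hL) //; apply: (D_addQ hg hS hD hA) => //.
  exact: bracket_scale_D.
by rewrite (bracket_Gamma hL gs gi).2 (bracket_Gamma hL gs gr).2.
Qed.

Lemma bracket_extend s s' q : Gamma prQ s -> (forall x, U x -> D (s x)) ->
  Gamma prQ s' -> (forall x, U x -> D (s' x)) -> U q ->
  (forall S, D_generator S -> D (bracket L s S q)) -> D (bracket L s s' q).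
Proof.
move=> gs sD gs' s'D Uq Hgen; pose m0 := pQ q.
have [_ [kQ [rQ HtQ]]] := subU; have [_ [kB [rB HtB]]] := subB'.
have [WQ [tq [coQ [trQ WQm HU]]]] := HtQ m0 I.
have [WB [tb [coB [trB WBm HB]]]] := HtB m0 I.
have [chi bchi chi1] := exists_bump cM (openDI (triv_open trQ) (triv_open trB)) (conj WQm WBm).
have bQ : bump_on WQ chi by apply: bump_onW bchi => x [].
have bB : bump_on WB chi by apply: bump_onW bchi => x [].
have spQ : smooth pQ by case: (dvb_qQ hX).
have sprB : smooth prB by case: (dvb_vB hX).
pose b i := cut_section (qB X) WB tb chi (delta_mx 0 i).
have gb i : GammaB (b i) by exact: (Gamma_cut (dvb_qB hX) trB bB).
pose u j := cut_section (qQ X) WQ tq chi (delta_mx 0 j).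
have gu j : Gamma pQ (u j) by exact: (Gamma_cut (dvb_qQ hX) trQ bQ).
pose tau (j : 'I_kQ) : tM X -> Qdual X :=
  cut_cosection (qQ X) coQ chi (fun i => (i == j)%:R).
have gtau j : @GammaQdual _ X (tau j) by exact: (Gamma_cut_cosection (dvb_qQ hX) trQ bQ).
have [c gc bc] : exists2 c : 'I_kQ -> tM X -> tE X, forall j, Gamma_core (c j) &
    forall j m, beta_core g (c j m) = tau j m.
  have /choice[c Hc] : forall j, exists c, Gamma_core c /\ forall m, beta_core g (c m) = tau j m.
    by move=> j; have [c ? ?] := exists_core_section hg hS (gtau j); exists c.
  by exists c => j; [have [] := Hc j|have [_] := Hc j].
pose f i q := cut_form (qB X) coB chi (fun i' => (i' == i)%:R) (prB (s' q)).
have Cf i : Cinf (f i).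
  exact: (smooth_comp gs'.1 sprB (Cinf_cut_form (dvb_qB hX) trB bB _)).
pose h j q := lam (s' q) (u j (pQ q)).
have Ch j : Cinf (h j) by exact: covec_smooth.
have gsig i := Gamma_sigmaB hg hS (gb i).
have gcs j := Gamma_core_section hg (gc j).
pose s1 := sumS (vQ X) (enum 'I_kB) f (fun i => sigmaB Sg (b i)).
pose s2 := sumS (vQ X) (enum 'I_kQ) h (fun j => core_section (c j)).
have gs1 : Gamma prQ s1 := Gamma_sumS hL _ Cf gsig.
have gs2 : Gamma prQ s2 := Gamma_sumS hL _ Ch gcs.
pose chi2 x := chi (pQ x) * chi (pQ x).
have Cchi2 : Cinf chi2 by apply: (Cinf_mul cQ); apply: spQ; exact: bchi.1.
(* One factor chi cuts off the coordinates, the other one the frames, so that the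
   identity holds on all of Q. *)
have decomp : scaleS (vQ X) chi2 s' = addS (vQ X) s1 s2.
  apply/funext => x; set m := pQ x.
  have px : pB (prB (s' x)) = m by rewrite (pB_prB hX) gs'.2.
  have fx i : f i x = chi m * coB (prB (s' x)) 0 i by rewrite /f cut_form_coord px.
  have ls' := covec_linear hg hS (s' x); rewrite gs'.2 -/m in ls'.
  have [[WQx WBx]|Wx] := pselect ((WQ `&` WB) m); last first.
    have chi0 := bump_on0 bchi Wx.
    rewrite /addS /scaleS /s1 /s2 (sumS_eq0 hL) => [|i|i]; first last.
    - by rewrite fx chi0 mul0r.
    - exact: (gsig i).2.
    rewrite (sumS_eq0 hL) => [|j|j]; first last.
    - by rewrite /h /u (cut_section0 (dvb_qQ hX) trQ) // (linear_at_zero fqQ ls').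
    - exact: (gcs j).2.
    by rewrite /chi2 -/m chi0 mul0r (vscale0 fQ (gs'.2 x)) (vaddr0 fQ) // (proj_zero fQ).
  have p12 : prQ (s1 x) = prQ (s2 x) by rewrite gs1.2 gs2.2.
  (* The two sums do not interfere: s2 has zero B-component and s1 has zero covector. *)
  rewrite /addS /scaleS; apply: (covec_inj hg hS).
  - by rewrite (proj_scale fQ) (proj_add fQ) // gs1.2 gs'.2.
  - have pm1 : pB (prB (s1 x)) = m by rewrite (pB_prB hX) gs1.2.
    have pm2 : pB (prB (s2 x)) = m by rewrite (pB_prB hX) gs2.2.
    rewrite (prB_scQ hX) (prB_addQ hX) //.
    rewrite -[LHS](triv_coordK trB WBx) ?(proj_scale fqB) //.
    rewrite -[RHS](triv_coordK trB WBx) ?(proj_add fqB) ?pm1 //; congr (tb m _).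
    rewrite (coordZ trB) ?px // (coordD trB) ?pm1 ?pm2 //.
    apply/rowP => j; rewrite !mxE.
    have lj : linear_at (vQ X) setT x (fun e => coB (prB e) 0 j).
      split=> [e e' _ _ ex e'x|a e _ ex].
        have eWB : WB (pB (prB e)) by rewrite (pB_prB hX) ex.
        rewrite (prB_addQ hX) ?ex ?e'x // (coordD trB) // ?mxE //.
        by rewrite !(pB_prB hX) ex e'x.
      by rewrite (prB_scQ hX) (coordZ trB) ?mxE // (pB_prB hX) ex.
    have [_ ->] := linear_sumS hL (enum 'I_kB) f (S := fun i => sigmaB Sg (b i)) (fun i => (gsig i).2 x) lj.
    have [_ ->] := linear_sumS hL (enum 'I_kQ) h (S := fun j => core_section (c j)) (fun i => (gcs i).2 x) lj.
    rewrite [X in _ = _ + X]big1 ?addr0 => [|i _]; last first.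
      by rewrite (core_section_prB hg) // (coord0 fqB trB) // mxE mulr0.
    rewrite big_enum /= (bigD1 j) //= big1 ?addr0 => [|i ij].
      rewrite (sigmaB_prB hS) // /b cut_sectionT // (triv_coord trB) // fx !mxE !eqxx /chi2 -/m.
      by rewrite mulr1 mulrAC.
    rewrite (sigmaB_prB hS) // /b cut_sectionT // (triv_coord trB) // !mxE !eqxx /=.
    by rewrite eq_sym (negbTE ij) !mulr0.
  move=> q'; rewrite (proj_scale fQ) gs'.2 -/m => q'm.
  rewrite (covecZ hg hS) ?gs'.2 // (covecD hg hS p12) ?gs1.2 //.
  have lq : linear_at (vQ X) setT x (fun e => lam e q').
    split=> [e e' _ _ ex e'x|a e _ ex].
      by rewrite (covecD hg hS) ?ex ?e'x.
    by rewrite (covecZ hg hS) ?ex.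
  have [_ ->] := linear_sumS hL (enum 'I_kB) f (S := fun i => sigmaB Sg (b i)) (fun i => (gsig i).2 x) lq.
  have [_ ->] := linear_sumS hL (enum 'I_kQ) h (S := fun j => core_section (c j)) (fun i => (gcs i).2 x) lq.
  rewrite [X in _ = X + _]big1 ?add0r => [|i _]; last first.
    by rewrite (covec_Sg hS) ?(gb i).2 // mulr0.
  rewrite -{1}(triv_coordK trQ WQx q'm) (triv_expand fqQ trQ _ WQx ls') mulr_sumr.
  rewrite [RHS]big_enum /=; apply: eq_bigr => j _.
  rewrite (core_section_covec hg hS) // bc -/m /h -/m /u cut_sectionT // (trivZ trQ) //.
  rewrite ls'.2 ?(triv_proj trQ) // -q'm (cut_cosection_coord (dvb_qQ hX) trQ bQ) q'm /chi2 -/m.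
  by ring.
have Dsum : D (bracket L s (scaleS (vQ X) chi2 s') q).
  rewrite decomp (bracketD hL) //; apply: (D_addQ hg hS hD hA).
  - apply: bracket_sum_D => // i.
    (* The first rB frame sections lie in B' and have generators as lifts; the other coordinates of
       the B-component of s' vanish over U. *)
    have [ir|ri] := ltnP i rB; [left|right].
      have gi : D_generator (sigmaB Sg (b i)).
        left; exists (b i); split=> // m; apply: (cut_section_sub (c := coB) (r := rB)) ir => //.
          exact: (subbundle_zero (dvb_qB hX)).
        by move=> e We He; apply/HB.
      by split; [exact: Hgen|exact: D_generator_D].
    move=> x Ux; rewrite /f cut_form_coord.
    have [Wx|Wx] := pselect (WB (pB (prB (s' x)))); last by rewrite (bump_on0 bB Wx) mul0r.
    by rewrite ((HB _ Wx I).1 _) ?mulr0 //; apply: (D_prB hD); exact: s'D.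
  - apply: bracket_sum_D => // j.
    (* The roles are exchanged for covectors: the first rQ frame sections lie in U, where the
       covector of s' vanishes, and the remaining dual frame annihilates U. *)
    have [jr|rj] := ltnP j rQ; [right|left].
      move=> x Ux; have Ds := s'D x Ux; have Ux' : U (prQ (s' x)) by rewrite gs'.2.
      have [_ lx] := (D_iff Ux').1 Ds; apply: lx; last by rewrite (gu j).2 gs'.2.
      apply: (cut_section_sub (c := coQ) (r := rQ)) jr => //; first exact: (subbundle_zero (dvb_qQ hX)).
      by move=> e We He; apply/HU.
    have kj := kills_cut_cosection (dvb_qQ hX) trQ bQ (fun e We Ue => (HU e We I).1 Ue) rj.
    have gj : D_generator (core_section (c j)).
      right; exists (c j), (tau j); split=> // m q' Uq' pq'.
      have q'm : pQ q' = m by rewrite pq'; exact: (gtau j).2.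
      by rewrite -q'm; exact: kj.
    by split; [exact: Hgen|exact: D_generator_D].
  - by rewrite (bracket_Gamma hL gs gs1).2 (bracket_Gamma hL gs gs2).2.
have gss' := bracket_Gamma hL gs gs'.
rewrite (bracket_leibniz hL) // /addS /scaleS in Dsum.
have chi21 : chi2 q = 1 by rewrite /chi2 chi1 mulr1.
rewrite chi21 (vscale1 fQ) in Dsum.
(* Differentiating the bump leaves the term a s'(q). It lies in D, so it can be subtracted. *)
set a := anchorS _ _ _ _ in Dsum.
have Das : D (vscale (vQ X) (- a) (s' q)).
  by apply: (D_scQ hg hS hD hA); exact: s'D.
have -> : bracket L s s' q = bracket L s s' q +Q a *Q s' q +Q (- a) *Q s' q.
  rewrite -(vaddA fQ) ?(proj_scale fQ) ?gss'.2 ?gs'.2 //.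
  by rewrite -(vscaleDl fQ) subrr (vscale0 fQ (gs'.2 q)) (vaddr0 fQ) // gss'.2.
apply: (D_addQ hg hS hD hA) => //.
by rewrite (proj_add fQ) !(proj_scale fQ) ?gss'.2 ?gs'.2.
Qed.

(** The reduction to generators is applied once in each argument, with skew-symmetry exchanging
    them. *)
Lemma bracket_in_D s s' : Gamma prQ s -> Gamma prQ s' ->
  (forall q, U q -> D (s q)) -> (forall q, U q -> D (s' q)) ->
  forall q, U q -> D (bracket L s s' q).
Proof.
move=> gs gs' sD s'D q Uq; apply: bracket_extend => // S gS.
have GS := D_generator_Gamma gS.
apply: bracketC_D => //; apply: bracket_extend => //.
  by move=> x Ux; exact: D_generator_D.
by move=> S' gS'; exact: D_generator_bracket.
Qed.

End Backward.

End Subalgebroid.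

Theorem proposition8p9 (R : realType) (X : dvb R) (g : tE X -> tE X -> R)
    (L : lie_ops (tE X) (tQ X)) (LB : lie_ops (tB X) (tM X))
    (D : set (tE X)) (U : set (tQ X)) (B' : set (tB X))
    (Sg : tQ X -> tB X -> tE X)
    (dQ : Qdual X -> tQ X)
    (nablaQ : (tM X -> tB X) -> (tM X -> tQ X) -> (tM X -> tQ X))
    (nablaQd : (tM X -> tB X) -> (tM X -> Qdual X) -> (tM X -> Qdual X))
    (Rc : tB X -> tB X -> tQ X -> Qdual X)
    (hE : metric_vb_algebroid g L LB)
    (hD : maximal_isotropic_dvb g D U B')
    (hSg : lagrangian_splitting g Sg)
    (hSgD : adapted Sg D U B')
    (hrep : two_representation g L LB Sg dQ nablaQ nablaQd Rc) :
  lie_subalgebroid (vQ X) L D U <->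
  [/\ (forall tau, annihilator U tau -> U (dQ tau)),
      (forall u b, Gamma (vproj (qQ X)) u -> (forall m, U (u m)) ->
         Gamma (vproj (qB X)) b -> (forall m, B' (b m)) ->
         forall m, U (nablaQ b u m)),
      (forall b1 b2, Gamma (vproj (qB X)) b1 -> (forall m, B' (b1 m)) ->
         Gamma (vproj (qB X)) b2 -> (forall m, B' (b2 m)) ->
         forall m, B' (bracket LB b1 b2 m)) &
      (forall b1 b2, Gamma (vproj (qB X)) b1 -> (forall m, B' (b1 m)) ->
         Gamma (vproj (qB X)) b2 -> (forall m, B' (b2 m)) ->
         forall q, U q ->
           annihilator U (Rc (b1 (vproj (qQ X) q)) (b2 (vproj (qQ X) q)) q))].
Proof.
split=> [hsub|[h1 h2 h3 h4]].
  exact: (sub_conditions hE hD hSg hSgD hrep hsub).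
split; first by case: hD => -[].
  exact: (anchor_in_U hE hD hSg hSgD hrep h1 h2).
exact: (bracket_in_D hE hD hSg hSgD hrep h1 h2 h3 h4).
Qed.
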